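(* Consider the distributed online linear quadratic control problem and the algorithm $\mathcal{A}$ (Online Distributed LQ Control) described in the context, with $m$ agents, system matrices $\mathbf{A}\in\mathbb{R}^{d\times d}$, $\mathbf{B}\in\mathbb{R}^{d\times k}$, noise covariance $\mathbf{W}$, communication matrix $\mathbf{P}$ with second largest singular value $\beta$, and cost matrices $\mathbf{Q}_{i,t},\mathbf{R}_{i,t}$ with $\mathrm{Tr}(\mathbf{Q}_{i,t}),\mathrm{Tr}(\mathbf{R}_{i,t})\le C$. Assume that the network is connected, $\mathrm{Tr}(\mathbf{W})\le\lambda^2$ and $\mathbf{W}\succeq\sigma^2\mathbf{I}$ (with $\lambda,\sigma>0$). Given $\kappa>1$ and $0<\gamma<1$, set $\nu=2\kappa^4\lambda^2/\gamma$ and $\eta=1/\sqrt{\rho T}$, where $$\rho=4mC^2\left(3+\frac{4\sqrt{m}}{1-\beta}\right)+mC\left(1+\frac{\nu}{\sigma^2}\right)\frac{16\sqrt{2m}\,C\nu}{(1-\beta)\sigma^2}.$$ Then, when $\mathcal{A}$ is run with parameters $\nu$ and $\eta$, for every agent $j\in\{1,\dots,m\}$ and every $(\kappa,\gamma)$-strongly stable controller $\mathbf{K}^s\in\mathbb{R}^{k\times d}$ for $(\mathbf{A},\mathbf{B})$, the expected individual regret of agent $j$ with respect to $\mathbf{K}^s$ satisfies $$J_T^j(\mathcal{A})-J_T(\mathbf{K}^s)=O\left((1-\beta)^{-1/2}\sqrt{T}\right)$$ for all $T\ge\left(\frac{4\sqrt{2m}\,\nu C}{\sigma^4(1-\bet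a)\rho^{1/2}}\right)^2$.
   Context: **Notation.** $\|\cdot\|$ is the Euclidean norm of a vector or spectral norm of a matrix; $\mathbf{X}\succeq\mathbf{Y}$ means $\mathbf{X}-\mathbf{Y}$ is positive semidefinite. A matrix $\Sigma\in\mathbb{R}^{(d+k)\times(d+k)}$ is written in blocks $\Sigma=\begin{pmatrix}\Sigma_{\mathbf{x}\mathbf{x}}&\Sigma_{\mathbf{x}\mathbf{u}}\\ \Sigma_{\mathbf{u}\mathbf{x}}&\Sigma_{\mathbf{u}\mathbf{u}}\end{pmatrix}$ with $\Sigma_{\mathbf{x}\mathbf{x}}\in\mathbb{R}^{d\times d}$ and $\Sigma_{\mathbf{u}\mathbf{u}}\in\mathbb{R}^{k\times k}$. **System.** There are $m$ agents with identical dynamics $\mathbf{x}_{i,t+1}=\mathbf{A}\mathbf{x}_{i,t}+\mathbf{B}\mathbf{u}_{i,t}+\mathbf{w}_{i,t}$, $i\in\{1,\dots,m\}$, with states $\mathbf{x}_{i,t}\in\mathbb{R}^d$ and controls $\mathbf{u}_{i,t}\in\mathbb{R}^k$. The noises $\mathbf{w}_{i,t}\sim\mathcal{N}(0,\mathbf{W})$, $\mathbf{W}\succ0$, are independent over time and agents (and of the initial states). The matrices $\mathbf{A},\mathbf{B},\mathbf{W}$ are known. **Costs.** For each agent $i$ and round $t$ there are positive definite matrices $\mathbf{Q}_{i,t}\in\mathbb{R}^{d\times d}$, $\mathbf{R}_{i,t}\in\mathbb{R}^{k\times k}$, forming arbitrary (non-random) sequences, with $\mathrm{Tr}(\mathbf{Q}_{i,t}),\mathrm{Tr}(\mathbf{R}_{i,t})\le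 C$ for all $i,t$ and some $C>0$. They are revealed to agent $i$ only after $\mathbf{u}_{i,t}$ has been chosen. Put $\mathbf{Q}_t=\sum_{i=1}^m\mathbf{Q}_{i,t}$ and $\mathbf{R}_t=\sum_{i=1}^m\mathbf{R}_{i,t}$. **Network.** $\mathbf{P}\in\mathbb{R}^{m\times m}$ is a time-invariant doubly stochastic matrix with $[\mathbf{P}]_{ji}>0$ if agent $j$ communicates with agent $i$ and $[\mathbf{P}]_{ji}=0$ otherwise. The network is connected, $\beta\in[0,1)$ is the second largest singular value of $\mathbf{P}$, and the mixing bound $\sum_{j=1}^m\left|[\mathbf{P}^n]_{ji}-1/m\right|\le\sqrt{m}\,\beta^n$ holds for every $i$ and every positive integer $n$. **Strong stability.** A matrix (linear policy $\mathbf{u}=\mathbf{K}\mathbf{x}$) $\mathbf{K}\in\mathbb{R}^{k\times d}$ is $(\kappa,\gamma)$-strongly stable (for $\kappa>0$, $0<\gamma\le1$) for $(\mathbf{A},\mathbf{B})$ if $\|\mathbf{K}\|\le\kappa$ and there exist matrices $\mathbf{L},\mathbf{H}$ (with $\mathbf{H}$ invertible) such that $\mathbf{A}+\mathbf{B}\mathbf{K}=\mathbf{H}\mathbf{L}\mathbf{H}^{-1}$, $\|\mathbf{L}\|\le1-\gamma$ and $\|\mathbf{H}\|\,\|\mathbf{H}^{-1}\|\le\kappa$. **Algorithm $\mathcal{A}$ (Online Distributed LQ Control)** with parameters $\nu,\eta>0$ and horizon $T$. Let $$\mathcal{S}=\left\{\Sigma\in\mathbb{R}^{(d+k)\times(d+k)}:\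 \Sigma\succeq0,\ \mathrm{Tr}(\Sigma)\le\nu,\ \Sigma_{\mathbf{x}\mathbf{x}}=(\mathbf{A}\ \mathbf{B})\,\Sigma\,(\mathbf{A}\ \mathbf{B})^\top+\mathbf{W}\right\}$$ and let $\Pi_{\mathcal{S}}$ be the Euclidean (Frobenius norm) projection onto $\mathcal{S}$. Initialize all $\Sigma_{i,1}$ identically at one point of $\mathcal{S}$, and draw each $\mathbf{x}_{i,1}$ from a mean-zero normal distribution. For $t=1,\dots,T$, each agent $i$: 1. receives $\mathbf{x}_{i,t}$; 2. computes $\mathbf{K}_{i,t}=(\Sigma_{i,t})_{\mathbf{u}\mathbf{x}}(\Sigma_{i,t})_{\mathbf{x}\mathbf{x}}^{-1}$ and $\mathbf{V}_{i,t}=(\Sigma_{i,t})_{\mathbf{u}\mathbf{u}}-\mathbf{K}_{i,t}(\Sigma_{i,t})_{\mathbf{x}\mathbf{x}}\mathbf{K}_{i,t}^\top$; 3. plays $\mathbf{u}_{i,t}\sim\mathcal{N}(\mathbf{K}_{i,t}\mathbf{x}_{i,t},\mathbf{V}_{i,t})$ (sampled with fresh randomness conditionally on the past), then observes $\mathbf{Q}_{i,t},\mathbf{R}_{i,t}$; 4. exchanges $\Sigma_{i,t}$ with its neighbors and sets $$\Sigma_{i,t+1}=\Pi_{\mathcal{S}}\left[\sum_{j=1}^m[\mathbf{P}]_{ji}\Sigma_{j,t}-\eta\begin{pmatrix}\mathbf{Q}_{i,t}&0\\0&\mathbf{R}_{i,t}\end{pmatrix}\right].$$ **Costs compared.** For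 agent $j$, with $\mathbf{x}_{j,t},\mathbf{u}_{j,t}$ generated by $\mathcal{A}$, $$J_T^j(\mathcal{A})=\mathbb{E}\left[\sum_{t=1}^T\left(\mathbf{x}_{j,t}^\top\mathbf{Q}_t\mathbf{x}_{j,t}+\mathbf{u}_{j,t}^\top\mathbf{R}_t\mathbf{u}_{j,t}\right)\right].$$ For a fixed linear controller $\mathbf{K}^s$, $$J_T(\mathbf{K}^s)=\mathbb{E}\left[\sum_{t=1}^T\left((\mathbf{x}_t^s)^\top\mathbf{Q}_t\mathbf{x}_t^s+(\mathbf{u}_t^s)^\top\mathbf{R}_t\mathbf{u}_t^s\right)\right],$$ where $\mathbf{u}_t^s=\mathbf{K}^s\mathbf{x}_t^s$, $\mathbf{x}_{t+1}^s=\mathbf{A}\mathbf{x}_t^s+\mathbf{B}\mathbf{u}_t^s+\mathbf{w}_t$ with $\mathbf{w}_t\sim\mathcal{N}(0,\mathbf{W})$ independent over time (and of the initial state). Expectations are over the noise, the initial states and the randomness of the policy. The distributions of the initial states $\mathbf{x}_{i,1}$ and $\mathbf{x}_1^s$ are fixed, independent of $T$, with finite second moments. **Meaning of $O(\cdot)$.** The hidden constant does not depend on $T$ or $\beta$, nor on the particular cost sequence; it may depend on $m,d,k,C,\kappa,\gamma,\lambda,\sigma$ (hence $\nu$) and on the second moments of the initial states. *)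

(* Defs.v *)
From mathcomp Require Import all_boot all_order all_algebra.
From mathcomp Require Import all_classical all_reals all_analysis.

Set Implicit Arguments.
Unset Strict Implicit.
Unset Printing Implicit Defensive.

Import Order.TTheory GRing.Theory Num.Theory.
Import numFieldNormedType.Exports.

Local Open Scope classical_set_scope.
Local Open Scope ring_scope.

Section Matrices.
Context {R : realType}.

(* On column vectors this is the Euclidean norm. The library norm `|M| is the
   sup norm of the entries. *)
Definition fronorm m n (M : 'M[R]_(m, n)) : R :=
  Num.sqrt (\sum_i \sum_j M i j ^+ 2).

Definition opnorm m n (M : 'M[R]_(m, n)) : R :=
  sup [set fronorm (M *m v) | v in [set v : 'cV[R]_n | fronorm v <= 1]].

Definition dotv n (a v : 'cV[R]_n) : R := (a^T *m v) ord0 ord0.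

Definition quad n (M : 'M[R]_n) (v : 'cV[R]_n) : R := dotv v (M *m v).

Definition psd n (M : 'M[R]_n) : Prop := M^T = M /\ forall v, 0 <= quad M v.

Definition posdef n (M : 'M[R]_n) : Prop :=
  M^T = M /\ forall v, v != 0 -> 0 < quad M v.

(* The singular values with multiplicity, in decreasing order: the nonnegative
   square roots of the eigenvalues of P^T P. *)
Definition singular_values n (P : 'M[R]_n) (s : seq R) : Prop :=
  [/\ sorted >=%R s, all (fun a => 0 <= a) s &
      char_poly (P^T *m P) = \prod_(a <- s) ('X - (a ^+ 2)%:P)].

(* A 1 x 1 matrix has second largest singular value 0, by the default value of
   nth. *)
Definition second_singular_value n (P : 'M[R]_n) (b : R) : Prop :=
  exists2 s, singular_values P s & b = s`_1.

Definition is_projection m n (S : set 'M[R]_(m, n)) (X Y : 'M[R]_(m, n)) : Prop :=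
  S Y /\ forall Z, S Z -> fronorm (Y - X) <= fronorm (Z - X).

End Matrices.

Section Control.
Context {R : realType} {d k : nat}.

Definition strongly_stable (A : 'M[R]_d) (B : 'M[R]_(d, k)) (kappa gamma : R)
    (K : 'M[R]_(k, d)) : Prop :=
  [/\ 0 < kappa, 0 < gamma <= 1, opnorm K <= kappa &
      exists L H : 'M[R]_d,
        [/\ H \in unitmx, A + B *m K = H *m L *m invmx H,
            opnorm L <= 1 - gamma & opnorm H * opnorm (invmx H) <= kappa]].

Definition feasible (A : 'M[R]_d) (B : 'M[R]_(d, k)) (W : 'M[R]_d) (nu : R) :
    set 'M[R]_(d + k) :=
  [set S | [/\ psd S, \tr S <= nu &
               ulsubmx S = row_mx A B *m S *m (row_mx A B)^T + W]].

Definition gain (S : 'M[R]_(d + k)) : 'M[R]_(k, d) :=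
  dlsubmx S *m invmx (ulsubmx S).

Definition policy_cov (S : 'M[R]_(d + k)) : 'M[R]_k :=
  drsubmx S - gain S *m ulsubmx S *m (gain S)^T.

End Control.

Section Network.
Context {R : realType} {m : nat}.

(* comm j i means that agent j communicates with agent i. The mixing bound
   follows from the other fields; it is listed as part of the setting. *)
Record network (comm : rel 'I_m) (P : 'M[R]_m) (beta : R) : Prop := Network {
  network_ge0 : forall j i, 0 <= P j i;
  network_row : forall j, \sum_i P j i = 1;
  network_col : forall i, \sum_j P j i = 1;
  network_pos : forall j i, comm j i -> 0 < P j i;
  network_zero : forall j i, ~~ comm j i -> P j i = 0;
  network_connected : forall j i, connect comm j i;
  network_beta : second_singular_value P beta;
  network_beta01 : 0 <= beta < 1;
  network_mixing : forall i n, (0 < n)%N ->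
    \sum_j `|(P ^+ n) j i - m%:R^-1| <= Num.sqrt m%:R * beta ^+ n }.

Definition admissible_costs d k (C : R) (Q : 'I_m -> nat -> 'M[R]_d)
    (Rc : 'I_m -> nat -> 'M[R]_k) : Prop :=
  forall i t, [/\ posdef (Q i t), posdef (Rc i t),
                  \tr (Q i t) <= C & \tr (Rc i t) <= C].

End Network.

Section Probability.
Context {R : realType}.

(* normal_prob takes a standard deviation, and for deviation 0 it is the uniform
   law on [0, 1]; a Gaussian law of variance 0 is a Dirac mass. *)
Definition gauss_law (mean var : R) (B : set R) : \bar R :=
  if var == 0 then \d_mean B else normal_prob mean (Num.sqrt var) B.

Context {disp : measure_display} {Omega : measurableType disp}.
Context (Pr : probability Omega R).

Definition random_vector n (X : Omega -> 'cV[R]_n) : Prop :=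
  forall l, measurable_fun setT (fun o => X o l ord0).

Definition sigma_of n (X : Omega -> 'cV[R]_n) : set (set Omega) :=
  g_sigma_preimage (fun (l : 'I_n) o => X o l ord0).

(* N(mean, V), with V possibly singular: every linear functional a^T X has law
   N(a^T mean, a^T V a). *)
Definition gaussian n (X : Omega -> 'cV[R]_n) (mean : 'cV[R]_n) (V : 'M[R]_n) :
    Prop :=
  forall (a : 'cV[R]_n) (B : set R), measurable B ->
    Pr [set o | B (dotv a (X o))] = gauss_law (dotv a mean) (quad V a) B.

(* Conditionally on the sigma-algebra F, X has law N(mean, V) with mean random:
   o |-> N(a^T mean(o), a^T V a)(B) is a version of Pr(a^T X \in B | F). *)
Definition cond_gaussian (F : set (set Omega)) n (X mean : Omega -> 'cV[R]_n)
    (V : 'M[R]_n) : Prop :=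
  forall (E : set Omega) (a : 'cV[R]_n) (B : set R), F E -> measurable B ->
    Pr (E `&` [set o | B (dotv a (X o))]) =
    (\int[Pr]_(o in E) gauss_law (dotv a (mean o)) (quad V a) B)%E.

Definition mutually_independent (I : eqType) (F : I -> set (set Omega)) : Prop :=
  forall (s : seq I) (E : I -> set Omega), uniq s ->
    (forall i, i \in s -> F i (E i)) ->
    Pr (\bigcap_(i in [set` s]) E i) = (\prod_(i <- s) fine (Pr (E i)))%:E.

(* The noises are mutually independent and jointly independent of the initial
   states; the initial states may depend on one another. *)
Record noise_model (I : eqType) d (x1 : I -> Omega -> 'cV[R]_d)
    (w : I -> nat -> Omega -> 'cV[R]_d) (W : 'M[R]_d) : Prop := NoiseModel {
  init_random : forall i, random_vector (x1 i);
  noise_random : forall i t, random_vector (w i t);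
  noise_law : forall i t, gaussian (w i t) 0 W;
  noise_indep : mutually_independent (fun o : option (I * nat) =>
    if o is Some (i, t) then sigma_of (w i t)
    else <<s \bigcup_i sigma_of (x1 i) >>) }.

Definition second_moment d (X : Omega -> 'cV[R]_d) (M : 'M[R]_d) : Prop :=
  forall a b, ('E_Pr[fun o => (X o a ord0 * X o b ord0)%R] = (M a b)%:E)%E.

(* Sum over the first T rounds of the costs summed over all agents. *)
Definition total_cost m d k (Q : 'I_m -> nat -> 'M[R]_d)
    (Rc : 'I_m -> nat -> 'M[R]_k) (T : nat) (x : nat -> Omega -> 'cV[R]_d)
    (u : nat -> Omega -> 'cV[R]_k) : \bar R :=
  ('E_Pr[fun o => (\sum_(t < T) (quad (\sum_i Q i t) (x t o)
                               + quad (\sum_i Rc i t) (u t o)))%R])%E.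

End Probability.

(* Rounds are numbered from 0 below: index t stands for round t + 1, so the
   initial states are x i 0 and the horizon T covers the indices t < T. *)
Section Algorithm.
Context {R : realType} {m d k : nat}.
Context {disp : measure_display} {Omega : measurableType disp}.

(* The information with respect to which the control u i t is drawn afresh: all
   initial states, all noises, and every other control up to the same round. *)
Definition past (x w : 'I_m -> nat -> Omega -> 'cV[R]_d)
    (u : 'I_m -> nat -> Omega -> 'cV[R]_k) (i : 'I_m) (t : nat) :
    set (set Omega) :=
  <<s (\bigcup_j sigma_of (x j 0%N))
      `|` (\bigcup_p sigma_of (w p.1 p.2))
      `|` (\bigcup_(p in [set p : 'I_m * nat | (p.2 <= t)%N && (p != (i, t))])
             sigma_of (u p.1 p.2)) >>.

Record algorithm_run (Pr : probability Omega R) (A : 'M[R]_d) (B : 'M[R]_(d, k))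
    (W : 'M[R]_d) (P : 'M[R]_m) (Q : 'I_m -> nat -> 'M[R]_d)
    (Rc : 'I_m -> nat -> 'M[R]_k) (nu eta : R) (T : nat) (M1 : 'I_m -> 'M[R]_d)
    (x w : 'I_m -> nat -> Omega -> 'cV[R]_d)
    (u : 'I_m -> nat -> Omega -> 'cV[R]_k)
    (S : 'I_m -> nat -> 'M[R]_(d + k)) : Prop := AlgorithmRun {
  run_noise : noise_model Pr (fun i => x i 0%N) w W;
  run_init_state : forall i, gaussian Pr (x i 0%N) 0 (M1 i);
  run_init : exists2 S1, feasible A B W nu S1 & forall i, S i 0%N = S1;
  run_random : forall i t, (t < T)%N -> random_vector (u i t);
  run_play : forall i t, (t < T)%N ->
    cond_gaussian Pr (past x w u i t) (u i t)
      (fun o => gain (S i t) *m x i t o) (policy_cov (S i t));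
  run_dynamics : forall i t o, (t < T)%N ->
    x i t.+1 o = A *m x i t o + B *m u i t o + w i t o;
  run_update : forall i t, (t < T)%N ->
    is_projection (feasible A B W nu)
      (\sum_j P j i *: S j t - eta *: block_mx (Q i t) 0 0 (Rc i t))
      (S i t.+1) }.

Record linear_run (Pr : probability Omega R) (A : 'M[R]_d) (B : 'M[R]_(d, k))
    (W : 'M[R]_d) (K : 'M[R]_(k, d)) (Ms : 'M[R]_d)
    (x w : nat -> Omega -> 'cV[R]_d) (u : nat -> Omega -> 'cV[R]_k) : Prop :=
  LinearRun {
  lin_noise : noise_model Pr (fun _ : unit => x 0%N) (fun _ => w) W;
  lin_init_state : second_moment Pr (x 0%N) Ms;
  lin_control : forall t o, u t o = K *m x t o;
  lin_dynamics : forall t o, x t.+1 o = A *m x t o + B *m u t o + w t o }.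

End Algorithm.

Section Tuning.
Context {R : realType}.

Definition trace_bound (kappa gamma lambda : R) : R :=
  2 * kappa ^+ 4 * lambda ^+ 2 / gamma.

Definition step_rho (m : nat) (C sigma nu beta : R) : R :=
  4 * m%:R * C ^+ 2 * (3 + 4 * Num.sqrt m%:R / (1 - beta))
  + m%:R * C * (1 + nu / sigma ^+ 2)
    * (16 * Num.sqrt (2 * m%:R) * C * nu / ((1 - beta) * sigma ^+ 2)).

Definition step_size (rho : R) (T : nat) : R := (Num.sqrt (rho * T%:R))^-1.

Definition horizon_bound (m : nat) (C sigma nu beta rho : R) : R :=
  (4 * Num.sqrt (2 * m%:R) * nu * C
   / (sigma ^+ 4 * (1 - beta) * Num.sqrt rho)) ^+ 2.

End Tuning.

(* Main.v *)
Require Import Defs.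
From HB Require Import structures.
From mathcomp Require Import all_boot all_order all_algebra.
From mathcomp Require Import all_classical all_reals all_analysis.
From mathcomp Require Import measurable_realfun.
From mathcomp Require Import ring lra.

(** The set [feasible] contains the possible stationary covariances of the pair
    (state, control), and the cost of a round is the linear functional
    [S |-> tr (G_t S)] of such a covariance, where [G_t] is block diagonal with
    the cost matrices summed over the agents. The regret of agent [j] is the sum
    of three differences.

    Comparator ([comparator]). A strongly stable controller [Ks] has a stationary
    state covariance, the solution of [Y = M Y M^T + W] with [M = A + B Ks], and
    the bound [kappa^2 tr W / gamma] on its trace makes the resulting joint
    covariance feasible. The true state covariance under [Ks] differs from [Y] by
    a matrix transported by the powers of [M], so that the stationary cost exceeds
    the cost of [Ks] by at most a constant, the sum of a geometric series.

    Gradient descent ([projected_regret_le]). Against a fixed feasible point, the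
    sum over the agents of the squared distances is a potential: mixing does not
    increase it and a projected gradient step decreases it by the linear regret,
    up to a term of order [eta^2]. The iterates of one agent differ from the mixed
    ones by [O(eta / (1 - beta))], because each past gradient step has been
    averaged by a power of [P] ([mixed_average_le]).

    Tracking ([tracking]). The state block [Y_t] of the iterate of agent [j] is a
    fixed point of the covariance map of the policy extracted from that iterate
    ([feasible_feedback]), whereas the state really has another covariance [X_t].
    Since [W] dominates [sigma^2] times the identity, hence [sigma^2 / nu] times
    [Y_t], an excess [X_t <= (1 + a) Y_t] contracts in one round; the motion of
    the target [Y_t], again [O(eta / (1 - beta))] by [iterate_drift_le], feeds it.
    The lower bound on the horizon keeps that motion below the contraction, and
    the excess is summable up to a multiple of [T eta / (1 - beta)].

    As [rho] has the order of [1 / (1 - beta)], the choice [eta = 1 / sqrt (rho T)]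
    makes all contributions [O(sqrt (T / (1 - beta)))].

    Expected costs reduce to covariances as follows. If [f] is known before a
    control [u] is drawn, the law of [a . u] given the past yields
    [E (f + a . u)^2 = E (f + a . K x)^2 + a . V a]
    ([integral_sqr_cond_gauss]); polarization then gives every second moment that
    involves [u] ([cond_gauss_moments]), and the state covariances obey an exact
    affine recursion ([moment_step], [algorithm_cost], [linear_cost]). *)

Set Implicit Arguments.
Unset Strict Implicit.
Unset Printing Implicit Defensive.

Import Order.TTheory GRing.Theory Num.Theory.
Import numFieldNormedType.Exports.

Local Open Scope classical_set_scope.
Local Open Scope ring_scope.

(** * Frobenius inner product and quadratic forms *)

Section Frobenius.
Context {R : realType}.

Definition mxdot m n (X Y : 'M[R]_(m, n)) : R := \sum_i \sum_j X i j * Y i j.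

Lemma mxdotC m n (X Y : 'M[R]_(m, n)) : mxdot X Y = mxdot Y X.
Proof. by apply: eq_bigr => i _; apply: eq_bigr => j _; rewrite mulrC. Qed.

Lemma mxdotDl m n (X Y Z : 'M[R]_(m, n)) :
  mxdot (X + Y) Z = mxdot X Z + mxdot Y Z.
Proof.
rewrite /mxdot -big_split; apply: eq_bigr => i _ /=.
by rewrite -big_split; apply: eq_bigr => j _; rewrite !mxE mulrDl.
Qed.

Lemma mxdotZl m n a (X Y : 'M[R]_(m, n)) : mxdot (a *: X) Y = a * mxdot X Y.
Proof.
rewrite /mxdot mulr_sumr; apply: eq_bigr => i _.
by rewrite mulr_sumr; apply: eq_bigr => j _; rewrite !mxE mulrA.
Qed.

Lemma mxdotDr m n (X Y Z : 'M[R]_(m, n)) :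
  mxdot X (Y + Z) = mxdot X Y + mxdot X Z.
Proof. by rewrite ![mxdot X _]mxdotC mxdotDl. Qed.

Lemma mxdotZr m n a (X Y : 'M[R]_(m, n)) : mxdot X (a *: Y) = a * mxdot X Y.
Proof. by rewrite ![mxdot X _]mxdotC mxdotZl. Qed.

Lemma mxdotNl m n (X Y : 'M[R]_(m, n)) : mxdot (- X) Y = - mxdot X Y.
Proof. by rewrite -scaleN1r mxdotZl mulN1r. Qed.

Lemma mxdotNr m n (X Y : 'M[R]_(m, n)) : mxdot X (- Y) = - mxdot X Y.
Proof. by rewrite ![mxdot X _]mxdotC mxdotNl. Qed.

Lemma mxdot0l m n (X : 'M[R]_(m, n)) : mxdot 0 X = 0.
Proof. by rewrite -(scale0r 0) mxdotZl mul0r. Qed.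

Lemma mxdot_suml m n (I : Type) (r : seq I) (F : I -> 'M[R]_(m, n)) Y :
  mxdot (\sum_(i <- r) F i) Y = \sum_(i <- r) mxdot (F i) Y.
Proof.
elim: r => [|i r IH]; first by rewrite !big_nil mxdot0l.
by rewrite !big_cons mxdotDl IH.
Qed.

Lemma mxdot_trace m n (X Y : 'M[R]_(m, n)) : mxdot X Y = \tr (X^T *m Y).
Proof.
rewrite /mxdot exchange_big; apply: eq_bigr => j _ /=; rewrite mxE.
by apply: eq_bigr => i _; rewrite mxE.
Qed.

Lemma mxdot_mulmxl m n p (A : 'M[R]_(m, n)) (X : 'M[R]_(n, p)) Y :
  mxdot (A *m X) Y = mxdot X (A^T *m Y).
Proof. by rewrite !mxdot_trace trmx_mul mulmxA. Qed.

Lemma mxdot_ge0 m n (X : 'M[R]_(m, n)) : 0 <= mxdot X X.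
Proof. by apply: sumr_ge0 => i _; apply: sumr_ge0 => j _; rewrite -expr2 sqr_ge0. Qed.

Lemma fronorm_sqr m n (X : 'M[R]_(m, n)) : fronorm X ^+ 2 = mxdot X X.
Proof.
rewrite /fronorm sqr_sqrtr; last first.
  by apply: sumr_ge0 => i _; apply: sumr_ge0 => j _; rewrite sqr_ge0.
by apply: eq_bigr => i _; apply: eq_bigr => j _; rewrite expr2.
Qed.

Lemma fronorm_ge0 m n (X : 'M[R]_(m, n)) : 0 <= fronorm X.
Proof. exact: sqrtr_ge0. Qed.

Lemma fronorm_eq0 m n (X : 'M[R]_(m, n)) : fronorm X = 0 -> X = 0.
Proof.
move=> X0; have := fronorm_sqr X; rewrite X0 expr0n /= => /esym /eqP.
rewrite psumr_eq0 => [/allP h|i _]; last first.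
  by apply: sumr_ge0 => j _; rewrite -expr2 sqr_ge0.
apply/matrixP => i j; have /= := h i (mem_index_enum _).
rewrite psumr_eq0 => [/allP /(_ j (mem_index_enum _))|{}j _]; last first.
  by rewrite -expr2 sqr_ge0.
by rewrite /= mulf_eq0 orbb => /eqP ->; rewrite mxE.
Qed.

Lemma fronorm0 m n : fronorm (0 : 'M[R]_(m, n)) = 0.
Proof. by apply/eqP; rewrite -sqrf_eq0 fronorm_sqr mxdot0l. Qed.

Lemma fronormZ m n a (X : 'M[R]_(m, n)) : fronorm (a *: X) = `|a| * fronorm X.
Proof.
apply/eqP; rewrite -(@eqrXn2 _ 2) ?mulr_ge0 ?fronorm_ge0 //.
by rewrite exprMn !fronorm_sqr mxdotZl mxdotZr mulrA -expr2 real_normK ?num_real.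
Qed.

Lemma fronormN m n (X : 'M[R]_(m, n)) : fronorm (- X) = fronorm X.
Proof. by rewrite -scaleN1r fronormZ normrN1 mul1r. Qed.

Lemma fronormB m n (X Y : 'M[R]_(m, n)) : fronorm (X - Y) = fronorm (Y - X).
Proof. by rewrite -fronormN opprB. Qed.

(** Cauchy-Schwarz, by expanding the squared norm of [|Y| X - |X| Y]. *)
Lemma mxdot_le m n (X Y : 'M[R]_(m, n)) : mxdot X Y <= fronorm X * fronorm Y.
Proof.
have [/eqP/fronorm_eq0 ->|X0] := boolP (fronorm X == 0).
  by rewrite mxdot0l fronorm0 mul0r.
have [/eqP/fronorm_eq0 ->|Y0] := boolP (fronorm Y == 0).
  by rewrite mxdotC mxdot0l fronorm0 mulr0.
have := mxdot_ge0 (fronorm Y *: X - fronorm X *: Y).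
rewrite !(mxdotDl, mxdotDr, mxdotNl, mxdotNr, mxdotZl, mxdotZr) -!fronorm_sqr.
rewrite (mxdotC Y X) => h.
have p : 0 < fronorm X * fronorm Y by rewrite mulr_gt0 // lt0r ?X0 ?Y0 fronorm_ge0.
by rewrite -(ler_pM2l p); nra.
Qed.

Lemma normr_mxdot_le m n (X Y : 'M[R]_(m, n)) :
  `|mxdot X Y| <= fronorm X * fronorm Y.
Proof.
rewrite ler_norml mxdot_le andbT -(fronormN X) -[leRHS]opprK lerN2 -mxdotNl.
exact: mxdot_le.
Qed.

Lemma fronormD m n (X Y : 'M[R]_(m, n)) : fronorm (X + Y) <= fronorm X + fronorm Y.
Proof.
rewrite -(@ler_pXn2r _ 2) ?nnegrE ?addr_ge0 ?fronorm_ge0 // sqrrD !fronorm_sqr.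
rewrite !(mxdotDl, mxdotDr) (mxdotC Y X); have := mxdot_le X Y; lra.
Qed.

Lemma fronorm_sum m n (I : Type) (r : seq I) (F : I -> 'M[R]_(m, n)) :
  fronorm (\sum_(i <- r) F i) <= \sum_(i <- r) fronorm (F i).
Proof.
elim: r => [|i r IH]; first by rewrite !big_nil fronorm0.
by rewrite !big_cons (le_trans (fronormD _ _)) // lerD2l.
Qed.

(** Cauchy-Schwarz bounds each entry of the product by the norms of a row and a
    column. *)
Lemma fronorm_mul m n p (X : 'M[R]_(m, n)) (Y : 'M[R]_(n, p)) :
  fronorm (X *m Y) <= fronorm X * fronorm Y.
Proof.
rewrite -(@ler_pXn2r _ 2) ?nnegrE ?mulr_ge0 ?fronorm_ge0 // exprMn !fronorm_sqr.
rewrite {2}/mxdot mulr_suml; apply: ler_sum => i _.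
rewrite /mxdot exchange_big /= mulr_sumr; apply: ler_sum => j _.
have -> : \sum_k X i k * X i k = fronorm (row i X) ^+ 2.
  rewrite fronorm_sqr /mxdot big_ord1; apply: eq_bigr => k _; by rewrite !mxE.
have -> : \sum_k Y k j * Y k j = fronorm (col j Y)^T ^+ 2.
  rewrite fronorm_sqr /mxdot big_ord1; apply: eq_bigr => k _; by rewrite !mxE.
have -> : (X *m Y) i j = mxdot (row i X) (col j Y)^T.
  by rewrite mxE /mxdot big_ord1; apply: eq_bigr => k _; rewrite !mxE.
rewrite -expr2 -exprMn -real_normK ?num_real //.
by rewrite ler_pXn2r ?nnegrE ?mulr_ge0 ?fronorm_ge0 ?normr_mxdot_le.
Qed.

Lemma fronorm_tr m n (X : 'M[R]_(m, n)) : fronorm X^T = fronorm X.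
Proof.
apply/eqP; rewrite -(@eqrXn2 _ 2) ?fronorm_ge0 // !fronorm_sqr !mxdot_trace.
by rewrite trmxK mxtrace_mulC.
Qed.

Lemma dotvE n (a v : 'cV[R]_n) : dotv a v = mxdot a v.
Proof. by rewrite /dotv mxdot_trace /mxtrace big_ord1. Qed.

Lemma dotvDr n (a u v : 'cV[R]_n) : dotv a (u + v) = dotv a u + dotv a v.
Proof. by rewrite !dotvE mxdotDr. Qed.

Lemma dotv_mulmx m n (A : 'M[R]_(m, n)) a v : dotv a (A *m v) = dotv (A^T *m a) v.
Proof. by rewrite !dotvE mxdotC mxdot_mulmxl mxdotC. Qed.

Lemma quadE n (M : 'M[R]_n) v : quad M v = mxdot v (M *m v).
Proof. by rewrite /quad dotvE. Qed.

Lemma quadD n (M N : 'M[R]_n) v : quad (M + N) v = quad M v + quad N v.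
Proof. by rewrite !quadE mulmxDl mxdotDr. Qed.

Lemma quadZ n a (M : 'M[R]_n) v : quad (a *: M) v = a * quad M v.
Proof. by rewrite !quadE -scalemxAl mxdotZr. Qed.

Lemma quadN n (M : 'M[R]_n) v : quad (- M) v = - quad M v.
Proof. by rewrite -scaleN1r quadZ mulN1r. Qed.

Lemma quad0 n v : quad (0 : 'M[R]_n) v = 0.
Proof. by rewrite -(scale0r 0) quadZ mul0r. Qed.

Lemma quad_sum n (I : Type) (r : seq I) (F : I -> 'M[R]_n) v :
  quad (\sum_(i <- r) F i) v = \sum_(i <- r) quad (F i) v.
Proof.
elim: r => [|i r IH]; first by rewrite !big_nil quad0.
by rewrite !big_cons quadD IH.
Qed.

Lemma quad_scalar n a (v : 'cV[R]_n) : quad a%:M v = a * mxdot v v.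
Proof. by rewrite quadE mul_scalar_mx mxdotZr. Qed.

Lemma quad_conj m n (N : 'M[R]_(m, n)) (M : 'M[R]_n) v :
  quad (N *m M *m N^T) v = quad M (N^T *m v).
Proof. by rewrite !quadE [in RHS]mxdotC -!mulmxA mxdotC !mxdot_mulmxl. Qed.

Lemma quad_gram m n (L : 'M[R]_(m, n)) v :
  quad (L *m L^T) v = fronorm (L^T *m v) ^+ 2.
Proof. by rewrite -{1}[L]mulmx1 quad_conj quad_scalar mul1r fronorm_sqr. Qed.

Lemma quad_scale n (M : 'M[R]_n) a v : quad M (a *: v) = a ^+ 2 * quad M v.
Proof. by rewrite !quadE -scalemxAr mxdotZl mxdotZr mulrA. Qed.

Lemma normr_quad_le n (M : 'M[R]_n) v : `|quad M v| <= fronorm M * mxdot v v.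
Proof.
rewrite quadE (le_trans (normr_mxdot_le _ _)) // -fronorm_sqr expr2 mulrA.
by rewrite mulrC ler_wpM2r ?fronorm_ge0 // fronorm_mul.
Qed.

Lemma quad_delta n (M : 'M[R]_n) (i : 'I_n) :
  quad M (delta_mx i ord0) = M i i.
Proof.
rewrite quadE -colE /mxdot (bigD1 i) //= big_ord1 big1 => [|k ki].
  by rewrite addr0 !mxE !eqxx mul1r.
by rewrite big_ord1 mxE (negPf ki) mul0r.
Qed.

Lemma mxtrace_quad n (M : 'M[R]_n) : \tr M = \sum_i quad M (delta_mx i ord0).
Proof. by apply: eq_bigr => i _; rewrite quad_delta. Qed.

End Frobenius.

(** * Positive semidefinite matrices *)

Section PositiveSemidefinite.
Context {R : realType}.

Lemma posdef_psd n (M : 'M[R]_n) : posdef M -> psd M.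
Proof.
case=> sM pM; split=> // v; have [->|/pM/ltW //] := eqVneq v 0.
by rewrite quadE mxdot0l.
Qed.

Lemma psdD n (M N : 'M[R]_n) : psd M -> psd N -> psd (M + N).
Proof.
move=> [sM pM] [sN pN]; split=> [|v]; first by rewrite linearD /= sM sN.
by rewrite quadD addr_ge0.
Qed.

Lemma psd0 n : psd (0 : 'M[R]_n).
Proof. by split=> [|v]; rewrite ?trmx0 // quad0. Qed.

Lemma psd_sum n (I : Type) (r : seq I) (F : I -> 'M[R]_n) :
  (forall i, psd (F i)) -> psd (\sum_(i <- r) F i).
Proof. by move=> h; elim/big_ind: _ => //; [exact: psd0 | exact: psdD]. Qed.

Lemma psdZ n a (M : 'M[R]_n) : 0 <= a -> psd M -> psd (a *: M).
Proof.
move=> a0 [sM pM]; split=> [|v]; first by rewrite linearZ /= sM.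
by rewrite quadZ mulr_ge0.
Qed.

Lemma psd_conj m n (N : 'M[R]_(m, n)) (M : 'M[R]_n) :
  psd M -> psd (N *m M *m N^T).
Proof.
move=> [sM pM]; split=> [|v]; last by rewrite quad_conj.
by rewrite !trmx_mul trmxK sM mulmxA.
Qed.

Lemma mxdot_colE m n (u : 'cV[R]_m) (v : 'cV[R]_n) x y :
  mxdot (col_mx u v) (col_mx x y) = mxdot u x + mxdot v y.
Proof.
rewrite /mxdot big_split_ord /=; congr (_ + _).
  by apply: eq_bigr => i _; rewrite !big_ord1 !col_mxEu.
by apply: eq_bigr => i _; rewrite !big_ord1 !col_mxEd.
Qed.

Lemma quad_block m n (P : 'M[R]_m) (Q : 'M[R]_(m, n)) (S : 'M[R]_(n, m))
    (T : 'M[R]_n) u v :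
  quad (block_mx P Q S T) (col_mx u v) =
  quad P u + mxdot u (Q *m v) + mxdot v (S *m u) + quad T v.
Proof. by rewrite !quadE mul_block_col mxdot_colE !mxdotDr !addrA. Qed.

(** Cholesky: if the corner entry [b] is positive, completing the square
    leaves the Schur complement, which is again positive semidefinite; if
    [b = 0], nonnegativity forces the rest of its row to vanish. *)
Lemma psd_factor n (M : 'M[R]_n) : psd M -> exists L : 'M[R]_n, M = L *m L^T.
Proof.
elim: n M => [|n IH] M [sM pM]; first by exists 0; apply/matrixP => -[].
move: M sM pM; rewrite -[n.+1]/(1 + n)%N => M sM pM.
set b := M ord0 ord0; set c : 'cV[R]_n := dlsubmx M; set D := drsubmx M.
have eM : M = block_mx b%:M c^T c D.
  rewrite -[M]submxK; congr block_mx => //.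
    by apply/matrixP => i j; rewrite !ord1 !mxE eqxx !lshift0.
  by rewrite /c trmx_dlsub sM.
have sD : D^T = D by rewrite /D trmx_drsub sM.
have pE t v : 0 <= b * t ^+ 2 + 2 * t * mxdot c v + quad D v.
  have := pM (col_mx t%:M v); rewrite eM quad_block quad_scalar.
  have -> : mxdot (t%:M : 'cV[R]_1) t%:M = t ^+ 2.
    by rewrite /mxdot !big_ord1 !mxE eqxx.
  have -> : mxdot (t%:M : 'cV[R]_1) (c^T *m v) = t * mxdot c v.
    rewrite mxdotC mxdot_mulmxl trmxK mul_mx_scalar mxdotZr; congr (_ * _).
    exact: mxdotC.
  have -> : mxdot v (c *m t%:M) = t * mxdot c v.
    by rewrite mul_mx_scalar mxdotZr mxdotC.
  by move=> h; apply: le_trans h _; rewrite le_eqVlt; apply/orP; left; apply/eqP; ring.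
have [b0|b0] := eqVneq b 0.
  have c0 : c = 0.
    apply: fronorm_eq0; apply/eqP; rewrite -sqrf_eq0 fronorm_sqr.
    have p0 := mxdot_ge0 c; have q0 : 0 <= quad D c by have := pE 0 c; rewrite b0; lra.
    apply: contraT => n0; have {n0}p0 : 0 < mxdot c c by rewrite lt0r n0.
    have := pE (- (quad D c + 1) / (2 * mxdot c c)) c; rewrite b0 mul0r add0r.
    have -> : 2 * (- (quad D c + 1) / (2 * mxdot c c)) * mxdot c c
              = - (quad D c + 1) by field; rewrite gt_eqF.
    lra.
  have [L eL] : exists L : 'M[R]_n, D = L *m L^T.
    by apply: IH; split=> // v; have := pE 0 v; rewrite b0; lra.
  exists (block_mx 0 0 0 L : 'M[R]_(1 + n)).
  rewrite eM c0 b0 tr_block_mx mulmx_block.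
  rewrite !(mulmx0, mul0mx, trmx0, addr0, add0r) -eL; congr block_mx.
  by apply/matrixP => i j; rewrite !mxE mul0rn.
have b_gt0 : 0 < b.
  by rewrite lt0r b0 /b -(quad_delta M) pM.
have sb : Num.sqrt b * Num.sqrt b = b by rewrite -expr2 sqr_sqrtr // ltW.
have sb0 : Num.sqrt b != 0 by rewrite gt_eqF // sqrtr_gt0.
have [L eL] : exists L : 'M[R]_n, D - b^-1 *: (c *m c^T) = L *m L^T.
  apply: IH; split=> [|v].
    by rewrite linearB linearZ /= trmx_mul trmxK sD.
  rewrite quadD quadN quadZ quad_gram.
  have -> : fronorm (c^T *m v) = `|mxdot c v|.
    apply/eqP; rewrite -(@eqrXn2 _ 2) ?fronorm_ge0 // real_normK ?num_real //.
    rewrite fronorm_sqr {1}/mxdot !big_ord1 -expr2; apply/eqP; congr (_ ^+ 2).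
    rewrite mxE /mxdot; apply: eq_bigr => i _; by rewrite big_ord1 mxE.
  rewrite real_normK ?num_real //; have := pE (- (mxdot c v / b)) v.
  by move=> h; apply: le_trans h _; rewrite le_eqVlt; apply/orP; left; apply/eqP; field.
exists (block_mx (Num.sqrt b)%:M 0 ((Num.sqrt b)^-1 *: c) L : 'M[R]_(1 + n)).
rewrite eM tr_block_mx mulmx_block !(mulmx0, mul0mx, trmx0, addr0).
rewrite tr_scalar_mx -scalar_mxM sb linearZ /= mul_scalar_mx scalerA.
rewrite mulfV // scale1r mul_mx_scalar scalerA mulfV // scale1r; congr block_mx.
rewrite -scalemxAl -scalemxAr scalerA -eL -invfM sb.
by rewrite addrC subrK.
Qed.

Lemma mxtrace_gram_mul n p (L : 'M[R]_(n, p)) (M : 'M[R]_n) :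
  \tr (L *m L^T *m M) = \sum_j quad M (col j L).
Proof.
rewrite -mulmxA mxtrace_mulC -mulmxA /mxtrace; apply: eq_bigr => j _.
rewrite quadE mxdotC mxE /mxdot; apply: eq_bigr => i _.
rewrite big_ord1 !mxE mulrC; congr (_ * _).
by apply: eq_bigr => k _; rewrite !mxE.
Qed.

(** A Gram factor of [G] turns both traces into sums of values of the quadratic
    forms at the columns of that factor. *)
Lemma psd_trace_le n (G M N : 'M[R]_n) : psd G ->
  (forall v, quad M v <= quad N v) -> \tr (G *m M) <= \tr (G *m N).
Proof.
move=> /psd_factor[L ->] MN; rewrite !mxtrace_gram_mul.
by apply: ler_sum => j _; exact: MN.
Qed.

Lemma psd_trace_ge0 n (M : 'M[R]_n) : psd M -> 0 <= \tr M.
Proof. by move=> [_ pM]; rewrite mxtrace_quad; apply: sumr_ge0 => i _. Qed.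

Lemma psd_quad_le_trace n (M : 'M[R]_n) v : psd M -> quad M v <= \tr M * mxdot v v.
Proof.
move=> /psd_factor[L ->]; rewrite quad_gram -fronorm_sqr.
have -> : \tr (L *m L^T) = fronorm L^T ^+ 2.
  by rewrite fronorm_sqr mxdot_trace trmxK.
by rewrite -exprMn ler_pXn2r ?nnegrE ?mulr_ge0 ?fronorm_ge0 // fronorm_mul.
Qed.

Lemma psd_trace_mul_le n (G M : 'M[R]_n) : psd G -> psd M ->
  \tr (G *m M) <= \tr G * \tr M.
Proof.
move=> pG pM; rewrite [leRHS]mulrC -mxtraceZ -mul_mx_scalar.
by apply: psd_trace_le => // v; rewrite quad_scalar psd_quad_le_trace.
Qed.

(** The squared Frobenius norm is [tr (M M)], and [M] is dominated by its trace
    times the identity. *)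
Lemma psd_fronorm_le n (M : 'M[R]_n) : psd M -> fronorm M <= \tr M.
Proof.
move=> pM; rewrite -(@ler_pXn2r _ 2) ?nnegrE ?fronorm_ge0 ?psd_trace_ge0 //.
rewrite fronorm_sqr mxdot_trace (proj1 pM) expr2; exact: psd_trace_mul_le.
Qed.

End PositiveSemidefinite.

(** * Operator norm *)

Section OperatorNorm.
Context {R : realType} {m n : nat}.
Implicit Types (M : 'M[R]_(m, n)) (v : 'cV[R]_n).

Lemma fronorm_le_opnorm M v : fronorm v <= 1 -> fronorm (M *m v) <= opnorm M.
Proof.
move=> v1; apply: sup_upper_bound; last by exists v.
split; first by exists (fronorm (M *m v)), v.
exists (fronorm M) => _ [u /= u1 <-]; rewrite (le_trans (fronorm_mul _ _)) //.
by rewrite ler_piMr ?fronorm_ge0.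
Qed.

Lemma opnorm_ge0 M : 0 <= opnorm M.
Proof.
have := @fronorm_le_opnorm M 0; rewrite mulmx0 !fronorm0; apply; exact: ler01.
Qed.

Lemma fronorm_mulmx_opnorm M v : fronorm (M *m v) <= opnorm M * fronorm v.
Proof.
have [/eqP/fronorm_eq0 ->|v0] := boolP (fronorm v == 0).
  by rewrite mulmx0 !fronorm0 mulr0.
have p : 0 < fronorm v by rewrite lt0r v0 fronorm_ge0.
rewrite -ler_pdivrMr // mulrC -(@gtr0_norm _ (fronorm v)^-1) ?invr_gt0 //.
rewrite -fronormZ scalemxAr fronorm_le_opnorm // fronormZ gtr0_norm ?invr_gt0 //.
by rewrite mulVf.
Qed.

End OperatorNorm.

(** * Scalar bounds up to a vanishing error *)

Section Geometric.
Context {R : realType}.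

Lemma le_of_le_small_error (x y K e0 : R) : 0 < e0 -> 0 <= K ->
  (forall e, 0 < e -> e < e0 -> x <= y + K * e) -> x <= y.
Proof.
move=> e00 K0 h; rewrite leNgt; apply/negP => yx.
have K1 : 0 < K + 1 by rewrite ltr_wpDl.
have p : 0 < (x - y) / (K + 1) by rewrite divr_gt0 // subr_gt0.
set e := Num.min (e0 / 2) ((x - y) / (K + 1)).
have e_gt0 : 0 < e by rewrite lt_min p divr_gt0.
have e_lt : e < e0 by rewrite gt_min ltr_pdivrMr // ltr_pMr // ltr1n.
have e_le : e * (K + 1) <= x - y by rewrite -ler_pdivlMr // ge_min lexx orbT.
have := h e e_gt0 e_lt; nra.
Qed.

Lemma le_of_le_geometric_error (x y c r : R) : 0 <= r < 1 ->
  (forall n, x <= y + c * r ^+ n) -> x <= y.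
Proof.
move=> /andP[r0 r1] h.
have cv : (fun n => y + c * r ^+ n) @ \oo --> y.
  rewrite -[X in _ --> X]addr0 -[X in y + X](mulr0 c).
  apply: cvgD; first exact: cvg_cst.
  by apply: cvgMr; apply: cvg_expr; rewrite ger0_norm.
rewrite -(cvg_lim _ cv) //; apply: limr_ge; first by apply/cvg_ex; exists y.
by apply: nearW => n; exact: h.
Qed.

Lemma sum_geometric_le (r : R) n : 0 <= r < 1 -> \sum_(i < n) r ^+ i <= (1 - r)^-1.
Proof.
move=> /andP[r0 r1]; have p : 0 < 1 - r by rewrite subr_gt0.
rewrite -[leRHS]mul1r ler_pdivlMr // mulrC.
rewrite -(opprB r) mulNr -subrX1 opprB.
by rewrite lerBlDr lerDl exprn_ge0.
Qed.

End Geometric.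

(** * The discrete Lyapunov equation *)

Section Lyapunov.
Context {R : realType} {d : nat}.
Implicit Types (M N W Y : 'M[R]_d).

(** The Gram matrix [N^T N] is dominated by [b^2] times the identity. *)
Lemma trace_conj_le p (N : 'M[R]_(p, d)) Y (b : R) : psd Y ->
  (forall v : 'cV[R]_d, fronorm (N *m v) <= b * fronorm v) ->
  \tr (N *m Y *m N^T) <= b ^+ 2 * \tr Y.
Proof.
move=> pY hN; rewrite mxtrace_mulC mulmxA mxtrace_mulC -mxtraceZ -mul_mx_scalar.
apply: psd_trace_le => // v; rewrite quad_scalar.
have := quad_gram N^T v; rewrite trmxK => ->; rewrite -fronorm_sqr -exprMn ler_pXn2r ?nnegrE ?fronorm_ge0 //.
exact: le_trans (fronorm_ge0 _) (hN v).
Qed.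

Lemma fronorm_le_columns p (N : 'M[R]_(p, d)) (b : R) :
  (forall v : 'cV[R]_d, fronorm (N *m v) <= b * fronorm v) -> fronorm N ^+ 2 <= d%:R * b ^+ 2.
Proof.
move=> hN; rewrite fronorm_sqr /mxdot exchange_big /=.
rewrite -[X in X%:R](card_ord d) -sumr_const mulr_suml.
apply: ler_sum => j _; rewrite mul1r.
have -> : \sum_i N i j * N i j = fronorm (N *m (delta_mx j ord0 : 'cV_d)) ^+ 2.
  rewrite fronorm_sqr -colE /mxdot; apply: eq_bigr => i _.
  by rewrite big_ord1 !mxE.
have e1 : fronorm (delta_mx j ord0 : 'cV[R]_d) = 1.
  apply/eqP; rewrite -(@eqrXn2 _ 2) ?fronorm_ge0 // fronorm_sqr expr1n.
  have := quad_delta (1%:M : 'M[R]_d) j.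
  by rewrite quadE mul1mx mxE eqxx => ->.
have := hN (delta_mx j ord0); rewrite e1 mulr1 => h.
by rewrite ler_pXn2r ?nnegrE ?fronorm_ge0 // (le_trans (fronorm_ge0 _) h).
Qed.

Section FixedPoint.
Context (M W : 'M[R]_d) (kap r : R).
Hypothesis r01 : 0 <= r < 1.
Hypothesis Mpow : forall n (v : 'cV[R]_d), fronorm (M ^+ n *m v) <= kap * r ^+ n * fronorm v.

Lemma exprmxS n : M ^+ n.+1 = M *m M ^+ n. Proof. exact: exprS. Qed.
Lemma exprmxSr n : M ^+ n.+1 = M ^+ n *m M. Proof. exact: exprSr. Qed.

Lemma fronorm_expr_sqr n : fronorm (M ^+ n) ^+ 2 <= d%:R * kap ^+ 2 * r ^+ n.
Proof.
have [r0 r1] := andP r01.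
apply: le_trans (fronorm_le_columns (Mpow n)) _.
have c0 : 0 <= d%:R * kap ^+ 2 by apply: mulr_ge0; [exact: ler0n | exact: sqr_ge0].
rewrite exprMn mulrA ler_wpM2l //.
by rewrite expr2 ler_piMl ?exprn_ge0 // exprn_ile1 // ltW.
Qed.

Lemma lyapunov_iter Y n : Y = M *m Y *m M^T + W ->
  Y = \sum_(s < n) M ^+ s *m W *m (M ^+ s)^T + M ^+ n *m Y *m (M ^+ n)^T.
Proof.
move=> eY; elim: n => [|n IH].
  rewrite big_ord0 add0r expr0 (_ : (1 : 'M[R]_d) = 1%:M) //.
  by rewrite mul1mx trmx1 mulmx1.
rewrite big_ord_recr /= exprmxSr trmx_mul {1}IH -addrA; congr (_ + _).
by rewrite {1}eY mulmxDr mulmxDl addrC !mulmxA.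
Qed.

(** Iterating the equation gives [Y = M^n Y (M^n)^T], and the right-hand side
    decays geometrically. *)
Lemma lyapunov_homogeneous Y : Y = M *m Y *m M^T -> Y = 0.
Proof.
move=> eY; apply: fronorm_eq0; apply/eqP; rewrite eq_le fronorm_ge0 andbT.
have it n : Y = M ^+ n *m Y *m (M ^+ n)^T.
  elim: n => [|n IH].
    by rewrite expr0 (_ : (1 : 'M[R]_d) = 1%:M) // mul1mx trmx1 mulmx1.
  by rewrite exprmxSr trmx_mul {1}IH {1}eY !mulmxA.
apply: (@le_of_le_geometric_error _ _ _ (d%:R * kap ^+ 2 * fronorm Y) r) => // n.
rewrite add0r {1}(it n) (le_trans (fronorm_mul _ _)) // fronorm_tr.
apply: le_trans (ler_wpM2r (fronorm_ge0 _) (fronorm_mul _ _)) _.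
rewrite mulrAC -expr2 [leRHS]mulrAC ler_wpM2r ?fronorm_ge0 //.
exact: fronorm_expr_sqr.
Qed.

(** The map [Y |-> Y - M Y M^T] is injective on a finite-dimensional space,
    hence onto. *)
Lemma lyapunov_solution : exists Y, Y = M *m Y *m M^T + W.
Proof.
pose f : 'M[R]_d -> 'M[R]_d := idfun \- (mulmx M \o mulmxr M^T).
have fE Y : f Y = Y - M *m Y *m M^T by rewrite /f /= mulmxA.
pose g := lin_mx f.
have inj : row_free g.
  apply: inj_row_free => v; rewrite -[v]vec_mxK mul_vec_lin => h.
  have {h} : mxvec (f (vec_mx v)) = 0 by exact: h.
  move/eqP; rewrite mxvec_eq0 fE subr_eq0 => /eqP h.
  by rewrite (lyapunov_homogeneous h) linear0.
have gU : g \in unitmx by rewrite -row_free_unit.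
exists (vec_mx (mxvec W *m invmx g)); set Y := vec_mx _.
have : mxvec Y *m g = mxvec W by rewrite vec_mxK mulmxKV.
rewrite mul_vec_lin => h.
have {h} /(can_inj mxvecK) : mxvec (f Y) = mxvec W by exact: h.
rewrite fE => <-.
by rewrite addrC subrK.
Qed.

(** The solution is symmetric because its transpose solves the same equation, and
    nonnegative because it is a sum of positive semidefinite matrices up to a
    remainder that vanishes as the number of terms grows. *)
Lemma lyapunov_psd Y : psd W -> Y = M *m Y *m M^T + W -> psd Y.
Proof.
move=> [sW pW] eY.
have sY : Y^T = Y.
  apply/eqP; rewrite -subr_eq0; apply/eqP; apply: lyapunov_homogeneous.
  rewrite mulmxBr mulmxBl {1}eY {2}eY linearD /= !trmx_mul trmxK sW mulmxA.
  by rewrite opprD addrACA subrr addr0.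
split=> // v.
apply: (@le_of_le_geometric_error _ _ _ (fronorm Y * (d%:R * kap ^+ 2) * mxdot v v) r) => // n.
rewrite {1}(lyapunov_iter n eY) quadD quad_sum quad_conj -addrA.
apply: addr_ge0; first by apply: sumr_ge0 => s _; rewrite quad_conj.
have := normr_quad_le Y ((M ^+ n)^T *m v); rewrite ler_norml => /andP[h _].
rewrite -lerBlDr sub0r; apply: le_trans h; rewrite lerN2.
rewrite [leRHS](_ : _ =
  fronorm Y * (d%:R * kap ^+ 2 * r ^+ n * fronorm v ^+ 2)); last first.
  by rewrite fronorm_sqr; ring.
rewrite ler_wpM2l ?fronorm_ge0 // -fronorm_sqr.
have h1 : fronorm ((M ^+ n)^T *m v) <= fronorm (M ^+ n) * fronorm v.
  by rewrite -(fronorm_tr (M ^+ n)) fronorm_mul.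
have h2 : fronorm ((M ^+ n)^T *m v) ^+ 2 <= fronorm (M ^+ n) ^+ 2 * fronorm v ^+ 2.
  by rewrite -exprMn ler_pXn2r ?nnegrE ?mulr_ge0 ?fronorm_ge0.
apply: le_trans h2 _.
by rewrite ler_wpM2r ?sqr_ge0 // fronorm_expr_sqr.
Qed.

Lemma lyapunov_trace_le Y : psd W -> Y = M *m Y *m M^T + W ->
  \tr Y <= kap ^+ 2 * \tr W / (1 - r).
Proof.
move=> pW eY; have [r0 r1] := andP r01; have pY := lyapunov_psd pW eY.
have kt0 (Z : 'M[R]_d) : psd Z -> 0 <= kap ^+ 2 * \tr Z.
  by move=> pZ; apply: mulr_ge0; [exact: sqr_ge0 | exact: psd_trace_ge0].
have rr n : (r ^+ n) ^+ 2 <= r ^+ n.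
  by rewrite expr2 ler_piMl ?exprn_ge0 // exprn_ile1 // ltW.
apply: (@le_of_le_geometric_error _ _ _ (kap ^+ 2 * \tr Y) r) => // n.
rewrite {1}(lyapunov_iter n eY) mxtraceD (raddf_sum (@mxtrace _ _)) /=.
apply: lerD; last first.
  apply: le_trans (trace_conj_le pY (Mpow n)) _.
  by rewrite exprMn mulrAC ler_wpM2l ?kt0.
apply: le_trans (_ : \sum_(s < n) kap ^+ 2 * \tr W * r ^+ s <= _).
  apply: ler_sum => s _; apply: le_trans (trace_conj_le pW (Mpow s)) _.
  by rewrite exprMn mulrAC ler_wpM2l ?kt0.
rewrite -mulr_sumr ler_wpM2l ?sum_geometric_le //.
exact: kt0.
Qed.

End FixedPoint.
End Lyapunov.

(** * Translation and second moment of Gaussian laws *)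

Section Gaussian.
Context {R : realType}.
Local Notation leb := (@lebesgue_measure R).

(** Packaging the measurability of [f] lets the pushforward by [f] be recognized
    as a measure. *)
Definition mfun_of d d' (T : measurableType d) (U : measurableType d')
    (f : T -> U) (mf : measurable_fun setT f) : {mfun T >-> U} :=
  HB.pack f (isMeasurableFun.Build d d' T U f mf).

Lemma pushforward_lebesgue_shift (m : R) (D : set R) : measurable D ->
  leb [set y | D (m + y)] = leb D.
Proof.
move=> mD.
have mphi : measurable_fun setT
    (fun y : measurableTypeR R => (m + y)%R : measurableTypeR R).
  exact: measurable_funD.
suff: forall X, ocitv X -> leb X = pushforward leb (mfun_of mphi) X.
  by move=> h; have -> := @lebesgue_measure_unique R _ h D mD.
move=> _ [[a b]] _ <-.
rewrite /pushforward /=.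
have -> : (fun y : R => m + y) @^-1` `]a, b] = `]a - m, b - m]%classic.
  by apply/seteqP; split=> y /=; rewrite !in_itv /= ltrBlDl lerBrDl.
rewrite !lebesgue_measure_itv /= !lte_fin ltrD2r; case: ifP => // _.
by rewrite -!EFinB opprB addrA subrK.
Qed.

Lemma ge0_integral_shift (m : R) (D : set R) (f : R -> \bar R) :
  measurable D -> measurable_fun setT f -> (forall x, (0 <= f x)%E) ->
  (\int[leb]_(x in D) f x =
   \int[leb]_(y in [set y | D (m + y)%R]) f (m + y)%R)%E.
Proof.
move=> mD mf f0.
pose phi (y : measurableTypeR R) : measurableTypeR R := m + y.
have mphi : measurable_fun setT phi by exact: measurable_funD.
have := @ge0_integral_pushforward _ _ _ _ _ phi mphi leb D f mD.
move=> <- //; last exact: measurable_funS mf.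
apply: eq_measure_integral => //= E mE _.
exact: (esym (pushforward_lebesgue_shift m mE)).
Qed.

(** The density agrees almost everywhere with the Radon-Nikodym derivative. *)
Lemma ge0_integral_normal_prob (m s : R) (f : R -> \bar R) :
  measurable_fun setT f -> (forall x, (0 <= f x)%E) ->
  (\int[normal_prob m s]_x f x = \int[leb]_x (f x * (normal_pdf m s x)%:E))%E.
Proof.
move=> mf f0; have dom := @normal_prob_dominates R m s.
rewrite -(Radon_Nikodym_SigmaFinite.change_of_variables dom) //.
have mp : measurable_fun setT (EFin \o normal_pdf m s).
  by apply/measurable_EFinP; exact: measurable_normal_pdf.
have mr := measurable_int _ (Radon_Nikodym_SigmaFinite.f_integrable dom).
apply: ge0_ae_eq_integral => //.
- exact: emeasurable_funM.
- exact: emeasurable_funM.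
- by move=> x _; rewrite mule_ge0 // Radon_Nikodym_SigmaFinite.f_ge0.
- by move=> x _; rewrite mule_ge0 // lee_fin normal_pdf_ge0.
- apply: ae_eqe_mul2l; apply: integral_ae_eq => //.
    exact: Radon_Nikodym_SigmaFinite.f_integrable.
  by move=> E _ mE; rewrite -Radon_Nikodym_SigmaFinite.f_integral.
Qed.

(** [gauss_law] is a mere set function; this is [gauss_law 0 v] as a measure, so
    that one can integrate and form products. *)
Definition centered_gauss (v : R) : probability (measurableTypeR R) R :=
  if v == 0 then dirac (0 : measurableTypeR R) : probability (measurableTypeR R) R
  else normal_prob 0 (Num.sqrt v).

(** For negative [v] this fails, since a normal law of deviation zero is the
    uniform law on the unit interval whatever its mean. *)
Lemma gauss_law_shift (m v : R) (B : set R) : 0 <= v -> measurable B ->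
  gauss_law m v B = centered_gauss v [set y | B (m + y)].
Proof.
move=> v0 mB; rewrite /gauss_law /centered_gauss; case: eqP => [_|/eqP vn0].
  rewrite /= !diracE; suff -> : (m \in B) = ((0 : R) \in [set y | B (m + y)]) by [].
  by apply/idP/idP; rewrite !inE /= addr0.
have sv0 : Num.sqrt v != 0 by rewrite gt_eqF // sqrtr_gt0 lt0r vn0.
rewrite /= /normal_prob (ge0_integral_shift m) //.
- apply: eq_integral => y _; rewrite !normal_pdfE // /normal_fun; congr (_ * _)%:E.
  by rewrite subr0 addrC addKr.
- by apply/measurable_EFinP; exact: measurable_normal_pdf.
- by move=> x; rewrite lee_fin normal_pdf_ge0.
Qed.

Lemma integral_normal_fun0 (s : R) : 0 < s ->
  (\int[leb]_x (normal_fun 0 s x)%:E)%E = (s * Num.sqrt (pi *+ 2))%:E.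
Proof.
move=> s0; have sn0 : s != 0 by rewrite gt_eqF.
have := integral_normal_pdf 0 s; rewrite /normal_pdf (negPf sn0).
under eq_integral do rewrite EFinM.
have p0 := normal_peak_gt0 sn0.
rewrite ge0_integralZl //; first last.
- by rewrite lee_fin ltW.
- by move=> x _; rewrite lee_fin normal_fun_ge0.
- by apply/measurable_EFinP; exact: measurable_normal_fun.
have -> : s * Num.sqrt (pi *+ 2) = (normal_peak s)^-1.
  by rewrite /normal_peak invrK -mulrnAr sqrtrM ?sqr_ge0 // sqrtr_sqr gtr0_norm.
move=> /(congr1 (fun z => ((normal_peak s)^-1)%:E * z)%E).
by rewrite muleA -EFinM mulVf ?gt_eqF // mul1e mule1.
Qed.

(** With [a = 1 / (2 s^2)] and [b = 1 / (2 t^2)] these are the two halves of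
    [(a - b) x^2 exp (- a x^2) <= exp (- b x^2) - exp (- a x^2)
                               <= (a - b) x^2 exp (- b x^2)]. *)
Lemma normal_fun_diff_ge (s t x : R) : 0 < s -> s < t ->
  ((s ^+ 2 *+ 2)^-1 - (t ^+ 2 *+ 2)^-1) * (x ^+ 2 * normal_fun 0 s x)
    + normal_fun 0 s x <= normal_fun 0 t x.
Proof.
move=> s0 st; rewrite /normal_fun subr0.
set a := (s ^+ 2 *+ 2)^-1; set b := (t ^+ 2 *+ 2)^-1.
have -> : - x ^+ 2 / (t ^+ 2 *+ 2) = (a - b) * x ^+ 2 + - x ^+ 2 * a.
  by rewrite -/b; ring.
rewrite -/a expRD; have := expR_ge1Dx ((a - b) * x ^+ 2).
by have := expR_gt0 (- x ^+ 2 * a); nra.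
Qed.

Lemma normal_fun_diff_le (s t x : R) : 0 < s -> s < t ->
  normal_fun 0 t x <=
  ((s ^+ 2 *+ 2)^-1 - (t ^+ 2 *+ 2)^-1) * (x ^+ 2 * normal_fun 0 t x)
    + normal_fun 0 s x.
Proof.
move=> s0 st; rewrite /normal_fun subr0.
set a := (s ^+ 2 *+ 2)^-1; set b := (t ^+ 2 *+ 2)^-1.
have -> : - x ^+ 2 / (s ^+ 2 *+ 2) = - ((a - b) * x ^+ 2) + - x ^+ 2 * b.
  by rewrite -/a; ring.
rewrite -/b expRD; have := expR_ge1Dx (- ((a - b) * x ^+ 2)).
by have := expR_gt0 (- x ^+ 2 * b); nra.
Qed.

Let sq_EFin_measurable :
  measurable_fun setT (fun x : R => (x ^+ 2)%:E).
Proof. by apply/measurable_EFinP; exact: measurable_funX. Qed.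

Let normal_moment_measurable (s : R) :
  measurable_fun setT (fun x : R => (x ^+ 2 * normal_fun 0 s x)%:E).
Proof.
apply/measurable_EFinP; apply: measurable_funM.
  exact: measurable_funX.
exact: measurable_normal_fun.
Qed.

Let normal_moment_ge0 (s : R) x : (0 <= (x ^+ 2 * normal_fun 0 s x)%:E)%E.
Proof. by rewrite lee_fin mulr_ge0 ?sqr_ge0 ?normal_fun_ge0. Qed.

Let normal_fun_measurableE (s : R) :
  measurable_fun setT (fun x : R => (normal_fun 0 s x)%:E).
Proof. by apply/measurable_EFinP; exact: measurable_normal_fun. Qed.

Lemma inv_double_sqr_diff (s t : R) : 0 < s -> s < t ->
  (s ^+ 2 *+ 2)^-1 - (t ^+ 2 *+ 2)^-1 =
  (t - s) * ((t + s) / (2 * s ^+ 2 * t ^+ 2)).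
Proof.
move=> s0 st; have t0 := lt_trans s0 st.
have dbl (x : R) : x *+ 2 = 2 * x by rewrite mulr_natl.
by rewrite !(dbl (_ ^+ 2)); field; rewrite !gt_eqF.
Qed.

(** Integrating the two bounds above gives difference quotients of
    [s |-> \int exp (- x^2 / (2 s^2)) = s sqrt (2 pi)] on both sides. *)
Lemma normal_moment_bounds (s t : R) : 0 < s -> s < t ->
  let J r := (\int[leb]_x (x ^+ 2 * normal_fun 0 r x)%:E)%E in
  let q := (t + s) / (2 * s ^+ 2 * t ^+ 2) in
  (q%:E * J s <= (Num.sqrt (pi *+ 2))%:E)%E /\
  ((Num.sqrt (pi *+ 2))%:E <= q%:E * J t)%E.
Proof.
move=> s0 st J q; have t0 := lt_trans s0 st; set c := Num.sqrt _.
have q0 : 0 < q by rewrite divr_gt0 ?addr_gt0 ?mulr_gt0 ?exprn_gt0.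
have D0 : 0 < (t - s) * q by rewrite mulr_gt0 // subr_gt0.
have J0 r : (0 <= J r)%E by apply: integral_ge0.
have mJ r : measurable_fun [set: measurableTypeR R]
    (fun x : R => (((t - s) * q) * (x ^+ 2 * normal_fun 0 r x))%:E).
  apply/measurable_EFinP; apply: measurable_funM => //.
  by apply/measurable_EFinP; exact: normal_moment_measurable.
have pJ r x : (0 <= (((t - s) * q) * (x ^+ 2 * normal_fun 0 r x))%:E)%E.
  by rewrite EFinM mule_ge0 // lee_fin ltW.
have pN r x : (0 <= (normal_fun 0 r x)%:E :> \bar R)%E.
  by rewrite lee_fin normal_fun_ge0.
have mD r u : measurable_fun [set: measurableTypeR R]
    (fun x : R => ((((t - s) * q) * (x ^+ 2 * normal_fun 0 r x))%:E
        + (normal_fun 0 u x)%:E)%E).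
  by apply: emeasurable_funD; [exact: mJ | exact: normal_fun_measurableE].
have intE r u : 0 < u ->
    (\int[leb]_x ((((t - s) * q) * (x ^+ 2 * normal_fun 0 r x))%:E
        + (normal_fun 0 u x)%:E) = ((t - s) * q)%:E * J r + (u * c)%:E)%E.
  move=> u0; rewrite (ge0_integralD _ _ _ (mJ r) _ (normal_fun_measurableE u)) //.
  rewrite integral_normal_fun0 //; congr (_ + _)%E.
  under eq_integral do rewrite EFinM.
  rewrite /J ge0_integralZl //; first exact: normal_moment_measurable.
  by rewrite lee_fin ltW.
have tsq : (t * c - s * c = (t - s) * c)%R by ring.
split.
  have : (((t - s) * q)%:E * J s + (s * c)%:E <= (t * c)%:E)%E.
    rewrite -intE // -integral_normal_fun0 //.
    apply: ge0_le_integral => //.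
    - by move=> x _; rewrite adde_ge0.
    - exact: normal_fun_measurableE.
    - move=> x _; rewrite -EFinD lee_fin -inv_double_sqr_diff //.
      exact: normal_fun_diff_ge.
  rewrite -leeBrDr // -EFinB tsq !EFinM -muleA lee_pmul2l // lte_fin subr_gt0 //.
have : ((t * c)%:E <= ((t - s) * q)%:E * J t + (s * c)%:E)%E.
  rewrite -intE // -integral_normal_fun0 //.
  apply: ge0_le_integral => //.
  - exact: normal_fun_measurableE.
  - move=> x _; rewrite -EFinD lee_fin -inv_double_sqr_diff //.
    exact: normal_fun_diff_le.
by rewrite -leeBlDr // -EFinB tsq !EFinM -muleA lee_pmul2l // lte_fin subr_gt0.
Qed.

(** As [t] tends to [s] from above or from below, the two bounds close up on the
    derivative of [s |-> s sqrt (2 pi)]. *)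
Lemma integral_sqr_normal_fun (s : R) : 0 < s ->
  (\int[leb]_x (x ^+ 2 * normal_fun 0 s x)%:E)%E =
  (s ^+ 3 * Num.sqrt (pi *+ 2))%:E.
Proof.
move=> s0; set c := Num.sqrt _; set J := (\int[leb]_x _)%E.
have c0 : 0 <= c by exact: sqrtr_ge0.
have J0 : (0 <= J)%E by apply: integral_ge0.
have pos u v : 0 < u -> 0 < v -> 0 < (u + v) / (2 * v ^+ 2 * u ^+ 2) :> R.
  by move=> *; rewrite divr_gt0 ?addr_gt0 ?mulr_gt0 ?exprn_gt0.
have Jfin : J \is a fin_num.
  have [h _] := normal_moment_bounds s0 (ltr_pwDr ltr01 (lexx s)).
  rewrite ge0_fin_numE // ltey; apply/eqP => Joo; move: h.
  by rewrite -/J Joo gt0_muley ?lte_fin ?pos ?addr_gt0.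
move: (normal_moment_bounds) => bnd.
rewrite -(fineK Jfin); congr (_%:E); set j := fine J.
have j0 : 0 <= j by rewrite fine_ge0.
apply/eqP; rewrite eq_le; apply/andP; split.
- have s2 : 0 < 2 * s by rewrite mulr_gt0.
  rewrite -(ler_pM2l s2).
  apply: (@le_of_le_small_error _ _ _ (4 * s ^+ 3 * c + 2 * s ^+ 2 * c) 1) => //.
    by rewrite addr_ge0 ?mulr_ge0 ?exprn_ge0 ?(ltW s0).
  move=> e e0 e1; have se : s < s + e by rewrite ltrDl.
  have [h _] := bnd _ _ s0 se; move: h.
  rewrite -/J -(fineK Jfin) -/j -EFinM lee_fin.
  rewrite mulrAC ler_pdivrMr ?mulr_gt0 ?exprn_gt0 ?addr_gt0 // => h.
  have := mulr_ge0 j0 (ltW e0).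
  have : 2 * s ^+ 2 * c * e ^+ 2 <= 2 * s ^+ 2 * c * e.
    rewrite ler_wpM2l ?mulr_ge0 ?exprn_ge0 ?(ltW s0) //.
    by rewrite expr2 ler_piMl // ltW.
  by move: h; rewrite -/c; lra.
- have s2 : 0 < 2 * s by rewrite mulr_gt0.
  rewrite -(ler_pM2l s2).
  apply: (@le_of_le_small_error _ _ _ (4 * s ^+ 3 * c) s) => //.
    by rewrite ?mulr_ge0 ?exprn_ge0 ?(ltW s0).
  move=> e e0 es; have se : s - e < s by rewrite ltrBlDr ltrDl.
  have se0 : 0 < s - e by rewrite subr_gt0.
  have [_ h] := bnd _ _ se0 se; move: h.
  rewrite -/J -(fineK Jfin) -/j -EFinM lee_fin.
  rewrite mulrAC ler_pdivlMr ?mulr_gt0 ?exprn_gt0 // => h.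
  have := mulr_ge0 j0 (ltW e0).
  have : 0 <= 2 * s ^+ 2 * c * e ^+ 2.
    by rewrite ?mulr_ge0 ?exprn_ge0 ?(ltW s0) ?(ltW e0).
  by move: h; rewrite -/c; lra.
Qed.

Lemma integral_sqr_centered_gauss (v : R) : 0 <= v ->
  (\int[centered_gauss v]_y (y ^+ 2)%:E)%E = v%:E.
Proof.
move=> v0; rewrite /centered_gauss; case: eqP => [->|/eqP vn0].
  by rewrite integral_dirac //= diracT mul1e expr0n.
have s0 : 0 < Num.sqrt v by rewrite sqrtr_gt0 lt0r vn0.
have sn0 : Num.sqrt v != 0 by rewrite gt_eqF.
rewrite ge0_integral_normal_prob //; last by move=> x; rewrite lee_fin sqr_ge0.
have p0 := normal_peak_gt0 sn0.
under eq_integral => x _.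
  rewrite normal_pdfE // -EFinM mulrCA EFinM.
  over.
rewrite ge0_integralZl // ?lee_fin ?(ltW p0) //; last first.
  exact: normal_moment_measurable.
rewrite integral_sqr_normal_fun // -EFinM; congr _%:E.
have -> : normal_peak (Num.sqrt v) = (Num.sqrt v * Num.sqrt (pi *+ 2))^-1.
  by rewrite /normal_peak -mulrnAr sqrtrM ?sqr_ge0 // sqrtr_sqr gtr0_norm.
have c0 : Num.sqrt (pi *+ 2 : R) != 0.
  by rewrite gt_eqF // sqrtr_gt0 pmulrn_lgt0 // pi_gt0.
rewrite -[RHS](sqr_sqrtr v0); field; by rewrite c0 sn0.
Qed.

Lemma ge0_integral_opp (f : R -> \bar R) :
  measurable_fun setT f -> (forall x, (0 <= f x)%E) ->
  (\int[leb]_x f x = \int[leb]_x f (- x)%R)%E.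
Proof.
move=> mf f0.
pose phi (y : measurableTypeR R) : measurableTypeR R := - y.
have mphi : measurable_fun setT phi by exact: measurable_funN.
have := @ge0_integral_pushforward _ _ _ _ _ phi mphi leb setT f measurableT.
rewrite preimage_setT => <- //.
apply: eq_measure_integral => //= E mE _.
exact: (esym (lebesgue_measureN mE)).
Qed.

(** Averaging [(c + y)^2] and [(c - y)^2], which have the same integral by
    symmetry of the law, removes the linear term. *)
Lemma integral_shift_sqr_centered_gauss (c v : R) : 0 <= v ->
  (\int[centered_gauss v]_y ((c + y) ^+ 2)%:E)%E = (c ^+ 2 + v)%:E.
Proof.
move=> v0.
have mc (c' : R) : measurable_fun setT (fun y : R => ((c' + y) ^+ 2)%:E).
  by apply/measurable_EFinP; apply: measurable_funX; exact: measurable_funD.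
have mo (c' : R) : measurable_fun setT (fun y : R => ((c' - y) ^+ 2)%:E).
  by apply/measurable_EFinP; apply: measurable_funX; exact: measurable_funB.
have pc (c' y : R) : (0 <= ((c' + y) ^+ 2)%:E)%E by rewrite lee_fin sqr_ge0.
set I := (\int[_]_y _)%E.
have sym : (\int[centered_gauss v]_y ((c - y) ^+ 2)%:E)%E = I.
  rewrite /I /centered_gauss; case: eqP => [_|/eqP vn0].
    have dir (g : R -> \bar R) : measurable_fun setT g ->
        (\int[dirac (0%R : measurableTypeR R)]_y g y = g 0%R)%E.
      by move=> mg; rewrite integral_dirac //= diracT mul1e.
    by rewrite (dir _ (mo c)) (dir _ (mc c)) subr0 addr0.
  rewrite (ge0_integral_normal_prob _ _ (mo c)); last first.
    by move=> x; rewrite lee_fin sqr_ge0.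
  rewrite (ge0_integral_normal_prob _ _ (mc c) (pc c)).
  have mi : measurable_fun setT (fun x : R =>
      ((c - x) ^+ 2)%:E * (normal_pdf 0 (Num.sqrt v) x)%:E)%E.
    apply: emeasurable_funM; first exact: mo.
    by apply/measurable_EFinP; exact: measurable_normal_pdf.
  have i0 (x : R) : (0 <= ((c - x) ^+ 2)%:E * (normal_pdf 0 (Num.sqrt v) x)%:E)%E.
    by rewrite mule_ge0 // lee_fin ?sqr_ge0 ?normal_pdf_ge0.
  rewrite (ge0_integral_opp mi i0); apply: eq_integral => x _.
  rewrite opprK; congr (_ * _%:E)%E.
  rewrite /normal_pdf; case: ifP => [|_]; last by rewrite /normal_fun !subr0 sqrrN.
  by rewrite gt_eqF // sqrtr_gt0 lt0r vn0.
have h : (I + I = (c ^+ 2 + v)%:E + (c ^+ 2 + v)%:E)%E.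
  rewrite -{1}sym -ge0_integralD //; [|exact: mo|exact: mc].
  under eq_integral => y _.
    rewrite -EFinD (_ : (c - y) ^+ 2 + (c + y) ^+ 2 = 2 * c ^+ 2 + 2 * y ^+ 2);
      last by ring.
    rewrite EFinD (EFinM 2 (y ^+ 2)); over.
  rewrite ge0_integralD //; first last.
  - by apply/measurable_EFinP; apply: measurable_funM => //; exact: measurable_funX.
  - by move=> x _; rewrite -EFinM lee_fin mulr_ge0 // sqr_ge0.
  - by move=> x _; rewrite lee_fin mulr_ge0 // sqr_ge0.
  rewrite integral_cst // ge0_integralZl // ?lee_fin //; last first.
    by move=> x _; rewrite lee_fin sqr_ge0.
  rewrite integral_sqr_centered_gauss //.
  rewrite [X in (_ * X + _)%E](_ : _ = 1%E); last exact: probability_setT.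
  by rewrite mule1 -EFinM -!EFinD; congr _%:E; ring.
have I0 : (0 <= I)%E by apply: integral_ge0.
clear sym; move: h I0; case: I => [r||] //= /eqP; rewrite -!EFinD eqe => /eqP h _.
by congr _%:E; lra.
Qed.

End Gaussian.

(** * Square-integrable random variables *)

Section SquareIntegrable.
Context {R : realType} {disp : measure_display} {Omega : measurableType disp}.
Context (Pr : probability Omega R).
Implicit Types f g h : Omega -> R.

Definition square_integrable (f : Omega -> R) : Prop := f \in Lfun Pr 2%:E.

Definition inner (f g : Omega -> R) : R := \int[Pr]_o (f o * g o).

Lemma square_integrable_measurable f :
  square_integrable f -> measurable_fun setT f.
Proof. by rewrite /square_integrable inE => /andP[/[!inE]]. Qed.

Lemma square_integrableP f : measurable_fun setT f ->
  (\int[Pr]_o (f o ^+ 2)%:E < +oo)%E -> square_integrable f.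
Proof.
move=> mf ioo; rewrite /square_integrable inE; apply/andP; split; rewrite inE //=.
rewrite /finite_norm unlock /Lnorm poweR_lty //.
rewrite (_ : (fun x => _) = (fun o => (f o ^+ 2)%:E)) //.
by apply/funext => o /=; rewrite powR_mulrn // real_normK ?num_real.
Qed.

Lemma square_integrableZD a f g : square_integrable f -> square_integrable g ->
  square_integrable (fun o => a * f o + g o).
Proof. exact: (proj2 (Lfun_submod_closed Pr (lee1n 2))). Qed.

Lemma square_integrable0 : square_integrable (fun=> 0).
Proof. exact: (proj1 (Lfun_submod_closed Pr (lee1n 2))). Qed.

Lemma square_integrableD f g : square_integrable f -> square_integrable g ->
  square_integrable (fun o => f o + g o).
Proof.
move=> Lf Lg; have := square_integrableZD 1 Lf Lg.
by under eq_fun do rewrite mul1r.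
Qed.

Lemma square_integrableZ a f : square_integrable f ->
  square_integrable (fun o => a * f o).
Proof.
move=> Lf; have := square_integrableZD a Lf square_integrable0.
by under eq_fun do rewrite addr0.
Qed.

Lemma integrable_mul f g : square_integrable f -> square_integrable g ->
  Pr.-integrable setT (EFin \o (fun o => f o * g o)).
Proof. by move=> Lf Lg; apply/Lfun1_integrable; exact: Lfun2_mul_Lfun1. Qed.

Lemma innerC f g : inner f g = inner g f.
Proof. by apply: eq_Rintegral => o _; rewrite mulrC. Qed.

Lemma innerDl f g h : square_integrable f -> square_integrable g ->
  square_integrable h -> inner (fun o => f o + g o) h = inner f h + inner g h.
Proof.
move=> Lf Lg Lh; rewrite /inner -RintegralD //; [|exact: integrable_mul..].
by apply: eq_Rintegral => o _; rewrite mulrDl.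
Qed.

Lemma innerDr f g h : square_integrable f -> square_integrable g ->
  square_integrable h -> inner f (fun o => g o + h o) = inner f g + inner f h.
Proof. by move=> Lf Lg Lh; rewrite ![inner f _]innerC innerDl. Qed.

Lemma innerZl a f g : square_integrable f -> square_integrable g ->
  inner (fun o => a * f o) g = a * inner f g.
Proof.
move=> Lf Lg; rewrite /inner -RintegralZl //; last exact: integrable_mul.
by apply: eq_Rintegral => o _; rewrite mulrA.
Qed.

Lemma inner_sqr f : square_integrable f ->
  (\int[Pr]_o (f o ^+ 2)%:E)%E = (inner f f)%:E.
Proof.
move=> Lf; rewrite /inner /Rintegral fineK; last first.
  by apply: integrable_fin_num => //; exact: integrable_mul.
by apply: eq_integral => o _; rewrite expr2.
Qed.

Lemma inner_sqrD f g : square_integrable f -> square_integrable g ->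
  inner (fun o => f o + g o) (fun o => f o + g o)
  = inner f f + 2 * inner f g + inner g g.
Proof.
move=> Lf Lg; rewrite innerDl ?innerDr //; last exact: square_integrableD.
by rewrite (innerC g f); ring.
Qed.

End SquareIntegrable.

(** * Conditionally Gaussian variables *)

Section ConditionalGaussian.
Context {R : realType} {disp : measure_display} {Omega : measurableType disp}.
Context (Pr : probability Omega R).
Implicit Types f g h : Omega -> R.

Definition sub_measurable (F : set (set Omega)) (f : Omega -> R) : Prop :=
  forall B, measurable B -> F (f @^-1` B).

Lemma sub_measurable_fun (F : set (set Omega)) f : F `<=` measurable ->
  sub_measurable F f -> measurable_fun setT f.
Proof. by move=> FM mf _ B mB; rewrite setTI; apply: FM; exact: mf. Qed.

Section JointLaw.
Context (F : set (set Omega)) (Y mean : Omega -> R) (v : R).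
Hypotheses (sF : sigma_algebra setT F) (FM : F `<=` measurable) (v_ge0 : 0 <= v).
Hypotheses (mY : measurable_fun setT Y) (mmean : sub_measurable F mean).
Hypothesis condY : forall E B, F E -> measurable B ->
  Pr (E `&` Y @^-1` B) = (\int[Pr]_(o in E) gauss_law (mean o) v B)%E.

Local Notation N := (centered_gauss v).

(** Given [F], the pair [(f, Y)] has the law of [(f, mean + y)] with [y] drawn
    from the centred law independently of everything else: both laws agree on
    rectangles, hence everywhere, and the square integrates by Fubini. *)
Lemma integral_sqr_cond_gauss f : sub_measurable F f ->
  (\int[Pr]_o ((f o + Y o) ^+ 2)%:E =
   \int[Pr]_o ((f o + mean o) ^+ 2)%:E + v%:E)%E.
Proof.
move=> Ff.
have mf := sub_measurable_fun FM Ff; have mm := sub_measurable_fun FM mmean.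
pose phi1 (o : Omega) : measurableTypeR R * measurableTypeR R := (f o, Y o).
pose phi2 (z : Omega * measurableTypeR R) : measurableTypeR R * measurableTypeR R
  := (f z.1, mean z.1 + z.2).
have mphi1 : measurable_fun setT phi1 by apply/measurable_fun_pairP.
have mphi2 : measurable_fun setT phi2.
  apply/measurable_fun_pairP; split.
    by apply: (measurableT_comp mf); exact: measurable_fst.
  apply: measurable_funD; last exact: measurable_snd.
  by apply: (measurableT_comp mm); exact: measurable_fst.
pose nu1 := pushforward Pr (mfun_of mphi1).
pose nu2 := pushforward (Pr \x N)%E (mfun_of mphi2).
pose h (z : measurableTypeR R * measurableTypeR R) : \bar R := ((z.1 + z.2) ^+ 2)%:E.
have mh : measurable_fun setT h.
  apply/measurable_EFinP; apply: measurable_funX; apply: measurable_funD.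
    exact: measurable_fst.
  exact: measurable_snd.
have h0 z : (0 <= h z)%E by rewrite lee_fin sqr_ge0.
have rect A B : measurable A -> measurable B -> nu1 (A `*` B) = nu2 (A `*` B).
  move=> mA mB.
  have -> : nu1 (A `*` B) = Pr (f @^-1` A `&` Y @^-1` B) by [].
  rewrite condY //; last exact: Ff.
  rewrite /nu2 /pushforward /= /product_measure1 /=.
  rewrite integral_mkcond; apply: eq_integral => o _; rewrite patchE.
  case: ifPn => [|] fo.
    rewrite gauss_law_shift //; congr (N _).
    apply/seteqP; split=> y /=; rewrite /xsection /= inE /=.
      by move=> By; split=> //; rewrite inE in fo.
    by case.
  rewrite (_ : xsection _ _ = set0) ?measure0 //.
  apply/seteqP; split=> y //=; rewrite /xsection /= inE /= => -[fA _].
  by move: fo; rewrite notin_setE; apply.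
have nu12 E : measurable E -> nu1 E = nu2 E.
  pose G := [set A `*` B | A in @measurable _ (measurableTypeR R)
                         & B in @measurable _ (measurableTypeR R)].
  apply: (measure_unique G (fun=> setT)).
  - exact: measurable_prod_measurableType.
  - move=> _ _ [A mA [B mB <-]] [A' mA' [B' mB' <-]].
    exists (A `&` A'); first exact: measurableI.
    by exists (B `&` B'); [exact: measurableI | rewrite setXI].
  - by move=> _; exists setT => //; exists setT => //; rewrite setXTT.
  - by rewrite bigcup_const.
  - by move=> _ [A mA [B mB <-]]; exact: rect.
  - move=> _; rewrite [X in (X < _)%E](_ : _ = Pr setT) //.
    by rewrite probability_setT ltry.
transitivity (\int[nu1]_z h z)%E.
  by rewrite ge0_integral_pushforward.
transitivity (\int[nu2]_z h z)%E.
  by apply: eq_measure_integral => E mE _; exact: nu12.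
rewrite ge0_integral_pushforward //= fubini_tonelli1 //; last first.
  exact: measurableT_comp.
rewrite /fubini_F /=.
transitivity (\int[Pr]_o (((f o + mean o) ^+ 2)%:E + v%:E))%E.
  apply: eq_integral => o _; rewrite -EFinD -integral_shift_sqr_centered_gauss //.
  by apply: eq_integral => y _; rewrite /h /= addrA.
rewrite ge0_integralD //.
- congr (_ + _)%E; rewrite integral_cst //.
  by rewrite [X in (_ * X)%E](_ : _ = 1%E) ?mule1 //; exact: probability_setT.
- by move=> o _; rewrite lee_fin sqr_ge0.
- by apply/measurable_EFinP; apply: measurable_funX; exact: measurable_funD.
Qed.

(** Polarization: the previous identity for [f = 0] gives the second moment of
    [Y], and then the cross moment with [f] is the remaining unknown. *)
Lemma cond_gauss_moments : square_integrable Pr mean ->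
  [/\ square_integrable Pr Y, inner Pr Y Y = inner Pr mean mean + v
    & forall f, sub_measurable F f -> square_integrable Pr f ->
        inner Pr f Y = inner Pr f mean].
Proof.
move=> Lm.
have F0 : sub_measurable F (fun=> 0).
  move=> B _; have [B0|B0] := pselect (B 0).
    have -> : (fun=> 0) @^-1` B = [set: Omega] by apply/seteqP; split.
    rewrite -(setD0 setT); by case: sF => F0 FC _; exact: FC.
  by rewrite (_ : _ @^-1` _ = set0); [case: sF | apply/seteqP; split=> o].
have YY : (\int[Pr]_o (Y o ^+ 2)%:E = (inner Pr mean mean + v)%:E)%E.
  have := integral_sqr_cond_gauss F0.
  under eq_integral do rewrite add0r.
  by move=> ->; under eq_integral do rewrite add0r; rewrite inner_sqr.
have LY : square_integrable Pr Y by apply: square_integrableP => //; rewrite YY ltry.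
have EYY : inner Pr Y Y = inner Pr mean mean + v.
  by apply: EFin_inj; rewrite -inner_sqr.
split=> // f Ff Lf; have := integral_sqr_cond_gauss Ff.
rewrite (inner_sqr (square_integrableD Lf LY)).
rewrite (inner_sqr (square_integrableD Lf Lm)) => -[].
by rewrite !inner_sqrD // EYY; lra.
Qed.

End JointLaw.
End ConditionalGaussian.

(** * Measurability with respect to generated sigma-algebras *)

Section SubMeasurable.
Context {R : realType} {disp : measure_display} {Omega : measurableType disp}.
Implicit Types (G : set (set Omega)) (f g : Omega -> R).

Lemma sub_measurableP G f : sub_measurable <<s G >> f <->
  measurable_fun (setT : set (g_sigma_algebraType G)) f.
Proof.
split=> [h _ B mB|h B mB]; first by rewrite setTI; exact: h.
by have := h measurableT B mB; rewrite setTI.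
Qed.

Lemma sub_measurable_le F F' f : F `<=` F' ->
  sub_measurable F f -> sub_measurable F' f.
Proof. by move=> FF' h B mB; apply: FF'; exact: h. Qed.

Definition vec_measurable n F (X : Omega -> 'cV[R]_n) : Prop :=
  forall l, sub_measurable F (fun o => X o l ord0).

Lemma sub_measurableD G f g : sub_measurable <<s G >> f ->
  sub_measurable <<s G >> g -> sub_measurable <<s G >> (fun o => f o + g o).
Proof.
by move=> /sub_measurableP mf /sub_measurableP mg; apply/sub_measurableP/measurable_funD.
Qed.

Lemma sub_measurableZ G a f : sub_measurable <<s G >> f ->
  sub_measurable <<s G >> (fun o => a * f o).
Proof. by move=> /sub_measurableP mf; apply/sub_measurableP/measurable_funM. Qed.

Lemma sub_measurable_dot G n (X : Omega -> 'cV[R]_n) (a : 'I_n -> R) :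
  vec_measurable <<s G >> X -> sub_measurable <<s G >> (fun o => \sum_l a l * X o l ord0).
Proof.
move=> mX; elim: (index_enum _) => [|l r IH].
  under eq_fun do rewrite big_nil.
  by apply/sub_measurableP; exact: measurable_cst.
under eq_fun do rewrite big_cons.
by apply: sub_measurableD => //; exact: sub_measurableZ.
Qed.

Lemma vec_measurable_mulmx G m n (A : 'M[R]_(m, n)) (X : Omega -> 'cV[R]_n) :
  vec_measurable <<s G >> X -> vec_measurable <<s G >> (fun o => A *m X o).
Proof.
move=> mX l; have := sub_measurable_dot (A l) mX.
by under [X in _ -> sub_measurable _ X]eq_fun do rewrite mxE.
Qed.

Lemma vec_measurableD G n (X Y : Omega -> 'cV[R]_n) :
  vec_measurable <<s G >> X -> vec_measurable <<s G >> Y ->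
  vec_measurable <<s G >> (fun o => X o + Y o).
Proof.
move=> mX mY l; have := sub_measurableD (mX l) (mY l).
by under [X in _ -> sub_measurable _ X]eq_fun do rewrite mxE.
Qed.

Lemma dotv_sum n (a v : 'cV[R]_n) : dotv a v = \sum_l a l ord0 * v l ord0.
Proof. by rewrite dotvE; apply: eq_bigr => l _; rewrite big_ord1. Qed.

Lemma sub_measurable_dotv G n (a : 'cV[R]_n) (X : Omega -> 'cV[R]_n) :
  vec_measurable <<s G >> X -> sub_measurable <<s G >> (fun o => dotv a (X o)).
Proof.
move=> mX; have := sub_measurable_dot (a ^~ ord0) mX.
by under [X in _ -> sub_measurable _ X]eq_fun do rewrite dotv_sum.
Qed.

Lemma vec_measurable_sigma_of n (X : Omega -> 'cV[R]_n) :
  vec_measurable (sigma_of X) X.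
Proof.
move=> l B mB; apply: sub_sigma_algebra.
rewrite (bigD1 l) //=; left; exists B => //; by rewrite setTI.
Qed.

Lemma sigma_of_measurable n (X : Omega -> 'cV[R]_n) :
  random_vector X -> sigma_of X `<=` measurable.
Proof.
move=> rX; apply: smallest_sub.
  exact: sigma_algebra_measurable.
elim/big_ind: _ => [//|A B hA hB|l _]; first by rewrite subUset.
by move=> _ [B mB <-]; exact: rX.
Qed.

End SubMeasurable.

(** * Second moments of the noise *)

Section NoiseMoments.
Context {R : realType} {disp : measure_display} {Omega : measurableType disp}.
Context (Pr : probability Omega R).

Lemma inner0r f : inner Pr f (fun=> 0) = 0.
Proof. by rewrite /inner /Rintegral; under eq_integral do rewrite mulr0; rewrite integral0. Qed.

(** Independence from [G] is the conditional statement with mean zero. *)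
Lemma indep_gauss_moments (G : set (set Omega)) (Y : Omega -> R) (v : R) :
  <<s G >> `<=` measurable -> 0 <= v -> measurable_fun setT Y ->
  (forall E B, <<s G >> E -> measurable B ->
    Pr (E `&` Y @^-1` B) = (Pr E * gauss_law 0 v B)%E) ->
  [/\ square_integrable Pr Y, inner Pr Y Y = v
    & forall f, sub_measurable <<s G >> f -> square_integrable Pr f ->
        inner Pr f Y = 0].
Proof.
move=> GM v0 mY h.
have m0 : sub_measurable <<s G >> (fun=> 0 : R).
  by apply/sub_measurableP; exact: measurable_cst.
have hc E B : <<s G >> E -> measurable B ->
    Pr (E `&` Y @^-1` B) = (\int[Pr]_(o in E) gauss_law 0 v B)%E.
  move=> GE mB; rewrite h // muleC integral_cst //; exact: GM.
have [LY YY fY] := cond_gauss_moments (smallest_sigma_algebra _ _) GM v0 mY m0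
  hc (square_integrable0 Pr).
split=> // [|f Ff Lf]; last by rewrite fY // inner0r.
by rewrite YY inner0r add0r.
Qed.

(** Second moments involve the variables two at a time, so that independence is
    applied to pairs: a noise and the initial states, or two noises. *)
Lemma noise_moments (I : eqType) d (x1 : I -> Omega -> 'cV[R]_d) w (W : 'M[R]_d) :
  psd W -> noise_model Pr x1 w W -> forall i t c,
  [/\ square_integrable Pr (fun o => dotv c (w i t o)),
      inner Pr (fun o => dotv c (w i t o)) (fun o => dotv c (w i t o)) = quad W c,
      forall j q, square_integrable Pr (fun o => dotv q (x1 j o)) ->
        inner Pr (fun o => dotv q (x1 j o)) (fun o => dotv c (w i t o)) = 0
    & forall s q, s != t ->
        square_integrable Pr (fun o => dotv q (w i s o)) ->
        inner Pr (fun o => dotv q (w i s o)) (fun o => dotv c (w i t o)) = 0].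
Proof.
move=> [_ pW] nm i t c; set Y := fun o => dotv c (w i t o).
have mY : sub_measurable (sigma_of (w i t)) Y.
  by apply: sub_measurable_dotv; exact: vec_measurable_sigma_of.
have mYT : measurable_fun setT Y.
  by apply: sub_measurable_fun mY; apply: sigma_of_measurable; exact: noise_random nm i t.
pose F (k : option (I * nat)) : set (set Omega) :=
  if k is Some (i, t) then sigma_of (w i t)
  else <<s \bigcup_i sigma_of (x1 i) >>.
have FM k : F k `<=` measurable.
  case: k => [[j s]|] /=; first exact: (sigma_of_measurable (noise_random nm j s)).
  apply: smallest_sub; first exact: sigma_algebra_measurable.
  by move=> A [j _]; apply: sigma_of_measurable; exact: init_random nm j.
have pair k E B : k != Some (i, t) -> F k E -> measurable B ->
    Pr (E `&` Y @^-1` B) = (Pr E * gauss_law 0 (quad W c) B)%E.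
  move=> ki FE mB.
  pose E' l := if l == k then E else Y @^-1` B.
  have := @noise_indep _ _ _ _ _ _ _ _ _ nm [:: k; Some (i, t)] E'.
  rewrite /= inE ki => /(_ isT) h.
  have -> : E `&` Y @^-1` B = \bigcap_(l in [set` [:: k; Some (i, t)]]) E' l.
    apply/seteqP; split=> o.
      move=> [Eo Yo] l /=; rewrite /E'; case: eqP => // _.
    move=> h'; split; first by have := h' k; rewrite /E' eqxx; apply; rewrite /= inE eqxx.
    have := h' (Some (i, t)); rewrite /E' eq_sym (negPf ki); apply.
    by rewrite /= !inE eqxx orbT.
  rewrite h; last first.
    move=> l; rewrite !inE /E' => /orP[/eqP ->|/eqP ->]; first by rewrite eqxx.
    by rewrite eq_sym (negPf ki); exact: mY.
  rewrite big_cons big_seq1 /E' eqxx eq_sym (negPf ki) EFinM.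
  rewrite !fineK ?fin_num_measure //; last 2 first.
  - exact: (FM (Some (i, t)) _ (mY _ mB)).
  - exact: FM FE.
  congr (_ * _)%E; have := noise_law nm i t c mB.
  have -> : dotv c (0 : 'cV[R]_d) = 0 by rewrite dotvE mxdotC mxdot0l.
  by move=> <-.
have [LY YY x1Y] := indep_gauss_moments (FM None) (pW c) mYT (fun E B => @pair None E B isT).
split=> // [j q Lq|s q st Lq].
  apply: x1Y => //; apply: sub_measurable_dotv => l.
  apply: sub_measurable_le (@vec_measurable_sigma_of _ _ _ _ (x1 j) l).
  by move=> A hA; apply: sub_sigma_algebra; exists j.
have ks : Some (i, s) != Some (i, t).
  by apply: contra st => /eqP [->].
have [_ _ wY] := indep_gauss_moments (FM (Some (i, s))) (pW c) mYT (fun E B => @pair _ E B ks).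
by apply: wY => //; apply: sub_measurable_dotv; exact: vec_measurable_sigma_of.
Qed.

End NoiseMoments.

(** * Propagation of second moments *)

Section SecondOrder.
Context {R : realType} {disp : measure_display} {Omega : measurableType disp}.
Context (Pr : probability Omega R).

(** Uncentred second moments, tested on linear functionals because the Gaussian
    laws are given on linear functionals. *)
Definition has_moments n (X : Omega -> 'cV[R]_n) (M : 'M[R]_n) : Prop :=
  forall q, square_integrable Pr (fun o => dotv q (X o)) /\
    inner Pr (fun o => dotv q (X o)) (fun o => dotv q (X o)) = quad M q.

(** A Gram factor of [G] writes the integrand as a sum of squares of linear
    functionals of [X]. *)
Lemma integral_quad n (X : Omega -> 'cV[R]_n) (M G : 'M[R]_n) :
  has_moments X M -> psd G ->
  (\int[Pr]_o (quad G (X o))%:E = (\tr (G *m M))%:E)%E.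
Proof.
move=> hX /psd_factor[L ->]; rewrite mxtrace_gram_mul.
have quadE o : quad (L *m L^T) (X o) = \sum_j dotv (col j L) (X o) ^+ 2.
  rewrite quad_gram fronorm_sqr /mxdot; apply: eq_bigr => j _.
  rewrite big_ord1 -expr2; congr (_ ^+ 2).
  by rewrite dotv_sum mxE; apply: eq_bigr => l _; rewrite !mxE.
under eq_integral do rewrite quadE -sumEFin.
rewrite ge0_integral_sum //; last 2 first.
- move=> j; apply/measurable_EFinP; apply: measurable_funX.
  exact: square_integrable_measurable (proj1 (hX _)).
- by move=> j o _; rewrite lee_fin sqr_ge0.
rewrite -sumEFin; apply: eq_bigr => j _.
by have [Lj Ej] := hX (col j L); rewrite inner_sqr // Ej.
Qed.

Lemma measurable_quad n (X : Omega -> 'cV[R]_n) (M G : 'M[R]_n) :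
  has_moments X M -> measurable_fun setT (fun o => quad G (X o)).
Proof.
move=> hX; rewrite /quad.
under eq_fun do rewrite dotv_sum.
apply: measurable_sum => l.
have coord (l' : 'I_n) : measurable_fun setT (fun o => X o l' ord0).
  have := square_integrable_measurable (proj1 (hX (delta_mx l' ord0))).
  rewrite (_ : (fun o => dotv _ _) = (fun o => X o l' ord0)) //.
  apply/funext => o; rewrite dotv_sum (bigD1 l') //= big1 => [|i il].
    by rewrite mxE !eqxx mul1r addr0.
  by rewrite mxE (negPf il) mul0r.
apply: measurable_funM => //.
under eq_fun do rewrite mxE.
by apply: measurable_sum => i; apply: measurable_funM.
Qed.

Lemma total_cost_trace m d k (Q : 'I_m -> nat -> 'M[R]_d)
    (Rc : 'I_m -> nat -> 'M[R]_k) T x u (X : nat -> 'M[R]_d) (U : nat -> 'M[R]_k) :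
  (forall i t, psd (Q i t)) -> (forall i t, psd (Rc i t)) ->
  (forall t, (t < T)%N -> has_moments (x t) (X t)) ->
  (forall t, (t < T)%N -> has_moments (u t) (U t)) ->
  total_cost Pr Q Rc T x u =
  (\sum_(t < T) (\tr ((\sum_i Q i t) *m X t) + \tr ((\sum_i Rc i t) *m U t)))%:E.
Proof.
move=> pQ pR hx hu; rewrite /total_cost unlock.
have sQ t : psd (\sum_i Q i t) by apply: psd_sum => i.
have sR t : psd (\sum_i Rc i t) by apply: psd_sum => i.
under eq_integral do rewrite -sumEFin.
rewrite ge0_integral_sum //; last 2 first.
- move=> t; apply/measurable_EFinP; apply: measurable_funD.
    exact: measurable_quad (hx t (ltn_ord t)).
  exact: measurable_quad (hu t (ltn_ord t)).
- by move=> t o _; rewrite lee_fin addr_ge0 //; [case: (sQ t)|case: (sR t)].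
rewrite -sumEFin; apply: eq_bigr => t _.
under eq_integral do rewrite EFinD.
rewrite ge0_integralD //.
- by rewrite (integral_quad (hx t (ltn_ord t))) // (integral_quad (hu t (ltn_ord t))).
- by move=> o _; rewrite lee_fin; case: (sQ t).
- by apply/measurable_EFinP; exact: measurable_quad (hx t (ltn_ord t)).
- by move=> o _; rewrite lee_fin; case: (sR t).
- by apply/measurable_EFinP; exact: measurable_quad (hu t (ltn_ord t)).
Qed.

Section Step.
Context {d k : nat} (A : 'M[R]_d) (B : 'M[R]_(d, k)) (W : 'M[R]_d).
Context (w : nat -> Omega -> 'cV[R]_d).
Hypothesis w_moments : forall t, has_moments (w t) W.
Hypothesis w_uncorr : forall s t q c, s != t ->
  inner Pr (fun o => dotv q (w s o)) (fun o => dotv c (w t o)) = 0.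

Definition uncorrelated_from (t : nat) n (X : Omega -> 'cV[R]_n) : Prop :=
  forall q c s, (t <= s)%N ->
    inner Pr (fun o => dotv q (X o)) (fun o => dotv c (w s o)) = 0.

Definition feedback_cov (K : 'M[R]_(k, d)) (V : 'M[R]_k) (X : 'M[R]_d) : 'M[R]_d :=
  (A + B *m K) *m X *m (A + B *m K)^T + B *m V *m B^T + W.

Lemma control_moments (x : Omega -> 'cV[R]_d) (u : Omega -> 'cV[R]_k) K V X :
  has_moments x X ->
  (forall a, square_integrable Pr (fun o => dotv a (u o)) /\
    inner Pr (fun o => dotv a (u o)) (fun o => dotv a (u o)) =
    inner Pr (fun o => dotv a (K *m x o)) (fun o => dotv a (K *m x o)) + quad V a) ->
  has_moments u (K *m X *m K^T + V).
Proof.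
move=> hx hu a; have [Lu ->] := hu a; split=> //.
under eq_fun do rewrite dotv_mulmx.
by rewrite (proj2 (hx _)) quadD quad_conj.
Qed.

(** The noise of the round is uncorrelated with the state and the control, and
    within second moments the control may be replaced by its conditional mean
    [K x], up to the additional variance [V]; this turns [A x + B u] into
    [(A + B K) x]. *)
Lemma moment_step (t : nat) (x x' : Omega -> 'cV[R]_d) (u : Omega -> 'cV[R]_k) K V X :
  has_moments x X -> uncorrelated_from t x ->
  (forall o, x' o = A *m x o + B *m u o + w t o) ->
  (forall a, square_integrable Pr (fun o => dotv a (u o)) /\
    inner Pr (fun o => dotv a (u o)) (fun o => dotv a (u o)) =
    inner Pr (fun o => dotv a (K *m x o)) (fun o => dotv a (K *m x o)) + quad V a) ->
  (forall a q, inner Pr (fun o => dotv q (x o)) (fun o => dotv a (u o)) =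
               inner Pr (fun o => dotv q (x o)) (fun o => dotv a (K *m x o))) ->
  (forall a c s, inner Pr (fun o => dotv c (w s o)) (fun o => dotv a (u o)) =
                 inner Pr (fun o => dotv c (w s o)) (fun o => dotv a (K *m x o))) ->
  has_moments x' (feedback_cov K V X) /\ uncorrelated_from t.+1 x'.
Proof.
move=> hx xw ex' hu ux uw.
have Lx q := proj1 (hx q); have Lu a := proj1 (hu a).
have Lw s c := proj1 (w_moments s c).
have LKx a : square_integrable Pr (fun o => dotv a (K *m x o)).
  by under eq_fun do rewrite dotv_mulmx; exact: Lx.
have eq' q : (fun o => dotv q (x' o)) =
    (fun o => (dotv (A^T *m q) (x o) + dotv (B^T *m q) (u o)) + dotv q (w t o)).
  by apply/funext => o; rewrite ex' !dotvDr !dotv_mulmx.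
have wKx a c s : (t <= s)%N ->
    inner Pr (fun o => dotv c (w s o)) (fun o => dotv a (K *m x o)) = 0.
  by move=> ts; under [X in inner _ _ X]eq_fun do rewrite dotv_mulmx; rewrite innerC xw.
split=> [q|q c s ts].
  rewrite eq'; have Lxu := square_integrableD (Lx (A^T *m q)) (Lu (B^T *m q)).
  split; first exact: square_integrableD.
  rewrite inner_sqrD // (proj2 (w_moments _ _)) (inner_sqrD (Lx _) (Lu _)).
  rewrite (innerDl (Lx _) (Lu _) (Lw t q)) xw //.
  rewrite (innerC _ (fun o => dotv (B^T *m q) (u o))) uw wKx // ux (proj2 (hu _)).
  have -> : inner Pr (fun o => dotv (A^T *m q) (x o)) (fun o => dotv (A^T *m q) (x o))
      + 2 * inner Pr (fun o => dotv (A^T *m q) (x o))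
          (fun o => dotv (B^T *m q) (K *m x o))
      + (inner Pr (fun o => dotv (B^T *m q) (K *m x o))
          (fun o => dotv (B^T *m q) (K *m x o)) + quad V (B^T *m q))
      = quad X ((A + B *m K)^T *m q) + quad V (B^T *m q).
    rewrite -(proj2 (hx _)) addrA -inner_sqrD //; congr (_ + _).
    have e : (fun o => dotv (A^T *m q) (x o) + dotv (B^T *m q) (K *m x o)) =
             (fun o => dotv ((A + B *m K)^T *m q) (x o)).
      apply/funext => o; rewrite -!dotv_mulmx -dotvDr; congr (dotv q _).
      by rewrite mulmxDl mulmxA.
    by rewrite e.
  by rewrite /feedback_cov !quadD !quad_conj; ring.
rewrite eq' (innerDl (square_integrableD (Lx _) (Lu _)) (Lw t q) (Lw s c)).
rewrite (innerDl (Lx _) (Lu _) (Lw s c)) xw ?(ltnW ts) //.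
rewrite (innerC _ (fun o => dotv (B^T *m q) (u o))) uw wKx ?(ltnW ts) //.
by rewrite w_uncorr ?addr0 // neq_ltn ts.
Qed.

End Step.

End SecondOrder.

(** * Second moments of the initial states *)

Section InitialState.
Context {R : realType} {disp : measure_display} {Omega : measurableType disp}.
Context (Pr : probability Omega R).

Lemma normal_prob_sd0_itv (m : R) : normal_prob m 0 `]-oo, 0] = 0%E.
Proof.
rewrite /normal_prob /normal_pdf eqxx integral_indic //.
have -> : `[0, 1]%classic `&` `]-oo, 0%R] = [set 0 : R].
  apply/seteqP; split=> y /=; rewrite !in_itv /=.
    by case=> /andP[y0 _] y0'; apply/eqP; rewrite eq_le y0 y0'.
  by move=> ->; rewrite lexx ler01.
exact: lebesgue_measure_set1.
Qed.

(** A negative variance would make both [q . X] and [- q . X] uniform on the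
    unit interval, hence both almost surely positive. *)
Lemma gaussian_quad_ge0 n (X : Omega -> 'cV[R]_n) (M : 'M[R]_n) q :
  random_vector X -> gaussian Pr X 0 M -> 0 <= quad M q.
Proof.
move=> rX gX; rewrite leNgt; apply/negP => Mq.
have eE (c : 'cV[R]_n) : [set o | dotv c (X o) <= 0] =
    (fun o => dotv c (X o)) @^-1` `]-oo, 0%R].
  by apply/seteqP; split=> o /=; rewrite in_itv.
have null (c : 'cV[R]_n) : quad M c < 0 -> Pr [set o | dotv c (X o) <= 0] = 0%E.
  move=> Mc; have := gX c `]-oo, 0%R]%classic (measurable_itv _).
  by rewrite /gauss_law lt_eqF // ler0_sqrtr ?(ltW Mc) // normal_prob_sd0_itv eE.
have mX c : measurable_fun setT (fun o => dotv c (X o)).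
  apply: (sub_measurable_fun (sigma_of_measurable rX)).
  by apply: sub_measurable_dotv; exact: vec_measurable_sigma_of.
have mE c : measurable [set o | dotv c (X o) <= 0].
  by rewrite eE -[Y in measurable Y]setTI; exact: mX.
have := probability_setT Pr.
have -> : [set: Omega] = [set o | dotv q (X o) <= 0] `|` [set o | dotv (- q) (X o) <= 0].
  apply/esym/seteqP; split=> // o _ /=; rewrite [dotv (- q) _]dotvE mxdotNl -dotvE.
  by rewrite oppr_le0; have [|/ltW] := leP (dotv q (X o)) 0; [left | right].
move=> h; have MNq : quad M (- q) < 0.
  by rewrite -scaleN1r quad_scale sqrrN expr1n mul1r.
have U : (Pr ([set o | (dotv q (X o) <= 0)%R] `|` [set o | (dotv (- q) (X o) <= 0)%R])
    <= Pr [set o | (dotv q (X o) <= 0)%R] + Pr [set o | (dotv (- q) (X o) <= 0)%R])%E.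
  exact: measureU2.
move: U; rewrite (null q Mq) (null (- q) MNq) h.
by rewrite adde0 lee_fin ler10.
Qed.

Lemma gaussian_has_moments n (X : Omega -> 'cV[R]_n) (M : 'M[R]_n) :
  random_vector X -> gaussian Pr X 0 M -> has_moments Pr X M.
Proof.
move=> rX gX q; have v0 := gaussian_quad_ge0 q rX gX.
have mY : measurable_fun setT (fun o => dotv q (X o)).
  apply: (sub_measurable_fun (sigma_of_measurable rX)).
  by apply: sub_measurable_dotv; exact: vec_measurable_sigma_of.
have E : (\int[Pr]_o (dotv q (X o) ^+ 2)%:E = (quad M q)%:E)%E.
  rewrite -integral_sqr_centered_gauss //.
  have mY' : measurable_fun setT ((fun o => dotv q (X o)) : Omega -> measurableTypeR R).
    by [].
  have msq : measurable_fun [set: measurableTypeR R] (fun y : R => (y ^+ 2)%:E).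
    by apply/measurable_EFinP; exact: measurable_funX.
  transitivity (\int[pushforward Pr (mfun_of mY')]_y (y ^+ 2)%:E)%E.
    rewrite ge0_integral_pushforward // => y _; by rewrite lee_fin sqr_ge0.
  apply: eq_measure_integral => B mB _.
  rewrite /pushforward /=; have := gX q B mB.
  rewrite gauss_law_shift // dotvE mxdotC mxdot0l.
  under [X in _ = centered_gauss _ X]eq_set do rewrite add0r.
  by [].
have L : square_integrable Pr (fun o => dotv q (X o)).
  by apply: square_integrableP => //; rewrite E ltry.
by split=> //; apply: EFin_inj; rewrite -inner_sqr.
Qed.

(** The square of a linear functional expands bilinearly in the coordinates, each
    of which is square integrable by the diagonal entries of [M]. *)
Lemma second_moment_has_moments n (X : Omega -> 'cV[R]_n) (M : 'M[R]_n) :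
  random_vector X -> second_moment Pr X M -> has_moments Pr X M.
Proof.
move=> rX mM q.
have Lc (l : 'I_n) : square_integrable Pr (fun o => X o l ord0).
  apply: square_integrableP; first exact: rX.
  have := mM l l; rewrite unlock => h.
  by under eq_integral do rewrite expr2; rewrite h ltry.
have Ec (a b : 'I_n) : inner Pr (fun o => X o a ord0) (fun o => X o b ord0) = M a b.
  by have := mM a b; rewrite unlock /inner /Rintegral => ->.
have sumP (r : seq 'I_n) : square_integrable Pr (fun o => \sum_(l <- r) q l ord0 * X o l ord0) /\
    forall g, square_integrable Pr g ->
    inner Pr (fun o => \sum_(l <- r) q l ord0 * X o l ord0) g =
    \sum_(l <- r) q l ord0 * inner Pr (fun o => X o l ord0) g.
  elim: r => [|l r [Lr Er]].
    split=> [|g Lg]; under eq_fun do rewrite big_nil; first exact: square_integrable0.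
    by rewrite big_nil innerC inner0r.
  have Ll := square_integrableZ (q l ord0) (Lc l).
  split=> [|g Lg]; under eq_fun do rewrite big_cons; first exact: square_integrableD.
  by rewrite innerDl // innerZl // Er // big_cons.
have [Lq Eq] := sumP (index_enum _).
have -> : (fun o => dotv q (X o)) = (fun o => \sum_l q l ord0 * X o l ord0).
  by apply/funext => o; rewrite dotv_sum.
split=> //; rewrite Eq // /quad dotv_sum; apply: eq_bigr => a _; congr (_ * _).
rewrite innerC Eq // mxE; apply: eq_bigr => b _.
by rewrite innerC Ec mulrC.
Qed.

End InitialState.

(** * Expected costs of the two systems *)

Section Runs.
Context {R : realType} {d k : nat}.

Fixpoint state_cov (A : 'M[R]_d) (B : 'M[R]_(d, k)) (W : 'M[R]_d)
    (K : nat -> 'M[R]_(k, d)) (V : nat -> 'M[R]_k) (X0 : 'M[R]_d) (t : nat) : 'M[R]_d :=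
  if t is s.+1 then feedback_cov A B W (K s) (V s) (state_cov A B W K V X0 s) else X0.

(** A linear controller is a control with vanishing policy covariance. *)
Lemma linear_cost m (disp : measure_display) (Omega : measurableType disp)
    (Pr : probability Omega R) A B W Ks Ms xs ws us
    (Q : 'I_m -> nat -> 'M[R]_d) (Rc : 'I_m -> nat -> 'M[R]_k) T :
  psd W -> (forall i t, psd (Q i t)) -> (forall i t, psd (Rc i t)) ->
  linear_run Pr A B W Ks Ms xs ws us ->
  let X := state_cov A B W (fun=> Ks) (fun=> 0) Ms in
  (forall q, 0 <= quad Ms q) /\
  total_cost Pr Q Rc T xs us =
  (\sum_(t < T) (\tr ((\sum_i Q i t) *m X t)
               + \tr ((\sum_i Rc i t) *m (Ks *m X t *m Ks^T))))%:E.
Proof.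
move=> pW pQ pR [nm im cu dyn] X.
have nmP t c := noise_moments pW nm tt t c.
have wm t : has_moments Pr (ws t) W by move=> q; have [? ?] := nmP t q; split.
have wu s t q c : s != t ->
    inner Pr (fun o => dotv q (ws s o)) (fun o => dotv c (ws t o)) = 0.
  by move=> st; have [_ _ _ h] := nmP t c; apply: h => //; exact: (proj1 (wm s q)).
have xm0 : has_moments Pr (xs 0%N) Ms.
  exact: second_moment_has_moments (init_random nm tt) im.
have inv t : has_moments Pr (xs t) (X t) /\ uncorrelated_from Pr ws t (xs t).
  elim: t => [|t [hx xw]].
    split=> // q c s _; have [_ _ h _] := nmP s c; apply: (h tt).
    exact: (proj1 (xm0 q)).
  have -> : X t.+1 = feedback_cov A B W Ks 0 (X t) by [].
  have eu a : (fun o => dotv a (us t o)) = (fun o => dotv a (Ks *m xs t o)).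
    by apply/funext => o; rewrite cu.
  apply: (moment_step wm wu hx xw (dyn t)) => [a|a q|a c s]; rewrite eu //.
  split; last by rewrite quad0 addr0.
  by under eq_fun do rewrite dotv_mulmx; exact: (proj1 (hx _)).
have hu t : has_moments Pr (us t) (Ks *m X t *m Ks^T).
  have eu a : (fun o => dotv a (us t o)) = (fun o => dotv a (Ks *m xs t o)).
    by apply/funext => o; rewrite cu.
  rewrite -[Ks *m _ *m _]addr0; apply: (control_moments (proj1 (inv t))) => a.
  rewrite eu; split; last by rewrite quad0 addr0.
  by under eq_fun do rewrite dotv_mulmx; exact: (proj1 (proj1 (inv t) _)).
split=> [q|].
  have [Lq <-] := xm0 q; rewrite -lee_fin -inner_sqr //.
  by apply: integral_ge0 => o _; rewrite lee_fin sqr_ge0.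
exact: (total_cost_trace pQ pR (fun t _ => proj1 (inv t)) (fun t _ => hu t)).
Qed.

(** The past of a control contains all noises, those of later rounds included;
    drawing the control afresh therefore keeps the state uncorrelated with the
    noises still to come. *)
Lemma algorithm_cost m (disp : measure_display) (Omega : measurableType disp)
    (Pr : probability Omega R) A B W P
    (Q : 'I_m -> nat -> 'M[R]_d) (Rc : 'I_m -> nat -> 'M[R]_k) nu eta T M1 x w u S j :
  psd W -> (forall i t, psd (Q i t)) -> (forall i t, psd (Rc i t)) ->
  (forall t, (t < T)%N -> psd (policy_cov (S j t))) ->
  algorithm_run Pr A B W P Q Rc nu eta T M1 x w u S ->
  let K t := gain (S j t) in let V t := policy_cov (S j t) in
  let X := state_cov A B W K V (M1 j) in
  total_cost Pr Q Rc T (x j) (u j) =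
  (\sum_(t < T) (\tr ((\sum_i Q i t) *m X t)
               + \tr ((\sum_i Rc i t) *m (K t *m X t *m (K t)^T + V t))))%:E.
Proof.
move=> pW pQ pR pV run K V X; have nm := run_noise run.
have nmP t c := noise_moments pW nm j t c.
have wm t : has_moments Pr (w j t) W by move=> q; have [? ?] := nmP t q; split.
have wu s t q c : s != t ->
    inner Pr (fun o => dotv q (w j s o)) (fun o => dotv c (w j t o)) = 0.
  by move=> st; have [_ _ _ h] := nmP t c; apply: h => //; exact: (proj1 (wm s q)).
have xm0 : has_moments Pr (x j 0%N) (M1 j).
  exact: gaussian_has_moments (init_random nm j) (run_init_state run j).
have pastM t : (t < T)%N -> past x w u j t `<=` measurable.
  move=> tT; apply: smallest_sub; first exact: sigma_algebra_measurable.
  move=> E [[[i _]|[p _]]|[p /= /andP[pt _]]].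
  - by apply: sigma_of_measurable; exact: init_random nm i.
  - by apply: sigma_of_measurable; exact: noise_random nm p.1 p.2.
  - apply: sigma_of_measurable; apply: (run_random run).
    exact: leq_ltn_trans tT.
have wpast t s : vec_measurable (past x w u j t) (w j s).
  move=> l; apply: sub_measurable_le (vec_measurable_sigma_of l).
  by move=> E hE; apply: sub_sigma_algebra; left; right; exists (j, s).
have xpast t s : (t < T)%N -> (s <= t)%N -> vec_measurable (past x w u j t) (x j s).
  move=> tT; elim: s => [_ l|s IH st].
    apply: sub_measurable_le (vec_measurable_sigma_of l).
    by move=> E hE; apply: sub_sigma_algebra; left; left; exists j.
  have e o : x j s.+1 o = A *m x j s o + B *m u j s o + w j s o.
    by apply: (run_dynamics run); exact: leq_ltn_trans (ltnW st) tT.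
  rewrite (_ : x j s.+1 = (fun o => (A *m x j s o + B *m u j s o) + w j s o)); last first.
    by apply/funext => o.
  apply: vec_measurableD (wpast t s); apply: vec_measurableD.
    by apply: vec_measurable_mulmx; apply: IH; exact: ltnW.
  apply: vec_measurable_mulmx => l; apply: sub_measurable_le (vec_measurable_sigma_of l).
  move=> E hE; apply: sub_sigma_algebra; right; exists (j, s) => //=.
  by rewrite (ltnW st) xpair_eqE eqxx /= neq_ltn st.
have ctrl t : (t < T)%N -> has_moments Pr (x j t) (X t) -> forall a,
    [/\ square_integrable Pr (fun o => dotv a (u j t o)),
        inner Pr (fun o => dotv a (u j t o)) (fun o => dotv a (u j t o)) =
        inner Pr (fun o => dotv a (K t *m x j t o)) (fun o => dotv a (K t *m x j t o))
        + quad (V t) a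
      & forall f, sub_measurable (past x w u j t) f -> square_integrable Pr f ->
        inner Pr f (fun o => dotv a (u j t o)) =
        inner Pr f (fun o => dotv a (K t *m x j t o))].
  move=> tT hx a; apply: (cond_gauss_moments (F := past x w u j t)).
  - exact: smallest_sigma_algebra.
  - exact: pastM.
  - exact: (proj2 (pV t tT)).
  - apply: (sub_measurable_fun (sigma_of_measurable (run_random run j tT))).
    by apply: sub_measurable_dotv; exact: vec_measurable_sigma_of.
  - by apply: sub_measurable_dotv; apply: vec_measurable_mulmx; exact: xpast.
  - move=> E B' FE mB; have h := run_play run (i := j) tT.
    exact: (h E a B' FE mB).
  - by under eq_fun do rewrite dotv_mulmx; exact: (proj1 (hx _)).
have inv t : (t <= T)%N ->
    has_moments Pr (x j t) (X t) /\ uncorrelated_from Pr (w j) t (x j t).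
  elim: t => [_|t IH tT].
    split=> // q c s _; have [_ _ h _] := nmP s c; apply: (h j).
    exact: (proj1 (xm0 q)).
  have [hx xw] := IH (ltnW tT); have cu := ctrl t tT hx.
  have -> : X t.+1 = feedback_cov A B W (K t) (V t) (X t) by [].
  apply: (moment_step wm wu hx xw (K := K t) (u := u j t)) => [z|a|a q|a c s].
  - exact: (run_dynamics run).
  - by have [] := cu a.
  - have [_ _ h] := cu a; apply: h; last exact: (proj1 (hx q)).
    by apply: sub_measurable_dotv; exact: xpast.
  - have [_ _ h] := cu a; apply: h; last exact: (proj1 (wm s c)).
    by apply: sub_measurable_dotv; exact: wpast.
apply: (total_cost_trace pQ pR (X := X)
  (U := fun t => K t *m X t *m (K t)^T + V t)) => t tT.
  exact: (proj1 (inv t (ltnW tT))).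
have hx := proj1 (inv t (ltnW tT)).
by apply: (control_moments hx) => a; have [] := ctrl t tT hx a.
Qed.

End Runs.

(** * Stationary covariance of a strongly stable controller *)

Section Comparator.
Context {R : realType} {d k : nat}.
Implicit Types (A : 'M[R]_d) (B : 'M[R]_(d, k)) (K : 'M[R]_(k, d)).

(** Powers commute with the conjugation by [H], and only one factor
    [|H| |H^-1|] appears whatever the exponent. *)
Lemma strongly_stable_pow A B kappa gamma K n (v : 'cV[R]_d) :
  strongly_stable A B kappa gamma K ->
  fronorm ((A + B *m K) ^+ n *m v) <= kappa * (1 - gamma) ^+ n * fronorm v.
Proof.
move=> [k0 g01 Kk [L [H [Hu -> Ll Hk]]]].
have eP : (H *m L *m invmx H) ^+ n = H *m L ^+ n *m invmx H.
  elim: n => [|n IH].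
    rewrite !expr0 (_ : (1 : 'M[R]_d) = 1%:M) // mulmx1 mulmxV //.
  by rewrite exprmxS IH exprmxS !mulmxA mulmxKV.
have Lp (z : 'cV[R]_d) : fronorm (L ^+ n *m z) <= (1 - gamma) ^+ n * fronorm z.
  elim: n {eP} => [|n IH].
    by rewrite !expr0 (_ : (1 : 'M[R]_d) = 1%:M) // mul1mx mul1r.
  rewrite exprmxS -mulmxA (le_trans (fronorm_mulmx_opnorm _ _)) // exprS -mulrA.
  by rewrite ler_pM ?opnorm_ge0 ?fronorm_ge0.
rewrite eP -!mulmxA (le_trans (fronorm_mulmx_opnorm _ _)) //.
have r0 : 0 <= 1 - gamma by exact: le_trans (opnorm_ge0 _) Ll.
apply: le_trans (ler_wpM2l (opnorm_ge0 _) (Lp _)) _.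
apply: le_trans (ler_wpM2l (opnorm_ge0 _) (ler_wpM2l (exprn_ge0 n r0)
  (fronorm_mulmx_opnorm _ _))) _.
rewrite [leLHS](_ : _ = opnorm H * opnorm (invmx H) * ((1 - gamma) ^+ n * fronorm v));
  last by ring.
by rewrite -[leRHS]mulrA ler_wpM2r // mulr_ge0 ?exprn_ge0 ?fronorm_ge0.
Qed.

Definition steady_cov K (Y : 'M[R]_d) : 'M[R]_(d + k) :=
  block_mx Y (Y *m K^T) (K *m Y) (K *m Y *m K^T).

Lemma steady_cov_feasible A B W nu K Y :
  psd Y -> Y = (A + B *m K) *m Y *m (A + B *m K)^T + W ->
  \tr Y + \tr (K *m Y *m K^T) <= nu ->
  feasible A B W nu (steady_cov K Y).
Proof.
move=> pY eY tY.
have eS : steady_cov K Y = col_mx 1%:M K *m Y *m (col_mx 1%:M K)^T.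
  rewrite tr_col_mx mul_col_mx mul_col_row trmx1 !mul1mx !mulmx1.
  by [].
split.
- by rewrite eS; exact: psd_conj.
- by rewrite mxtrace_block.
- rewrite block_mxKul {1}eY eS; congr (_ + _).
  by rewrite !mulmxA mul_row_col mulmx1 -!mulmxA -trmx_mul mul_row_col mulmx1.
Qed.

Lemma mxtrace_block_cost m n (G : 'M[R]_m) (H : 'M[R]_n) (S : 'M[R]_(m + n)) :
  \tr (block_mx G 0 0 H *m S) = \tr (G *m ulsubmx S) + \tr (H *m drsubmx S).
Proof.
rewrite -{1}[S]submxK mulmx_block !mul0mx mxtrace_block.
by rewrite addr0 add0r.
Qed.

(** Both the covariance of the state under [K] and its stationary value [Y]
    obey the same affine recursion, so that their difference is transported by
    the powers of the closed-loop matrix. *)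
Lemma state_cov_gap A B W K Ms Y t :
  Y = (A + B *m K) *m Y *m (A + B *m K)^T + W ->
  Y - state_cov A B W (fun=> K) (fun=> 0) Ms t =
  (A + B *m K) ^+ t *m (Y - Ms) *m ((A + B *m K) ^+ t)^T.
Proof.
move=> eY; set M := A + B *m K; elim: t => [|t IH].
  by rewrite expr0 (_ : (1 : 'M[R]_d) = 1%:M) // trmx1 mul1mx mulmx1.
rewrite exprmxS trmx_mul {1}eY /= /feedback_cov -/M mulmx0 mul0mx addr0.
rewrite opprD addrACA subrr addr0 -mulmxBl -mulmxBr IH.
by rewrite !mulmxA.
Qed.

(** The stationary covariance of the closed loop gives a feasible point; the true
    covariances approach it geometrically fast, so that over all rounds the cost
    of the controller falls short of the stationary cost by a constant at most. *)
Lemma comparator A B W kappa gamma lambda K :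
  1 < kappa -> 0 < gamma < 1 -> psd W -> \tr W <= lambda ^+ 2 ->
  strongly_stable A B kappa gamma K ->
  let nu := trace_bound kappa gamma lambda in
  exists2 S : 'M[R]_(d + k), feasible A B W nu S &
  forall (Ms : 'M[R]_d) (c : R) (Q : nat -> 'M[R]_d) (Rc : nat -> 'M[R]_k) T,
  (forall q, 0 <= quad Ms q) -> 0 <= c ->
  (forall t, psd (Q t)) -> (forall t, psd (Rc t)) ->
  (forall t, \tr (Q t) <= c) -> (forall t, \tr (Rc t) <= c) ->
  \sum_(t < T) \tr (block_mx (Q t) 0 0 (Rc t) *m S)
  - \sum_(t < T)
      (\tr (Q t *m state_cov A B W (fun=> K) (fun=> 0) Ms t)
       + \tr (Rc t *m (K *m state_cov A B W (fun=> K) (fun=> 0) Ms t *m K^T)))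
  <= c * kappa ^+ 2 * nu / gamma.
Proof.
move=> k1 /andP[g0 g1] pW tW ss nu.
have k0 : 0 < kappa by exact: lt_trans ltr01 k1.
have r01 : 0 <= 1 - gamma < 1 by rewrite subr_ge0 (ltW g1) ltrBlDr ltrDl.
set M := A + B *m K.
have Mp n v := @strongly_stable_pow A B kappa gamma K n v ss.
have [Y eY] := lyapunov_solution W r01 Mp.
have pY := lyapunov_psd r01 Mp pW eY.
have tY : \tr Y <= kappa ^+ 2 * \tr W / gamma.
  by have := lyapunov_trace_le r01 Mp pW eY; rewrite subKr.
have Kk : opnorm K <= kappa by case: ss.
have Kv (v : 'cV[R]_d) : fronorm (K *m v) <= kappa * fronorm v.
  by rewrite (le_trans (fronorm_mulmx_opnorm _ _)) // ler_wpM2r ?fronorm_ge0.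
have tY0 := psd_trace_ge0 pY.
have tKY : \tr Y + kappa ^+ 2 * \tr Y <= nu.
  have k2 : 1 <= kappa ^+ 2 by rewrite exprn_ege1 // ltW.
  apply: (@le_trans _ _ (2 * kappa ^+ 2 * \tr Y)).
    by have := ler_wpM2r tY0 k2; lra.
  rewrite /nu /trace_bound.
  have k20 : 0 <= 2 * kappa ^+ 2 by rewrite mulr_ge0 // sqr_ge0.
  apply: le_trans (ler_wpM2l k20 tY) _.
  rewrite [leRHS](_ : _ = 2 * kappa ^+ 2 * (kappa ^+ 2 * lambda ^+ 2 / gamma)); last by ring.
  by rewrite ler_wpM2l // ler_wpM2r ?invr_ge0 ?(ltW g0) // ler_wpM2l // sqr_ge0.
have feas : feasible A B W nu (steady_cov K Y).
  apply: steady_cov_feasible => //; apply: le_trans tKY.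
  by rewrite lerD2l trace_conj_le.
have nu0 : 0 <= nu by apply: le_trans tKY; rewrite addr_ge0 // mulr_ge0 ?sqr_ge0.
exists (steady_cov K Y) => // {feas}.
move: nu tKY nu0 => nu tKY nu0 Ms c Q Rc T pMs c0 pQ pR tQ tR.
set X := state_cov A B W _ _ Ms.
rewrite -sumrB.
apply: (@le_trans _ _ (\sum_(t < T) c * kappa ^+ 2 * nu * (1 - gamma) ^+ t)).
  apply: ler_sum => t _.
  rewrite mxtrace_block_cost /steady_cov block_mxKul block_mxKdr.
  have [r0 r1] := andP r01.
  pose D := M ^+ t *m Y *m (M ^+ t)^T.
  have pD : psd D by exact: psd_conj.
  have gapD v : quad (Y - X t) v <= quad D v.
    rewrite /X (state_cov_gap Ms t eY) -/M /D !quad_conj quadD quadN.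
    by rewrite lerBlDr lerDl pMs.
  have tD : \tr D <= kappa ^+ 2 * (1 - gamma) ^+ t * \tr Y.
    apply: le_trans (trace_conj_le pY (Mp t)) _.
    rewrite ler_wpM2r // exprMn ler_wpM2l ?sqr_ge0 //.
    by rewrite expr2 ler_piMl ?exprn_ge0 // exprn_ile1 // ltW.
  have h1 : \tr (Q t *m (Y - X t)) <= c * \tr D.
    apply: le_trans (psd_trace_le (pQ t) gapD) _.
    apply: le_trans (psd_trace_mul_le (pQ t) pD) _.
    by rewrite ler_wpM2r ?psd_trace_ge0.
  have h2 : \tr (Rc t *m (K *m (Y - X t) *m K^T)) <= c * (kappa ^+ 2 * \tr D).
    have gapK v : quad (K *m (Y - X t) *m K^T) v <= quad (K *m D *m K^T) v.
      by rewrite !(quad_conj K); exact: gapD.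
    apply: le_trans (psd_trace_le (pR t) gapK) _.
    apply: le_trans (psd_trace_mul_le (pR t) (psd_conj K pD)) _.
    apply: ler_pM => //; first exact: psd_trace_ge0.
      by apply: psd_trace_ge0; exact: psd_conj.
    exact: trace_conj_le.
  have -> : \tr (Q t *m Y) + \tr (Rc t *m (K *m Y *m K^T))
      - (\tr (Q t *m X t) + \tr (Rc t *m (K *m X t *m K^T)))
      = \tr (Q t *m (Y - X t)) + \tr (Rc t *m (K *m (Y - X t) *m K^T)).
    rewrite mulmxBr mulmxBr mulmxBl mulmxBr.
    have trB n (G H : 'M[R]_n) : \tr (G - H) = \tr G - \tr H by exact: raddfB.
    by rewrite !trB; ring.
  apply: le_trans (lerD h1 h2) _.
  rewrite -mulrDr.
  rewrite [leRHS](_ : _ = c * (kappa ^+ 2 * ((1 - gamma) ^+ t * nu))); last by ring.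
  rewrite ler_wpM2l //.
  apply: (@le_trans _ _ ((1 + kappa ^+ 2) * (kappa ^+ 2 * (1 - gamma) ^+ t * \tr Y))).
    by rewrite mulrDl mul1r lerD // ler_wpM2l // sqr_ge0.
  rewrite [leLHS](_ : _ = kappa ^+ 2 * ((1 - gamma) ^+ t * (\tr Y + kappa ^+ 2 * \tr Y)));
    last by ring.
  by rewrite ler_wpM2l ?sqr_ge0 // ler_wpM2l // exprn_ge0.
rewrite -mulr_sumr ler_wpM2l ?mulr_ge0 ?(ltW k0) //.
by have := sum_geometric_le T r01; rewrite subKr.
Qed.

End Comparator.

(** * Projection onto a convex set *)

Section Projection.
Context {R : realType} {p q : nat}.
Implicit Types (X Y Z : 'M[R]_(p, q)) (F : set 'M[R]_(p, q)).

Definition convex_closed F : Prop := forall (I : finType) (a : I -> R) (X : I -> 'M[R]_(p, q)),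
  (forall i, 0 <= a i) -> \sum_i a i = 1 -> (forall i, F (X i)) ->
  F (\sum_i a i *: X i).

Lemma fronorm_sqrB X Y : fronorm (X - Y) ^+ 2 =
  fronorm X ^+ 2 - 2 * mxdot X Y + fronorm Y ^+ 2.
Proof.
rewrite !fronorm_sqr !(mxdotDl, mxdotDr, mxdotNl, mxdotNr) (mxdotC Y X); ring.
Qed.

(** Moving the projection [Y] slightly towards [Z] cannot bring it closer to
    [X]; the first-order term gives the obtuse-angle inequality. *)
Lemma projection_obtuse F X Y Z : convex_closed F -> is_projection F X Y -> F Z ->
  mxdot (X - Y) (Z - Y) <= 0.
Proof.
move=> cF [FY hY] FZ.
apply: (@le_of_le_small_error _ _ _ (mxdot (Z - Y) (Z - Y) / 2) 1) => //.
  by rewrite divr_ge0 // mxdot_ge0.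
move=> e e0 e1; rewrite add0r.
pose a (b : bool) := if b then 1 - e else e.
pose V (b : bool) := if b then Y else Z.
have FV : F (\sum_b a b *: V b).
  apply: cF => [[]||[]] //=; rewrite ?(ltW e0) ?subr_ge0 ?(ltW e1) //.
  by rewrite big_bool /= subrK.
have := hY _ FV; rewrite big_bool /=.
have -> : (1 - e) *: Y + e *: Z - X = (e *: (Z - Y)) - (X - Y).
  by apply/matrixP => i j; rewrite !mxE; ring.
rewrite (fronormB Y X) (fronormB (e *: _)).
rewrite -(@ler_pXn2r _ 2) ?nnegrE ?fronorm_ge0 // (fronorm_sqrB (X - Y)).
rewrite (fronorm_sqr (e *: _)) mxdotZl !mxdotZr => h.
have : 0 <= e * (e * mxdot (Z - Y) (Z - Y) - 2 * mxdot (X - Y) (Z - Y)) by lra.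
by rewrite pmulr_rge0 //; lra.
Qed.

(** Expanding [|X - Z|^2] around [Y], the cross term has a sign by the
    obtuse-angle inequality. *)
Lemma projection_le F X Y Z : convex_closed F -> is_projection F X Y -> F Z ->
  fronorm (Y - Z) <= fronorm (X - Z).
Proof.
move=> cF pY FZ; have h := projection_obtuse cF pY FZ.
have -> : X - Z = (X - Y) - (Z - Y) by rewrite opprB addrA subrK.
rewrite -(@ler_pXn2r _ 2) ?nnegrE ?fronorm_ge0 // (fronorm_sqrB (X - Y)) (fronormB Y Z).
by have := sqr_ge0 (fronorm (X - Y)); move: h; lra.
Qed.

(** The difference of the two sides is the weighted mean of [|X i - Y|^2], where
    [Y] is the weighted mean of the [X i]. *)
Lemma fronorm_sqr_convex (I : finType) (a : I -> R) (X : I -> 'M[R]_(p, q)) :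
  (forall i, 0 <= a i) -> \sum_i a i = 1 ->
  fronorm (\sum_i a i *: X i) ^+ 2 <= \sum_i a i * fronorm (X i) ^+ 2.
Proof.
move=> a0 a1; set Y := \sum_i _.
have : 0 <= \sum_i a i * fronorm (X i - Y) ^+ 2.
  by apply: sumr_ge0 => i _; rewrite mulr_ge0 // sqr_ge0.
have e i : a i * fronorm (X i - Y) ^+ 2 =
    a i * fronorm (X i) ^+ 2 - 2 * mxdot (a i *: X i) Y + a i * fronorm Y ^+ 2.
  by rewrite fronorm_sqrB mxdotZl; ring.
under eq_bigr do rewrite e.
rewrite big_split sumrB /= -mulr_sumr -mxdot_suml -/Y -mulr_suml a1 mul1r.
by rewrite -fronorm_sqr; lra.
Qed.

End Projection.

(** * Agreement between the agents *)

Section Consensus.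
Context {R : realType} {m : nat}.
Context (comm : rel 'I_m) (P : 'M[R]_m) (beta : R).
Hypothesis net : network comm P beta.

Lemma network_expr_col n i : \sum_j (P ^+ n) j i = 1.
Proof.
elim: n i => [|n IH] i.
  rewrite expr0 (bigD1 i) //= big1 => [|j ji]; first by rewrite mxE eqxx addr0.
  by rewrite mxE (negPf ji).
rewrite exprmxS; under eq_bigr do rewrite mxE.
rewrite exchange_big /= -[RHS](IH i); apply: eq_bigr => l _.
by rewrite -mulr_suml (network_col net) mul1r.
Qed.

Definition mixing_error n i : R := \sum_j `|(P ^+ n) j i - m%:R^-1|.

Lemma agents_gt0 (i : 'I_m) : 0 < m%:R :> R.
Proof. by rewrite ltr0n; exact: leq_ltn_trans (ltn_ord i). Qed.

Lemma sqrt_agents_ge1 (i : 'I_m) : 1 <= Num.sqrt (m%:R : R).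
Proof.
rewrite -[leLHS]sqrtr1 ler_wsqrtr // ler1n.
exact: leq_ltn_trans (ltn_ord i).
Qed.

Lemma mixing_error0 i : mixing_error 0 i = 2 - 2 / m%:R.
Proof.
have m0 := agents_gt0 i; rewrite /mixing_error (bigD1 i) //= expr0 mxE eqxx /=.
have m1 : m%:R^-1 <= 1 :> R.
  by rewrite invf_le1 // ler1n; exact: leq_ltn_trans (ltn_ord i).
rewrite ger0_norm ?subr_ge0 //.
rewrite (eq_bigr (fun=> m%:R^-1)) => [|j ji]; last first.
  by rewrite mxE (negPf ji) sub0r normrN ger0_norm // invr_ge0 ltW.
rewrite sumr_const cardC1 card_ord -[_ *+ m.-1]mulr_natl.
have -> : m.-1%:R = m%:R - 1 :> R.
  by rewrite -subn1 natrB //; exact: leq_ltn_trans (ltn_ord i).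
by field; rewrite gt_eqF.
Qed.

(** The mixing bound of the network concerns positive powers; at power [0] the
    error is [2 - 2 / m], which is at most [sqrt m]. *)
Lemma mixing_error_le n i : mixing_error n i <= Num.sqrt m%:R * beta ^+ n.
Proof.
case: n => [|n]; last exact: (network_mixing net).
rewrite mixing_error0 expr0 mulr1.
have := sqrt_agents_ge1 i; have := sqr_sqrtr (ltW (agents_gt0 i)).
set s := Num.sqrt _ => <- s1.
have s0 : 0 < s by exact: lt_le_trans ltr01 s1.
rewrite lerBlDr.
have -> : s + 2 / s ^+ 2 = (s ^+ 3 + 2) / s ^+ 2 by field; rewrite gt_eqF.
rewrite ler_pdivlMr ?exprn_gt0 //.
have [s2|/ltW s2] := leP s 2; last by nra.
by have := mulr_ge0 (ltW s0) (sqr_ge0 (s - 1)); nra.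
Qed.

Section Deviation.
Context {p q : nat} (S r : 'I_m -> nat -> 'M[R]_(p, q)) (T : nat) (rho : R).
Context (S1 : 'M[R]_(p, q)).
Hypothesis S_init : forall i, S i 0%N = S1.
Hypothesis S_step : forall i t, (t < T)%N ->
  S i t.+1 = \sum_j P j i *: S j t + r i t.
Hypothesis r_le : forall i t, (t < T)%N -> fronorm (r i t) <= rho.

Definition average t : 'M[R]_(p, q) := m%:R^-1 *: \sum_j S j t.
(** The average that agent [i] would hold after [n] further rounds of mixing alone. *)
Definition mixed n t i : 'M[R]_(p, q) := \sum_j (P ^+ n) j i *: S j t.

Lemma mixed_step n t i : (t < T)%N ->
  mixed n t.+1 i = mixed n.+1 t i + \sum_j (P ^+ n) j i *: r j t.
Proof.
move=> tT; rewrite /mixed; under eq_bigr do rewrite S_step // scalerDr scaler_sumr.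
rewrite big_split /=; congr (_ + _); rewrite exchange_big /=.
apply: eq_bigr => l _; rewrite exprmxS mxE scaler_suml.
by apply: eq_bigr => j _; rewrite scalerA mulrC.
Qed.

Lemma average_step t : (t < T)%N ->
  average t.+1 = average t + m%:R^-1 *: \sum_j r j t.
Proof.
move=> tT; rewrite /average; under eq_bigr do rewrite S_step //.
rewrite big_split /= scalerDr; congr (_ *: _ + _); rewrite exchange_big /=.
by apply: eq_bigr => l _; rewrite -scaler_suml (network_row net) scale1r.
Qed.

(** Unrolling the dynamics, the residual of round [s] has been mixed [t - s - 1]
    further times by round [t]. *)
Lemma mixed_average_le n t i : (t <= T)%N ->
  fronorm (mixed n t i - average t) <= rho * \sum_(s < t) mixing_error (n + s) i.
Proof.
elim: t n => [|t IH] n tT.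
  rewrite big_ord0 mulr0 /mixed /average.
  under eq_bigr do rewrite S_init; under [X in _ *: X]eq_bigr do rewrite S_init.
  rewrite -scaler_suml network_expr_col scale1r sumr_const card_ord -[S1 *+ m]scaler_nat.
  by rewrite scalerA mulVf ?scale1r ?subrr ?fronorm0 // gt_eqF // (agents_gt0 i).
rewrite mixed_step // average_step // opprD addrACA.
apply: le_trans (fronormD _ _) _.
rewrite big_ord_recl addn0 mulrDr [leRHS]addrC lerD //; last first.
  rewrite scaler_sumr -sumrB /mixing_error mulr_sumr.
  apply: le_trans (fronorm_sum _ _) _; apply: ler_sum => j _.
  by rewrite -scalerBl fronormZ mulrC ler_wpM2r // r_le.
apply: le_trans (IH n.+1 (ltnW tT)) _; rewrite le_eqVlt; apply/orP; left; apply/eqP.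
by congr (_ * _); apply: eq_bigr => s _; rewrite /= addSnnS.
Qed.

Hypothesis rho_ge0 : 0 <= rho.

Lemma mixed_average_uniform n t i : (t <= T)%N ->
  fronorm (mixed n t i - average t) <= rho * (Num.sqrt m%:R / (1 - beta)).
Proof.
move=> tT; apply: le_trans (mixed_average_le n i tT) _.
have [b0 b1] := andP (network_beta01 net).
rewrite ler_wpM2l //.
apply: (@le_trans _ _ (\sum_(s < t) Num.sqrt m%:R * beta ^+ s)).
  apply: ler_sum => s _; apply: le_trans (mixing_error_le _ _) _.
  rewrite ler_wpM2l ?sqrtr_ge0 // exprD ler_piMl ?exprn_ge0 //.
  by rewrite exprn_ile1 // ltW.
by rewrite -mulr_sumr ler_wpM2l ?sqrtr_ge0 // sum_geometric_le // b0.
Qed.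

Lemma sum_mixing_errorS_le t i :
  \sum_(s < t) mixing_error s.+1 i <= Num.sqrt m%:R * beta / (1 - beta).
Proof.
have [b0 b1] := andP (network_beta01 net).
apply: (@le_trans _ _ (\sum_(s < t) Num.sqrt m%:R * beta * beta ^+ s)).
  by apply: ler_sum => s _; rewrite -mulrA -exprS mixing_error_le.
by rewrite -mulr_sumr ler_wpM2l ?mulr_ge0 ?sqrtr_ge0 // sum_geometric_le // b0.
Qed.

(** The unmixed residual and the error at mixing time [0] together cost at most
    [3 - 2 / m <= 2 sqrt m]; all other terms are geometric. *)
Lemma iterate_drift_le t i : (t < T)%N ->
  fronorm (S i t.+1 - S i t) <= rho * (2 * Num.sqrt m%:R / (1 - beta)).
Proof.
move=> tT; have [b0 b1] := andP (network_beta01 net).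
have b1' : 0 < 1 - beta by rewrite subr_gt0.
have e0 : mixed 0 t i = S i t.
  rewrite /mixed expr0 (bigD1 i) //= big1 => [|j ji].
    by rewrite mxE eqxx scale1r addr0.
  by rewrite mxE (negPf ji) scale0r.
have e1 : S i t.+1 = mixed 1 t i + r i t by rewrite S_step // /mixed expr1.
have -> : S i t.+1 - S i t =
    (mixed 1 t i - average t) - (mixed 0 t i - average t) + r i t.
  by rewrite e1 e0 opprB addrA subrK addrAC.
apply: le_trans (fronormD _ _) _.
apply: le_trans (lerD (fronormD _ _) (r_le i tT)) _; rewrite fronormN.
apply: le_trans (lerD (lerD (mixed_average_le 1 i (ltnW tT))
  (mixed_average_le 0 i (ltnW tT))) (lexx rho)) _.
rewrite -mulrDr -{2}[rho]mulr1 -mulrDr ler_wpM2l //.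
have h1 : \sum_(s < t) mixing_error (1 + s) i <= Num.sqrt m%:R * beta / (1 - beta).
  exact: sum_mixing_errorS_le.
have h0 : \sum_(s < t) mixing_error (0 + s) i <=
    2 - 2 / m%:R + Num.sqrt m%:R * beta / (1 - beta).
  have m0 : 0 <= mixing_error 0 i by apply: sumr_ge0 => j _.
  case: {tT h1 e0 e1} t => [|t].
    rewrite big_ord0 -(mixing_error0 i) addr_ge0 // mulr_ge0 ?mulr_ge0 ?sqrtr_ge0 //.
    by rewrite invr_ge0 ltW.
  by rewrite big_ord_recl -(mixing_error0 i) lerD // sum_mixing_errorS_le.
apply: le_trans (lerD (lerD h1 h0) (lexx 1)) _.
have := sqrt_agents_ge1 i; have := sqr_sqrtr (ltW (agents_gt0 i)).
set s := Num.sqrt _ => <- s1.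
have s0 : 0 < s by exact: lt_le_trans ltr01 s1.
have -> : 2 * s / (1 - beta) = 2 * s + 2 * (s * beta / (1 - beta)).
  by field; rewrite gt_eqF.
suff : 3 - 2 / s ^+ 2 <= 2 * s by lra.
rewrite lerBlDr.
have -> : 2 * s + 2 / s ^+ 2 = (2 * s ^+ 3 + 2) / s ^+ 2 by field; rewrite gt_eqF.
rewrite ler_pdivlMr ?exprn_gt0 //.
have s21 : 0 <= 2 * s + 1 by lra.
by have := mulr_ge0 s21 (sqr_ge0 (s - 1)); nra.
Qed.

End Deviation.
End Consensus.

(** * Regret of distributed projected gradient descent *)

Section Regret.
Context {R : realType} {m p q : nat}.
Context (comm : rel 'I_m) (P : 'M[R]_m) (beta : R).
Hypothesis net : network comm P beta.
Context (F : set 'M[R]_(p, q)) (S G : 'I_m -> nat -> 'M[R]_(p, q)).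
Context (T : nat) (eta g D : R) (S1 : 'M[R]_(p, q)).
Hypotheses (convF : convex_closed F) (eta_gt0 : 0 < eta).
Hypotheses (F_S1 : F S1) (S_init : forall i, S i 0%N = S1).
Hypothesis S_update : forall i t, (t < T)%N ->
  is_projection F (\sum_j P j i *: S j t - eta *: G i t) (S i t.+1).
Hypothesis G_le : forall i t, fronorm (G i t) <= g.

Let Z i t := \sum_j P j i *: S j t.
Let r i t := S i t.+1 - Z i t.

Lemma iterate_feasible i t : (t <= T)%N -> F (S i t).
Proof.
case: t => [|t] tT; first by rewrite S_init.
by have [] := S_update i tT.
Qed.

Let Z_feasible i t : (t <= T)%N -> F (Z i t).
Proof.
move=> tT; apply: convF => [j||j]; first exact: (network_ge0 net).
  exact: (network_col net).
exact: iterate_feasible.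
Qed.

Let S_step i t : (t < T)%N -> S i t.+1 = \sum_j P j i *: S j t + r i t.
Proof. by move=> _; rewrite /r addrC subrK. Qed.

Let r_le i t : (t < T)%N -> fronorm (r i t) <= eta * g.
Proof.
move=> tT; apply: le_trans (projection_le convF (S_update i tT) (Z_feasible i (ltnW tT))) _.
rewrite addrAC subrr add0r fronormN fronormZ gtr0_norm //.
by rewrite ler_wpM2l // ltW.
Qed.

Let etag_ge0 (i : 'I_m) : 0 <= eta * g.
Proof. by rewrite mulr_ge0 ?(ltW eta_gt0) // (le_trans (fronorm_ge0 _) (G_le i 0)). Qed.

Lemma projected_drift_le i t : (t < T)%N ->
  fronorm (S i t.+1 - S i t) <= eta * g * (2 * Num.sqrt m%:R / (1 - beta)).
Proof. exact: (iterate_drift_le net S_init S_step r_le (etag_ge0 i)). Qed.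

Lemma disagreement_le i j t : (t <= T)%N ->
  fronorm (S j t - Z i t) <= eta * g * (2 * Num.sqrt m%:R / (1 - beta)).
Proof.
move=> tT.
have h1 := mixed_average_uniform net S_init S_step r_le (etag_ge0 i) 1 i tT.
have h0 := mixed_average_uniform net S_init S_step r_le (etag_ge0 i) 0 j tT.
have e0 : mixed P S 0 t j = S j t.
  rewrite /mixed expr0 (bigD1 j) //= big1 => [|l lj].
    by rewrite mxE eqxx scale1r addr0.
  by rewrite mxE (negPf lj) scale0r.
have e1 : mixed P S 1 t i = Z i t by rewrite /mixed expr1.
rewrite -e0 -e1.
have -> : mixed P S 0 t j - mixed P S 1 t i =
  (mixed P S 0 t j - average S t) - (mixed P S 1 t i - average S t).
  by rewrite opprB addrA subrK.
apply: le_trans (fronormD _ _) _; rewrite fronormN.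
by apply: le_trans (lerD h0 h1) _; rewrite -!mulrA -mulrDr; lra.
Qed.

Context (Y : 'M[R]_(p, q)).
Hypotheses (F_Y : F Y) (diam : forall X, F X -> fronorm (X - Y) <= D).

Let potential t := \sum_i fronorm (S i t - Y) ^+ 2.

(** Mixing does not increase the potential, by convexity of the square and the
    double stochasticity of [P]; the gradient step decreases it by the
    linearized regret, up to a term of second order in [eta]. *)
Let potential_step t : (t < T)%N ->
  2 * eta * \sum_i mxdot (G i t) (Z i t - Y) <=
  potential t - potential t.+1 + m%:R * (eta * g) ^+ 2.
Proof.
move=> tT.
have h1 i : fronorm (S i t.+1 - Y) ^+ 2 <=
    fronorm (Z i t - Y) ^+ 2 - 2 * eta * mxdot (G i t) (Z i t - Y) + (eta * g) ^+ 2.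
  have := projection_le convF (S_update i tT) F_Y.
  rewrite -(@ler_pXn2r _ 2) ?nnegrE ?fronorm_ge0 // => h; apply: le_trans h _.
  rewrite -/(Z i t) addrAC (fronorm_sqrB (Z i t - Y)) mxdotZr.
  rewrite (mxdotC (Z i t - Y)) mulrA lerD2l fronormZ gtr0_norm //.
  rewrite ler_pXn2r ?nnegrE ?mulr_ge0 ?fronorm_ge0 ?(ltW eta_gt0) //.
    by rewrite ler_wpM2l // ltW.
  exact: le_trans (fronorm_ge0 _) (G_le i t).
have h2 i : fronorm (Z i t - Y) ^+ 2 <= \sum_j P j i * fronorm (S j t - Y) ^+ 2.
  have -> : Z i t - Y = \sum_j P j i *: (S j t - Y).
    under eq_bigr do rewrite scalerBr.
    by rewrite sumrB -scaler_suml (network_col net) scale1r.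
  apply: fronorm_sqr_convex => [j|]; [exact: (network_ge0 net)|exact: (network_col net)].
have h3 : \sum_i fronorm (Z i t - Y) ^+ 2 <= potential t.
  apply: le_trans (ler_sum _ (fun i _ => h2 i)) _; rewrite exchange_big /=.
  by apply: ler_sum => j _; rewrite -mulr_suml (network_row net) mul1r.
have h4 : potential t.+1 <= \sum_i fronorm (Z i t - Y) ^+ 2
    - 2 * eta * \sum_i mxdot (G i t) (Z i t - Y) + m%:R * (eta * g) ^+ 2.
  apply: le_trans (ler_sum _ (fun i _ => h1 i)) _.
  by rewrite big_split sumrB /= -mulr_sumr sumr_const card_ord -[_ *+ m]mulr_natl.
by move: h3 h4; lra.
Qed.

(** Summing the potential steps telescopes and bounds the regret of the mixed
    points; replacing these by the iterates of agent [j] costs the disagreement. *)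
Lemma projected_regret_le j :
  \sum_(t < T) \sum_i mxdot (G i t) (S j t - Y) <=
  m%:R * D ^+ 2 / (2 * eta)
  + T%:R * (m%:R * (eta * g ^+ 2 / 2))
  + T%:R * (m%:R * (g * (eta * g * (2 * Num.sqrt m%:R / (1 - beta))))).
Proof.
have g0 : 0 <= g by exact: le_trans (fronorm_ge0 _) (G_le j 0).
have e2 : 0 < 2 * eta by rewrite mulr_gt0.
have tele : 2 * eta * \sum_(t < T) \sum_i mxdot (G i t) (Z i t - Y) <=
    potential 0 - potential T + T%:R * (m%:R * (eta * g) ^+ 2).
  rewrite mulr_sumr; apply: le_trans (ler_sum _ (fun t _ => potential_step (ltn_ord t))) _.
  rewrite big_split sumr_const card_ord /= -[_ *+ T]mulr_natl lerD2r.
  rewrite -(big_mkord xpredT (fun t => potential t - potential t.+1)).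
  rewrite (@telescope_sumr_eq _ _ _ (fun t => - potential t)) // => [|t _].
    by rewrite opprK addrC.
  by rewrite opprK addrC.
have p0 : potential 0 <= m%:R * D ^+ 2.
  apply: le_trans (_ : \sum_(i < m) D ^+ 2 <= _); last first.
    by rewrite sumr_const card_ord mulr_natl.
  apply: ler_sum => i _; have h := diam (iterate_feasible i (leq0n T)).
  by rewrite ler_pXn2r ?nnegrE ?fronorm_ge0 // (le_trans (fronorm_ge0 _) h).
have pT : 0 <= potential T by apply: sumr_ge0 => i _; exact: sqr_ge0.
have lin : \sum_(t < T) \sum_i mxdot (G i t) (Z i t - Y) <=
    m%:R * D ^+ 2 / (2 * eta) + T%:R * (m%:R * (eta * g ^+ 2 / 2)).
  rewrite -(ler_pM2l e2) mulrDr [2 * eta * (_ / _)]mulrC divfK ?gt_eqF //.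
  rewrite [2 * eta * (T%:R * _)](_ : _ = T%:R * (m%:R * (eta * g) ^+ 2)); last by field.
  by move: tele p0 pT; lra.
have dis : \sum_(t < T) \sum_i mxdot (G i t) (S j t - Z i t) <=
    T%:R * (m%:R * (g * (eta * g * (2 * Num.sqrt m%:R / (1 - beta))))).
  apply: le_trans (_ : \sum_(t < T) \sum_(i < m)
    g * (eta * g * (2 * Num.sqrt m%:R / (1 - beta))) <= _); last first.
    by rewrite !sumr_const !card_ord !mulr_natl.
  apply: ler_sum => t _; apply: ler_sum => i _.
  apply: le_trans (mxdot_le _ _) _; apply: ler_pM; rewrite ?fronorm_ge0 //.
  by apply: disagreement_le; exact: ltnW.
apply: le_trans (lerD lin dis); rewrite -big_split /= le_eqVlt; apply/orP; left.
apply/eqP; apply: eq_bigr => t _; rewrite -big_split /=; apply: eq_bigr => i _.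
by rewrite -mxdotDr [Z i t - Y + _]addrC addrA subrK.
Qed.

End Regret.

(** * Policies extracted from feasible covariances *)

Section Feasible.
Context {R : realType} {d k : nat}.
Context (A : 'M[R]_d) (B : 'M[R]_(d, k)) (W : 'M[R]_d) (nu : R).
Implicit Types S : 'M[R]_(d + k).

Lemma feasible_convex : convex_closed (feasible A B W nu).
Proof.
move=> I a X a0 a1 FX; split.
- by apply: psd_sum => i; apply: psdZ => //; case: (FX i).
- rewrite raddf_sum /= -[leRHS]mul1r -a1 mulr_suml; apply: ler_sum => i _.
  by rewrite mxtraceZ ler_wpM2l //; case: (FX i).
- rewrite mulmx_sumr mulmx_suml -[X in _ + X]scale1r -a1 scaler_suml -big_split /=.
  transitivity (\sum_i a i *: ulsubmx (X i)).
    apply/matrixP => u v; rewrite !mxE !summxE; apply: eq_bigr => i _.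
    by rewrite !mxE.
  apply: eq_bigr => i _; have [_ _ e] := FX i.
  by rewrite e scalerDr -scalemxAr -scalemxAl.
Qed.

Lemma feasible_dist_le S S' : feasible A B W nu S -> feasible A B W nu S' ->
  fronorm (S - S') <= 2 * nu.
Proof.
move=> [pS tS _] [pS' tS' _]; apply: le_trans (fronormD _ _) _; rewrite fronormN.
by have := psd_fronorm_le pS; have := psd_fronorm_le pS'; lra.
Qed.

Lemma fronorm_ulsubmx (M : 'M[R]_(d + k)) : fronorm (ulsubmx M) <= fronorm M.
Proof.
rewrite -(@ler_pXn2r _ 2) ?nnegrE ?fronorm_ge0 // !fronorm_sqr /mxdot.
rewrite [leRHS]big_split_ord /= -[leLHS]addr0; apply: lerD.
  apply: ler_sum => i _; rewrite [leRHS]big_split_ord /= -[leLHS]addr0; apply: lerD.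
    by apply: ler_sum => j _; rewrite !mxE.
  by apply: sumr_ge0 => j _; rewrite -expr2 sqr_ge0.
by apply: sumr_ge0 => i _; apply: sumr_ge0 => j _; rewrite -expr2 sqr_ge0.
Qed.

Section Policy.
Context (sigma : R) (S : 'M[R]_(d + k)).
Hypotheses (sigma_gt0 : 0 < sigma) (W_ge : psd (W - (sigma ^+ 2)%:M)).
Hypothesis FS : feasible A B W nu S.

Let Y := ulsubmx S.
Let K := gain S.
Let V := policy_cov S.

Lemma noise_quad_ge v : sigma ^+ 2 * mxdot v v <= quad W v.
Proof.
have [_ /(_ v)] := W_ge; rewrite quadD quadN quad_scalar; lra.
Qed.

Lemma state_block_ge v : sigma ^+ 2 * mxdot v v <= quad Y v.
Proof.
case: FS => -[_ pS] _; rewrite -/Y => ->; rewrite quadD quad_conj.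
by have := noise_quad_ge v; have := pS ((row_mx A B)^T *m v); lra.
Qed.

Lemma state_block_unit : Y \in unitmx.
Proof.
rewrite -unitmx_tr -row_free_unit; apply: inj_row_free => v vY.
have := state_block_ge v^T.
have -> : quad Y v^T = 0.
  have e : Y *m v^T = 0 by rewrite -[Y]trmxK -trmx_mul vY trmx0.
  by rewrite quadE e mxdotC mxdot0l.
rewrite -fronorm_sqr fronorm_tr => h.
apply: fronorm_eq0; apply/eqP; rewrite -sqrf_eq0 eq_le sqr_ge0 andbT.
by rewrite -(pmulr_rle0 _ (exprn_gt0 2 sigma_gt0)).
Qed.

Lemma feasible_sym : ursubmx S = (dlsubmx S)^T /\ Y^T = Y /\ (drsubmx S)^T = drsubmx S.
Proof.
by case: FS => -[sS _] _ _; rewrite trmx_dlsub sS /Y trmx_ulsub sS trmx_drsub sS.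
Qed.

Lemma gain_state : K *m Y = dlsubmx S.
Proof. by rewrite /K /gain mulmxKV // state_block_unit. Qed.

Lemma feasible_blockE : S = block_mx Y (Y *m K^T) (K *m Y) (K *m Y *m K^T + V).
Proof.
have [e1 [e2 e3]] := feasible_sym.
rewrite -{1}[S]submxK -/Y e1 -gain_state trmx_mul e2 gain_state.
by rewrite /V /policy_cov -/K -/Y gain_state addrC subrK.
Qed.

Lemma state_block_psd : psd Y.
Proof.
have [_ [e2 _]] := feasible_sym; split=> // v.
apply: le_trans (state_block_ge v).
by rewrite mulr_ge0 ?sqr_ge0 // mxdot_ge0.
Qed.

(** The policy covariance is the Schur complement of the state block. *)
Lemma policy_cov_psd : psd V.
Proof.
have -> : V = row_mx (- K) 1%:M *m S *m (row_mx (- K) 1%:M)^T.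
  rewrite {1}feasible_blockE mul_row_block tr_row_mx trmx1 mul_row_col mulmx1.
  by rewrite !mul1mx !mulNmx addNr mul0mx add0r mulmxA addKr.
by apply: psd_conj; case: FS.
Qed.

(** The linear constraint on [S] is this fixed-point equation, once the blocks of
    [S] are expressed through the policy. *)
Lemma feasible_feedback : feedback_cov A B W K V Y = Y.
Proof.
case: FS => _ _ e; rewrite -/Y in e; rewrite {2}e feasible_blockE /feedback_cov.
congr (_ + _); rewrite mul_row_block tr_row_mx mul_row_col.
set N := (A + B *m K) *m Y.
have -> : A *m Y + B *m (K *m Y) = N by rewrite /N mulmxDl !mulmxA.
have -> : A *m (Y *m K^T) + B *m (K *m Y *m K^T + V) = N *m K^T + B *m V.
  by rewrite /N !mulmxDl mulmxDr !mulmxA addrA.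
by rewrite linearD /= trmx_mul mulmxDr mulmxDl mulmxA addrA.
Qed.

Lemma feasible_traces : \tr Y + \tr (K *m Y *m K^T) <= nu.
Proof.
case: FS => _ tS _; apply: le_trans tS; rewrite [\tr S](congr1 (@mxtrace _ _) feasible_blockE) mxtrace_block.
by rewrite lerD2l mxtraceD lerDl; apply: psd_trace_ge0; exact: policy_cov_psd.
Qed.

End Policy.
End Feasible.

(** * Tracking a drifting target covariance *)

Section Tracking.
Context {R : realType} {d k : nat}.
Context (A : 'M[R]_d) (B : 'M[R]_(d, k)) (W : 'M[R]_d) (nu sigma : R).
Hypotheses (nu_gt0 : 0 < nu) (sigma_gt0 : 0 < sigma).
Hypothesis W_ge : psd (W - (sigma ^+ 2)%:M).

Local Notation F := (feasible A B W nu).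
Local Notation K S := (gain S).
Local Notation V S := (policy_cov S).

(** If the true covariance is at most [(1 + a)] times the intended one, one
    closed-loop step shrinks the excess by the factor [1 - sigma^2 / nu],
    because [W >= sigma^2 I] dominates that fraction of the intended
    covariance; moving the target by [delta] then costs [delta / sigma^2]. *)
Lemma tracking_step (S S' : 'M[R]_(d + k)) (X : 'M[R]_d) (a delta : R) :
  F S -> F S' -> 0 <= a -> fronorm (S' - S) <= delta ->
  delta / sigma ^+ 2 <= sigma ^+ 2 / nu / 2 ->
  (forall v, quad (X - ulsubmx S) v <= a * quad (ulsubmx S) v) ->
  forall v, quad (feedback_cov A B W (K S) (V S) X - ulsubmx S') v <=
    ((1 - sigma ^+ 2 / nu / 2) * a + delta / sigma ^+ 2) * quad (ulsubmx S') v.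
Proof.
move=> FS FS' a0 SS' hd hX v.
have [->|v0] := eqVneq v 0; first by rewrite !quadE !mxdot0l mulr0.
have n_gt0 : 0 < mxdot v v.
  rewrite lt0r mxdot_ge0 andbT -fronorm_sqr sqrf_eq0; apply: contra v0.
  by move=> /eqP/fronorm_eq0 ->.
have s2 : 0 < sigma ^+ 2 by rewrite exprn_gt0.
set c := sigma ^+ 2 / nu; set eps := delta / sigma ^+ 2.
set Y := ulsubmx S; set Y' := ulsubmx S'.
set M := A + B *m K S.
have eY : M *m Y *m M^T + B *m V S *m B^T + W = Y.
  exact: (feasible_feedback sigma_gt0 W_ge FS).
have -> : feedback_cov A B W (K S) (V S) X - Y' = M *m (X - Y) *m M^T + (Y - Y').
  rewrite mulmxBr mulmxBl -[in Y - Y']eY /feedback_cov -/M.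
  move: (M *m X *m M^T) (M *m Y *m M^T) (B *m V S *m B^T) => Q1 Q2 Q3.
  by apply/matrixP => i j; rewrite !mxE; ring.
rewrite quadD quad_conj.
have y0 : 0 <= mxdot v v := mxdot_ge0 v.
have hY : quad (M *m Y *m M^T) v <= quad Y v - sigma ^+ 2 * mxdot v v.
  have := congr1 (fun Z => quad Z v) eY; rewrite /= !quadD (quad_conj B).
  have [_ pV] := policy_cov_psd sigma_gt0 W_ge FS.
  by have := pV (B^T *m v); have := noise_quad_ge W_ge v; lra.
have hE : quad (Y - Y') v <= delta * mxdot v v.
  apply: le_trans (ler_norm _) _; apply: le_trans (normr_quad_le _ _) _.
  rewrite ler_wpM2r //; apply: le_trans SS'; rewrite fronormB.
  have -> : Y' - Y = ulsubmx (S' - S) by apply/matrixP => i j; rewrite !mxE.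
  exact: fronorm_ulsubmx.
have hS' : sigma ^+ 2 * mxdot v v <= quad Y' v := state_block_ge W_ge FS' v.
have hnu : quad Y v <= nu * mxdot v v.
  apply: le_trans (psd_quad_le_trace v (state_block_psd W_ge FS)) _.
  rewrite ler_wpM2r //; have := feasible_traces sigma_gt0 W_ge FS.
  have := psd_trace_ge0 (psd_conj (K S) (state_block_psd W_ge FS)); rewrite -/Y; lra.
have hS : sigma ^+ 2 * mxdot v v <= quad Y v := state_block_ge W_ge FS v.
have d0 : 0 <= delta := le_trans (fronorm_ge0 _) SS'.
have hX' := hX (M^T *m v); rewrite -/Y -(quad_conj M Y) in hX'.
have EY : quad Y v = quad Y' v + quad (Y - Y') v.
  by rewrite quadD quadN addrC subrK.
move: n_gt0 hE hY hS' hnu hS hX' EY.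
set n := mxdot v v; set e := quad (Y - Y') v; set y := quad Y v; set y' := quad Y' v.
set z := quad (M *m Y *m M^T) v => n_gt0 hE hY hS' hnu hS hX' EY.
apply: le_trans (lerD hX' (lexx e)) _.
have e0 : 0 <= eps by rewrite divr_ge0 // ltW.
have c0 : 0 < c by rewrite divr_gt0.
have hE' : e <= eps * y'.
  apply: le_trans hE _; apply: le_trans (ler_wpM2l e0 hS').
  by rewrite mulrA divfK ?gt_eqF.
have c1 : c <= 1.
  rewrite ler_pdivrMr // mul1r -(ler_pM2r n_gt0); exact: le_trans hS hnu.
have zc : z <= (1 - c) * y.
  have : c * y <= sigma ^+ 2 * n.
    rewrite /c mulrAC ler_pdivrMr // -[leRHS]mulrA (mulrC n).
    by rewrite ler_wpM2l ?(ltW s2).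
  by move: hY; lra.
have yb : y <= (1 + eps) * y' by rewrite mulrDl mul1r EY lerD2l.
have y'0 : 0 <= y' by apply: le_trans hS'; rewrite mulr_ge0 ?(ltW s2).
have h1 : a * z <= a * ((1 - c) * ((1 + eps) * y')).
  rewrite ler_wpM2l //; apply: le_trans zc _; rewrite ler_wpM2l // subr_ge0 //.
apply: le_trans (lerD h1 hE') _.
have h2 : (1 - c) * (1 + eps) <= 1 - c / 2.
  have : 0 <= c * eps by rewrite mulr_ge0 // ltW.
  by move: hd; rewrite -/c -/eps; lra.
by have := ler_wpM2r (mulr_ge0 a0 y'0) h2; lra.
Qed.

End Tracking.

Section TrackingSum.
Context {R : realType} {d k : nat}.
Context (A : 'M[R]_d) (B : 'M[R]_(d, k)) (W : 'M[R]_d) (nu sigma : R).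
Hypotheses (nu_gt0 : 0 < nu) (sigma_gt0 : 0 < sigma).
Hypothesis W_ge : psd (W - (sigma ^+ 2)%:M).

(** The excess follows an affine recursion with contraction factor
    [1 - sigma^2 / (2 nu)], whose sum over the rounds is a telescoping sum. *)
Lemma tracking (S : nat -> 'M[R]_(d + k)) (X0 : 'M[R]_d) (T : nat) (delta : R) :
  0 <= delta ->
  (forall t, (t <= T)%N -> feasible A B W nu (S t)) ->
  (forall t, (t < T)%N -> fronorm (S t.+1 - S t) <= delta) ->
  delta / sigma ^+ 2 <= sigma ^+ 2 / nu / 2 ->
  let X := state_cov A B W (fun t => gain (S t)) (fun t => policy_cov (S t)) X0 in
  exists a : nat -> R,
  [/\ forall t, 0 <= a t,
      forall t, (t <= T)%N -> forall v,
        quad (X t - ulsubmx (S t)) v <= a t * quad (ulsubmx (S t)) v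
    & \sum_(t < T) a t <=
      2 * nu / sigma ^+ 2 * (fronorm X0 / sigma ^+ 2 + T%:R * (delta / sigma ^+ 2))].
Proof.
move=> d0 FS dS hd X.
have s2 : 0 < sigma ^+ 2 by rewrite exprn_gt0.
set c := sigma ^+ 2 / nu; set eps := delta / sigma ^+ 2.
have e0 : 0 <= eps by rewrite divr_ge0 // ltW.
have c0 : 0 < c by rewrite divr_gt0.
have ci : 2 * nu / sigma ^+ 2 = (c / 2)^-1.
  by rewrite /c; field; rewrite !gt_eqF.
have b0 : 0 <= fronorm X0 / sigma ^+ 2 by rewrite divr_ge0 ?fronorm_ge0 // ltW.
(* In dimension 0 nothing forces [sigma ^ 2 <= nu], but all forms vanish. *)
have [d_eq0|d_gt0] := posnP d.
  exists (fun=> 0); split=> // [t _ v|].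
    rewrite mul0r; suff -> : v = 0 by rewrite quadE mxdot0l.
    apply/matrixP => i; have : (i < 0)%N by rewrite -[X in (_ < X)%N]d_eq0 ltn_ord.
    by [].
  rewrite big1 // ci; apply: mulr_ge0; first by rewrite invr_ge0 ltW // divr_gt0.
  by rewrite addr_ge0 // mulr_ge0.
have c1 : c <= 1.
  pose v : 'cV[R]_d := delta_mx (Ordinal d_gt0) ord0.
  have v0 : 0 < mxdot v v.
    rewrite -[X in mxdot v X]mul1mx -quadE quad_delta mxE eqxx; exact: ltr01.
  rewrite ler_pdivrMr // mul1r -(ler_pM2r v0).
  apply: le_trans (state_block_ge W_ge (FS 0%N (leq0n T)) v) _.
  apply: le_trans (psd_quad_le_trace v (state_block_psd W_ge (FS 0%N (leq0n T)))) _.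
  rewrite ler_wpM2r ?(ltW v0) //.
  have := feasible_traces sigma_gt0 W_ge (FS 0%N (leq0n T)).
  have := psd_trace_ge0 (psd_conj (gain (S 0%N))
    (state_block_psd W_ge (FS 0%N (leq0n T)))); lra.
pose a := fix a t := if t is s.+1 then (1 - c / 2) * a s + eps
                     else fronorm X0 / sigma ^+ 2.
have a_ge0 t : 0 <= a t.
  elim: t => [//|t IH] /=; rewrite addr_ge0 // mulr_ge0 //; lra.
exists a; split=> //.
  elim=> [_|t IH tT] v.
    rewrite quadD quadN /=.
    apply: (@le_trans _ _ (quad X0 v)).
      rewrite lerBlDr lerDl; have [_ p] := state_block_psd W_ge (FS 0%N (leq0n T)).
      exact: p.
    apply: le_trans (ler_norm _) _; apply: le_trans (normr_quad_le _ _) _.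
    rewrite -mulrA ler_wpM2l ?fronorm_ge0 // -ler_pdivrMl ?invr_gt0 // invrK.
    exact: (state_block_ge W_ge (FS 0%N (leq0n T))).
  apply: (tracking_step nu_gt0 sigma_gt0 W_ge (FS t (ltnW tT)) (FS t.+1 tT)) => //.
    exact: dS.
  exact: IH (ltnW tT).
have sumE n : c / 2 * \sum_(t < n) a t = fronorm X0 / sigma ^+ 2 + n%:R * eps - a n.
  elim: n => [|n IH]; first by rewrite big_ord0 mulr0 mul0r addr0 subrr.
  by rewrite big_ord_recr /= mulrDr IH -natr1; ring.
rewrite ci -ler_pdivrMl ?invr_gt0 ?divr_gt0 // invrK sumE.
by rewrite lerBlDr lerDl.
Qed.

(** The policy covariance cancels, and a cost that is linear and monotone in the
    state covariance inherits the relative excess [a]. *)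
Lemma excess_cost_le (S : 'M[R]_(d + k)) (X Q : 'M[R]_d) (Rc : 'M[R]_k) (a c : R) :
  feasible A B W nu S -> 0 <= a -> 0 <= c -> psd Q -> psd Rc ->
  \tr Q <= c -> \tr Rc <= c ->
  (forall v, quad (X - ulsubmx S) v <= a * quad (ulsubmx S) v) ->
  \tr (Q *m X) + \tr (Rc *m (gain S *m X *m (gain S)^T + policy_cov S))
  - \tr (block_mx Q 0 0 Rc *m S) <= c * nu * a.
Proof.
move=> FS a0 c0 pQ pR tQ tR hX; set K := gain S; set Y := ulsubmx S.
have pY : psd Y := state_block_psd W_ge FS.
have pKY := psd_conj K pY.
have eS := feasible_blockE sigma_gt0 W_ge FS; rewrite -/K -/Y in eS.
rewrite mxtrace_block_cost.
have -> : drsubmx S = K *m Y *m K^T + policy_cov S by rewrite {1}eS block_mxKdr.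
rewrite -/Y.
have -> : \tr (Q *m X) + \tr (Rc *m (K *m X *m K^T + policy_cov S))
  - (\tr (Q *m Y) + \tr (Rc *m (K *m Y *m K^T + policy_cov S)))
  = \tr (Q *m (X - Y)) + \tr (Rc *m (K *m (X - Y) *m K^T)).
  by rewrite !mulmxDr !mxtraceD !mulmxN mulmxDl !mulmxDr mulNmx mulmxN !mxtraceD;
     rewrite !raddfN /=; ring.
have h1 : \tr (Q *m (X - Y)) <= a * (c * \tr Y).
  have hX' v : quad (X - Y) v <= quad (a *: Y) v by rewrite quadZ; exact: hX.
  apply: le_trans (psd_trace_le pQ hX') _.
  rewrite -scalemxAr mxtraceZ ler_wpM2l //.
  apply: le_trans (psd_trace_mul_le pQ pY) _.
  by rewrite ler_wpM2r ?psd_trace_ge0.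
have h2 : \tr (Rc *m (K *m (X - Y) *m K^T)) <= a * (c * \tr (K *m Y *m K^T)).
  have hX' v : quad (K *m (X - Y) *m K^T) v <= quad (a *: (K *m Y *m K^T)) v.
    by rewrite quadZ !(quad_conj K); exact: hX.
  apply: le_trans (psd_trace_le pR hX') _.
  rewrite -scalemxAr mxtraceZ ler_wpM2l //.
  apply: le_trans (psd_trace_mul_le pR pKY) _.
  by rewrite ler_wpM2r ?psd_trace_ge0.
apply: le_trans (lerD h1 h2) _.
rewrite -mulrDr -mulrDr [leRHS]mulrC ler_wpM2l // ler_wpM2l //.
exact: (feasible_traces sigma_gt0 W_ge FS).
Qed.

End TrackingSum.

(** * Step size and horizon *)

Section StepAndHorizon.
Context {R : realType} (m : nat) (C sigma nu beta : R).
Hypotheses (m_gt0 : (0 < m)%N) (C_gt0 : 0 < C) (sigma_gt0 : 0 < sigma).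
Hypotheses (nu_gt0 : 0 < nu) (beta01 : 0 <= beta < 1).

Let m1 : 1 <= m%:R :> R. Proof. by rewrite ler1n. Qed.
Let s1 : 1 <= Num.sqrt (m%:R : R).
Proof. by rewrite -[leLHS]sqrtr1 ler_wsqrtr. Qed.
Let b1 : 0 < 1 - beta. Proof. by case/andP: beta01 => _; rewrite subr_gt0. Qed.

(** Together with the next lemma: [rho] has exact order [1 / (1 - beta)]. *)
Lemma step_rho_ge : 16 * C ^+ 2 / (1 - beta) <= step_rho m C sigma nu beta.
Proof.
rewrite /step_rho; set t2 := (X in _ <= _ + X).
have t20 : 0 <= t2.
  apply: mulr_ge0.
    rewrite mulr_ge0 ?mulr_ge0 ?ler0n ?(ltW C_gt0) // addr_ge0 //.
    by rewrite divr_ge0 ?(ltW nu_gt0) ?sqr_ge0.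
  rewrite divr_ge0 ?mulr_ge0 ?sqrtr_ge0 ?(ltW C_gt0) ?(ltW nu_gt0) ?(ltW b1) //;
    exact: ltW.
apply: ler_wpDr => //.
have b0 : 0 <= (1 - beta)^-1 by rewrite invr_ge0 ltW.
(* The second summand of the bracket in the first term suffices. *)
have sm : 1 <= m%:R * Num.sqrt (m%:R : R) by rewrite mulr_ege1.
have h : 16 * C ^+ 2 / (1 - beta) * 1 <=
    16 * C ^+ 2 / (1 - beta) * (m%:R * Num.sqrt m%:R).
  by rewrite ler_wpM2l // mulr_ge0 // mulr_ge0 // sqr_ge0.
rewrite mulr1 in h; apply: le_trans h _.
rewrite -subr_ge0 [X in 0 <= X](_ : _ = 12 * (m%:R * C ^+ 2)); last by ring.
by rewrite mulr_ge0 // mulr_ge0 ?ler0n // sqr_ge0.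
Qed.

Lemma step_rho_le : step_rho m C sigma nu beta <= step_rho m C sigma nu 0 / (1 - beta).
Proof.
have [b0 bl] := andP beta01.
have -> : step_rho m C sigma nu 0 / (1 - beta) =
    4 * m%:R * C ^+ 2 * (3 / (1 - beta) + 4 * Num.sqrt m%:R / (1 - beta))
    + m%:R * C * (1 + nu / sigma ^+ 2)
      * (16 * Num.sqrt (2 * m%:R) * C * nu / ((1 - beta) * sigma ^+ 2)).
  by rewrite /step_rho subr0; field; rewrite !gt_eqF.
rewrite /step_rho lerD2r ler_wpM2l //.
  by rewrite mulr_ge0 ?mulr_ge0 ?ler0n ?(ltW C_gt0).
rewrite lerD2r ler_pdivlMr //; lra.
Qed.

Lemma step_rho_gt0 : 0 < step_rho m C sigma nu beta.
Proof.
by apply: lt_le_trans step_rho_ge; rewrite divr_gt0 // mulr_gt0 // exprn_gt0.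
Qed.

Lemma horizon_bound_gt0 :
  0 < horizon_bound m C sigma nu beta (step_rho m C sigma nu beta).
Proof.
rewrite exprn_gt0 // divr_gt0 ?mulr_gt0 ?sqrtr_gt0 ?mulr_gt0 ?exprn_gt0 ?ltr0n //.
exact: step_rho_gt0.
Qed.

Context (T : nat).
Hypothesis T_ge : horizon_bound m C sigma nu beta (step_rho m C sigma nu beta) <= T%:R.

Local Notation rho := (step_rho m C sigma nu beta).
Local Notation eta := (step_size rho T).

Lemma horizon_gt0 : (0 < T)%N.
Proof. by rewrite -(ltr0n R); exact: lt_le_trans horizon_bound_gt0 T_ge. Qed.

Lemma step_size_gt0 : 0 < eta.
Proof. by rewrite invr_gt0 sqrtr_gt0 mulr_gt0 ?step_rho_gt0 ?ltr0n ?horizon_gt0. Qed.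

(** The lower bound on the horizon says that the drift of the iterates is at most
    half of what the contraction of the state covariance absorbs. *)
Lemma drift_small :
  eta * (Num.sqrt 2 * C) * (2 * Num.sqrt m%:R / (1 - beta)) / sigma ^+ 2 <=
  sigma ^+ 2 / nu / 2.
Proof.
set h := 4 * Num.sqrt (2 * m%:R) * nu * C / (sigma ^+ 4 * (1 - beta)).
have h0 : 0 < h.
  by rewrite divr_gt0 ?mulr_gt0 ?sqrtr_gt0 ?mulr_gt0 ?exprn_gt0 ?ltr0n.
have r0 := step_rho_gt0.
have hT : h <= Num.sqrt (rho * T%:R).
  rewrite sqrtrM ?(ltW r0) // [leRHS]mulrC -ler_pdivrMr ?sqrtr_gt0 //.
  rewrite -(@ler_pXn2r _ 2) ?nnegrE ?sqrtr_ge0 //; last first.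
    by rewrite divr_ge0 ?sqrtr_ge0 ?(ltW h0).
  rewrite [leRHS]sqr_sqrtr ?ler0n //; apply: le_trans T_ge.
  rewrite le_eqVlt; apply/orP; left; apply/eqP; rewrite /horizon_bound /h.
  congr (_ ^+ 2); field; by rewrite !gt_eqF // ?sqrtr_gt0.
have eh : eta <= h^-1 by rewrite /step_size lef_pV2 ?posrE // (lt_le_trans h0).
have sq : Num.sqrt (2 * m%:R) = Num.sqrt 2 * Num.sqrt (m%:R : R) by rewrite sqrtrM.
have k0 : 0 <= (Num.sqrt 2 * C) * (2 * Num.sqrt m%:R / (1 - beta)) / sigma ^+ 2.
  by rewrite !(mulr_ge0, invr_ge0, sqrtr_ge0, sqr_ge0) // ltW.
rewrite [leLHS](_ : _ = eta * ((Num.sqrt 2 * C) * (2 * Num.sqrt m%:R / (1 - beta)) / sigma ^+ 2));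
  last by ring.
apply: le_trans (ler_wpM2r k0 eh) _.
rewrite le_eqVlt; apply/orP; left; apply/eqP; rewrite /h sq.
field; rewrite !gt_eqF ?sqrtr_gt0 ?ltr0n ?exprn_gt0 //.
Qed.

Local Notation rate := ((Num.sqrt (1 - beta))^-1 * Num.sqrt (T%:R : R)).

Lemma rate_ge1 : 1 <= rate.
Proof.
have [b0 bl] := andP beta01.
have sb : 0 < Num.sqrt (1 - beta) by rewrite sqrtr_gt0.
rewrite mulrC ler_pdivlMr // mul1r.
by rewrite ler_wsqrtr //; have : 1 <= T%:R :> R by [rewrite ler1n horizon_gt0]; lra.
Qed.

Lemma inv_step_size_le : eta^-1 <= Num.sqrt (step_rho m C sigma nu 0) * rate.
Proof.
rewrite /step_size invrK sqrtrM ?(ltW step_rho_gt0) // mulrA.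
rewrite ler_wpM2r ?sqrtr_ge0 // -sqrtrV ?(ltW b1) // -sqrtrM.
  exact: ler_wsqrtr step_rho_le.
by rewrite -(pmulr_lge0 _ (etrans (invr_gt0 _) b1)) (le_trans (ltW step_rho_gt0) step_rho_le).
Qed.

Lemma horizon_step_size_le : T%:R * eta / (1 - beta) <= (4 * C)^-1 * rate.
Proof.
have r0 := step_rho_gt0; have T0 : 0 < T%:R :> R by rewrite ltr0n horizon_gt0.
have sb : 0 < Num.sqrt (1 - beta) by rewrite sqrtr_gt0.
have sr : 4 * C / Num.sqrt (1 - beta) <= Num.sqrt rho.
  rewrite -(@ler_pXn2r _ 2) ?nnegrE ?sqrtr_ge0 //; last first.
    by rewrite divr_ge0 ?mulr_ge0 ?(ltW C_gt0) ?sqrtr_ge0.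
  rewrite sqr_sqrtr ?(ltW r0) // exprMn exprVn sqr_sqrtr ?(ltW b1) //.
  apply: le_trans step_rho_ge; rewrite exprMn; lra.
rewrite /step_size sqrtrM ?(ltW r0) //.
have eT : T%:R = Num.sqrt (T%:R : R) ^+ 2 by rewrite sqr_sqrtr // ltW.
have eb : 1 - beta = Num.sqrt (1 - beta) ^+ 2 by rewrite sqr_sqrtr // ltW.
have sT : 0 < Num.sqrt (T%:R : R) by rewrite sqrtr_gt0.
have sr0 : 0 < Num.sqrt rho by rewrite sqrtr_gt0.
move: sb sr eT eb sT sr0.
set vb := Num.sqrt (1 - beta); set vr := Num.sqrt rho; set vT := Num.sqrt T%:R.
move=> sb sr eT eb sT sr0.
have s4 : 0 < 4 * C / vb by rewrite divr_gt0 // mulr_gt0.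
rewrite [leLHS](_ : _ = vr^-1 * (vT / vb ^+ 2)); last first.
  by rewrite eT eb; field; rewrite !gt_eqF.
have ir : vr^-1 <= (4 * C / vb)^-1 by rewrite lef_pV2.
have q0 : 0 <= vT / vb ^+ 2 by rewrite divr_ge0 ?(ltW sT) ?sqr_ge0.
apply: le_trans (ler_wpM2r q0 ir) _; rewrite le_eqVlt; apply/orP; left; apply/eqP.
by field; rewrite !gt_eqF.
Qed.

End StepAndHorizon.

(** * The regret bound *)

Section CostMatrices.
Context {R : realType} {m d k : nat}.

Lemma fronorm_block_diag (G : 'M[R]_d) (H : 'M[R]_k) :
  fronorm (block_mx G 0 0 H) ^+ 2 = fronorm G ^+ 2 + fronorm H ^+ 2.
Proof.
rewrite !fronorm_sqr /mxdot big_split_ord /=; congr (_ + _).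
  apply: eq_bigr => i _; rewrite big_split_ord /= [X in _ + X]big1 ?addr0.
    by apply: eq_bigr => j _; rewrite !block_mxEul.
  by move=> j _; rewrite block_mxEur mxE mul0r.
apply: eq_bigr => i _; rewrite big_split_ord /= big1 ?add0r.
  by apply: eq_bigr => j _; rewrite !block_mxEdr.
by move=> j _; rewrite block_mxEdl mxE mul0r.
Qed.

Lemma fronorm_cost_le (C : R) (G : 'M[R]_d) (H : 'M[R]_k) :
  0 <= C -> psd G -> psd H -> \tr G <= C -> \tr H <= C ->
  fronorm (block_mx G 0 0 H) <= Num.sqrt 2 * C.
Proof.
move=> C0 pG pH tG tH.
rewrite -(@ler_pXn2r _ 2) ?nnegrE ?fronorm_ge0 ?mulr_ge0 ?sqrtr_ge0 //.
rewrite fronorm_block_diag exprMn (@sqr_sqrtr _ 2) //.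
have sq (n : nat) (M : 'M[R]_n) : psd M -> \tr M <= C -> fronorm M ^+ 2 <= C ^+ 2.
  move=> pM tM; rewrite ler_pXn2r ?nnegrE ?fronorm_ge0 //.
  exact: le_trans (psd_fronorm_le pM) tM.
by have := sq _ _ pG tG; have := sq _ _ pH tH; lra.
Qed.

Lemma block_cost_sum (Q : 'I_m -> 'M[R]_d) (Rc : 'I_m -> 'M[R]_k) (X : 'M[R]_(d + k)) :
  (forall i, psd (Q i)) -> (forall i, psd (Rc i)) ->
  \tr (block_mx (\sum_i Q i) 0 0 (\sum_i Rc i) *m X) =
  \sum_i mxdot (block_mx (Q i) 0 0 (Rc i)) X.
Proof.
move=> pQ pR; rewrite mxtrace_block_cost !mulmx_suml !raddf_sum -big_split /=.
apply: eq_bigr => i _; rewrite mxdot_trace tr_block_mx !trmx0 (proj1 (pQ i)).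
by rewrite (proj1 (pR i)) mxtrace_block_cost.
Qed.

Lemma trace_sum_le n (C : R) (F : 'I_m -> 'M[R]_n) :
  (forall i, \tr (F i) <= C) -> \tr (\sum_i F i) <= m%:R * C.
Proof.
move=> h; rewrite raddf_sum /=; apply: le_trans (ler_sum _ (fun i _ => h i)) _.
by rewrite sumr_const card_ord mulr_natl.
Qed.

End CostMatrices.

Theorem theorem2 (R : realType) (m d k : nat)
    (C kappa gamma lambda sigma : R)
    (M1 : 'I_m -> 'M[R]_d) (Ms : 'M[R]_d)
    (C_gt0 : 0 < C) (kappa_gt1 : 1 < kappa) (gamma01 : 0 < gamma < 1)
    (lambda_gt0 : 0 < lambda) (sigma_gt0 : 0 < sigma) :
  exists c : R,
  forall (A : 'M[R]_d) (B : 'M[R]_(d, k)) (W : 'M[R]_d)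
    (comm : rel 'I_m) (P : 'M[R]_m) (beta : R)
    (Q : 'I_m -> nat -> 'M[R]_d) (Rc : 'I_m -> nat -> 'M[R]_k) (T : nat),
  posdef W -> \tr W <= lambda ^+ 2 -> psd (W - (sigma ^+ 2)%:M) ->
  network comm P beta ->
  admissible_costs C Q Rc ->
  let nu := trace_bound kappa gamma lambda in
  let rho := step_rho m C sigma nu beta in
  let eta := step_size rho T in
  horizon_bound m C sigma nu beta rho <= T%:R ->
  forall (disp : measure_display) (Omega : measurableType disp)
    (Pr : probability Omega R)
    (x w : 'I_m -> nat -> Omega -> 'cV[R]_d)
    (u : 'I_m -> nat -> Omega -> 'cV[R]_k)
    (S : 'I_m -> nat -> 'M[R]_(d + k)),
  algorithm_run Pr A B W P Q Rc nu eta T M1 x w u S ->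
  forall (j : 'I_m) (Ks : 'M[R]_(k, d)),
  strongly_stable A B kappa gamma Ks ->
  forall (disps : measure_display) (Omegas : measurableType disps)
    (Prs : probability Omegas R)
    (xs ws : nat -> Omegas -> 'cV[R]_d) (us : nat -> Omegas -> 'cV[R]_k),
  linear_run Prs A B W Ks Ms xs ws us ->
  (total_cost Pr Q Rc T (x j) (u j) - total_cost Prs Q Rc T xs us
    <= (c * ((Num.sqrt (1 - beta))^-1 * Num.sqrt T%:R))%:E)%E.
Proof.
pose nu0 := trace_bound kappa gamma lambda.
pose g := Num.sqrt 2 * C.
pose K0 := \sum_i fronorm (M1 i).
(* The six terms bound, in this order: the initial covariance mismatch, the
   drift of the target covariance, the distance to the comparator, the squared
   gradients, the disagreement between agents, and the transient of the
   comparator. *)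
exists (m%:R * C * nu0 * (2 * nu0 / sigma ^+ 2) * (K0 / sigma ^+ 2)
  + m%:R * C * nu0 * (2 * nu0 / sigma ^+ 2) * (g * (2 * Num.sqrt m%:R) / sigma ^+ 2) / (4 * C)
  + m%:R * (2 * nu0) ^+ 2 / 2 * Num.sqrt (step_rho m C sigma nu0 0)
  + m%:R * (g ^+ 2 / 2) / (4 * C)
  + m%:R * (g * (g * (2 * Num.sqrt m%:R))) / (4 * C)
  + m%:R * C * kappa ^+ 2 * nu0 / gamma).
move=> A B W comm P beta Q Rc T pdW tW W_ge net adm nu rho eta T_ge.
move=> disp Omega Pr x w u S run j Ks ss disps Omegas Prs xs ws us lin.
have [g0 g1] := andP gamma01; have [b0 b1] := andP (network_beta01 net).
have nu_gt0 : 0 < nu.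
  rewrite divr_gt0 // mulr_gt0 ?exprn_gt0 // mulr_gt0 // exprn_gt0 //.
  exact: lt_trans ltr01 kappa_gt1.
have m_gt0 : (0 < m)%N by exact: leq_ltn_trans (ltn_ord j).
have beta01 := network_beta01 net.
have pW := posdef_psd pdW.
have pQ i t : psd (Q i t) by have [/posdef_psd] := adm i t.
have pR i t : psd (Rc i t) by have [_ /posdef_psd] := adm i t.
have tQ i t : \tr (Q i t) <= C by have [] := adm i t.
have tR i t : \tr (Rc i t) <= C by have [] := adm i t.
have eta_gt0 : 0 < eta := step_size_gt0 m_gt0 C_gt0 sigma_gt0 nu_gt0 beta01 T_ge.
have [S1 FS1 S_init] := run_init run.
have convF := @feasible_convex R d k A B W nu.
pose G i t := block_mx (Q i t) 0 0 (Rc i t).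
have G_le i t : fronorm (G i t) <= g by apply: fronorm_cost_le => //; exact: ltW.
have upd i t (tT : (t < T)%N) := run_update run i tT.
have FS i t : (t <= T)%N -> feasible A B W nu (S i t).
  exact: (iterate_feasible FS1 S_init upd).
have drift t : (t < T)%N ->
    fronorm (S j t.+1 - S j t) <= eta * g * (2 * Num.sqrt m%:R / (1 - beta)).
  exact: (projected_drift_le net convF eta_gt0 FS1 S_init upd G_le).
have small := drift_small m_gt0 C_gt0 sigma_gt0 nu_gt0 beta01 T_ge.
rewrite -/rho -/eta -/g in small.
set delta := eta * g * (2 * Num.sqrt m%:R / (1 - beta)) in drift small.
have g_ge0 : 0 <= g by rewrite mulr_ge0 ?sqrtr_ge0 // ltW.
have T_gt0 : (0 < T)%N := horizon_gt0 m_gt0 C_gt0 sigma_gt0 nu_gt0 beta01 T_ge.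
have d0 : 0 <= delta := le_trans (fronorm_ge0 _) (drift 0%N T_gt0).
have pV t : (t < T)%N -> psd (policy_cov (S j t)).
  by move=> tT; exact: (policy_cov_psd sigma_gt0 W_ge (FS j t (ltnW tT))).
rewrite (algorithm_cost pW pQ pR pV run).
have [pMs ->] := linear_cost T pW pQ pR lin.
have [a [a0 aX aS]] := tracking nu_gt0 sigma_gt0 W_ge (M1 j) d0 (FS j) drift small.
have [Ss FSs comp] := comparator kappa_gt1 gamma01 pW tW ss.
rewrite -EFinB lee_fin.
have mC0 : 0 <= m%:R * C by rewrite mulr_ge0 ?ler0n // ltW.
have sQ t : psd (\sum_i Q i t) by apply: psd_sum => i.
have sR t : psd (\sum_i Rc i t) by apply: psd_sum => i.
have stQ t : \tr (\sum_i Q i t) <= m%:R * C by apply: trace_sum_le => i.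
have stR t : \tr (\sum_i Rc i t) <= m%:R * C by apply: trace_sum_le => i.
have {comp} hcomp := comp Ms (m%:R * C) _ _ T pMs mC0 sQ sR stQ stR.
have hreg := projected_regret_le net convF eta_gt0 FS1 S_init upd G_le FSs
  (fun X FX => feasible_dist_le FX FSs) j.
pose cost t X := \tr (block_mx (\sum_i Q i t) 0 0 (\sum_i Rc i t) *m X).
have hexc : \sum_(t < T) (\tr ((\sum_i Q i t) *m
      state_cov A B W (fun t => gain (S j t)) (fun t => policy_cov (S j t)) (M1 j) t)
    + \tr ((\sum_i Rc i t) *m (gain (S j t) *m
      state_cov A B W (fun t => gain (S j t)) (fun t => policy_cov (S j t)) (M1 j) t
      *m (gain (S j t))^T + policy_cov (S j t)))) - \sum_(t < T) cost t (S j t)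
    <= m%:R * C * nu * \sum_(t < T) a t.
  rewrite -sumrB mulr_sumr; apply: ler_sum => t _.
  have tT := ltnW (ltn_ord t).
  exact: (excess_cost_le sigma_gt0 W_ge (FS j t tT) (a0 t) mC0 (sQ t) (sR t)
    (stQ t) (stR t) (aX t tT)).
have hlin : \sum_(t < T) cost t (S j t) - \sum_(t < T) cost t Ss =
    \sum_(t < T) \sum_i mxdot (G i t) (S j t - Ss).
  rewrite -sumrB; apply: eq_bigr => t _; rewrite /cost !block_cost_sum // -sumrB.
  by apply: eq_bigr => i _; rewrite mxdotDr mxdotNr.
rewrite -hlin in hreg.
have {}hcomp : \sum_(t < T) cost t Ss - _ <= _ := hcomp.
set Z := (Num.sqrt (1 - beta))^-1 * Num.sqrt T%:R.
have Z1 : 1 <= Z := rate_ge1 m_gt0 C_gt0 sigma_gt0 nu_gt0 beta01 T_ge.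
have Z_eta : eta^-1 <= Num.sqrt (step_rho m C sigma nu 0) * Z.
  exact: inv_step_size_le.
set H := T%:R * eta / (1 - beta).
have Z_H : H <= (4 * C)^-1 * Z := horizon_step_size_le m_gt0 C_gt0 sigma_gt0 nu_gt0 beta01 T_ge.
have H0 : T%:R * eta <= H.
  rewrite ler_pdivlMr ?subr_gt0 // ler_piMr ?mulr_ge0 ?ler0n ?(ltW eta_gt0) //.
  by rewrite lerBlDr lerDl.
have K0_ge : fronorm (M1 j) <= K0.
  by rewrite /K0 (bigD1 j) //= lerDl; apply: sumr_ge0 => i _; exact: fronorm_ge0.
set P1 := m%:R * C * nu * (2 * nu / sigma ^+ 2).
have P1_ge0 : 0 <= P1.
  apply: mulr_ge0; first by rewrite mulr_ge0 // ltW.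
  by rewrite divr_ge0 ?sqr_ge0 // mulr_ge0 // ltW.
set G2 := g * (2 * Num.sqrt m%:R) / sigma ^+ 2.
have G2_ge0 : 0 <= G2.
  by rewrite divr_ge0 ?sqr_ge0 // mulr_ge0 // mulr_ge0 ?sqrtr_ge0.
have bound_excess : m%:R * C * nu * \sum_(t < T) a t <= P1 * (K0 / sigma ^+ 2) + P1 * G2 * H.
  have mCn : 0 <= m%:R * C * nu by rewrite mulr_ge0 // ltW.
  apply: le_trans (ler_wpM2l mCn aS) _.
  rewrite [leLHS](_ : _ = P1 * (fronorm (M1 j) / sigma ^+ 2) + P1 * G2 * H); last first.
    rewrite /P1 /G2 /H /delta; field.
    by rewrite !gt_eqF // ?subr_gt0.
  by rewrite lerD2r ler_wpM2l // ler_wpM2r ?invr_ge0 ?sqr_ge0.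
have e1 : P1 * (K0 / sigma ^+ 2) <= P1 * (K0 / sigma ^+ 2) * Z.
  rewrite ler_peMr // mulr_ge0 // divr_ge0 ?sqr_ge0 //.
  exact: le_trans (fronorm_ge0 _) K0_ge.
have e2 : P1 * G2 * H <= P1 * G2 / (4 * C) * Z.
  by rewrite -[leRHS]mulrA ler_wpM2l // mulr_ge0.
have e3 : m%:R * (2 * nu) ^+ 2 / (2 * eta) <=
    m%:R * (2 * nu) ^+ 2 / 2 * Num.sqrt (step_rho m C sigma nu 0) * Z.
  rewrite invfM mulrA -[leRHS]mulrA ler_wpM2l //.
  by rewrite divr_ge0 // mulr_ge0 ?ler0n ?sqr_ge0.
have e4 : T%:R * (m%:R * (eta * g ^+ 2 / 2)) <= m%:R * (g ^+ 2 / 2) / (4 * C) * Z.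
  rewrite [leLHS](_ : _ = m%:R * (g ^+ 2 / 2) * (T%:R * eta)); last by ring.
  rewrite -[leRHS]mulrA ler_wpM2l ?(le_trans H0) //.
  by rewrite mulr_ge0 ?ler0n // divr_ge0 ?sqr_ge0.
have e5 : T%:R * (m%:R * (g * (eta * g * (2 * Num.sqrt m%:R / (1 - beta))))) <=
    m%:R * (g * (g * (2 * Num.sqrt m%:R))) / (4 * C) * Z.
  rewrite [leLHS](_ : _ = m%:R * (g * (g * (2 * Num.sqrt m%:R))) * H); last first.
    by rewrite /H; ring.
  rewrite -[leRHS]mulrA ler_wpM2l //.
  by rewrite mulr_ge0 ?ler0n // mulr_ge0 // mulr_ge0 // mulr_ge0 ?sqrtr_ge0.
have e6 : m%:R * C * kappa ^+ 2 * nu / gamma <= m%:R * C * kappa ^+ 2 * nu / gamma * Z.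
  by rewrite ler_peMr // divr_ge0 ?(ltW g0) // mulr_ge0 ?(ltW nu_gt0) // mulr_ge0 ?sqr_ge0.
have distr (a1 a2 a3 a4 a5 a6 z : R) : (a1 + a2 + a3 + a4 + a5 + a6) * z =
  a1 * z + a2 * z + a3 * z + a4 * z + a5 * z + a6 * z by ring.
rewrite distr (_ : nu0 = nu) // -/P1 -/G2.
have combine (x1 y1 y2 z u1 u2 u3 u4 u5 v1 v2 w1 w2 w3 w4 w5 w6 : R) :
    x1 - y1 <= u1 -> y1 - y2 <= u2 + u3 + u4 -> y2 - z <= u5 -> u1 <= v1 + v2 ->
    v1 <= w1 -> v2 <= w2 -> u2 <= w3 -> u3 <= w4 -> u4 <= w5 -> u5 <= w6 ->
    x1 - z <= w1 + w2 + w3 + w4 + w5 + w6 by lra.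
exact: (combine _ _ _ _ _ _ _ _ _ _ _ _ _ _ _ _ _ hexc hreg hcomp bound_excess
  e1 e2 e3 e4 e5 e6).
Qed.
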